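(* Let $K$ be a field. Given arbitrary integers $r$ and $s$ with $2 \leq r \leq s$, there exist a positive integer $n$ (allowed to be as large as necessary, $n \gg 0$) and a finite simple graph $G$ on the vertex set $[n] = \{1, \ldots, n\}$ for which $$\operatorname{reg}(K[\mathbf{x}, \mathbf{y}]/J_{G}) = r \quad \text{and} \quad \deg h_{K[\mathbf{x}, \mathbf{y}]/J_{G}}(\lambda) = s,$$ where $K[\mathbf{x},\mathbf{y}] = K[x_1,\ldots,x_n,y_1,\ldots,y_n]$ and $J_G$ is the binomial edge ideal of $G$.
   Context: A finite graph is simple if it has no loops and no multiple edges. For a finite simple graph $G$ on $[n]=\{1,\ldots,n\}$ and a field $K$, let $K[\mathbf{x},\mathbf{y}] = K[x_1,\ldots,x_n,y_1,\ldots,y_n]$ be the polynomial ring in $2n$ variables with $\deg x_i = \deg y_j = 1$. The binomial edge ideal $J_G \subset K[\mathbf{x},\mathbf{y}]$ is the ideal generated by the binomials $x_i y_j - x_j y_i$ for which $\{i,j\}$ is an edge of $G$. For a standard graded polynomial ring $S$ over $K$ and a homogeneous ideal $I \subset S$ with $d = \dim S/I$ (Krull dimension), the Hilbert series of $S/I$ has the form $H_{S/I}(\lambda) = (h_0 + h_1\lambda + \cdots + h_s\lambda^s)/(1-\lambda)^d$ with each $h_i \in \mathbb{Z}$ and $h_s \neq 0$; the polynomial $h_{S/I}(\lambda) = h_0 + h_1\lambda + \cdots + h_s\lambda^s$ is the $h$-polynomial of $S/I$. $\operatorname{reg}(S/I)$ denotes the Castelnuovo--Mumford regularity of $S/I$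 (as a graded $S$-module). *)

(* Defs.v *)
From mathcomp Require Import all_boot all_order all_algebra.
From mathcomp Require Import classical_sets mpoly.

Set Implicit Arguments.
Unset Strict Implicit.
Unset Printing Implicit Defensive.

Import GRing.Theory.
Local Open Scope ring_scope.
Local Open Scope classical_set_scope.

Section GradedQuotient.

Variables (K : fieldType) (N : nat).
Local Notation S := {mpoly K[N]}.
Implicit Types I : set S.

(* Primes of S / I are represented by the primes of S containing I.
   [idealr_closed] includes 1 \notin P. *)
Definition is_prime_ideal (P : set S) : Prop :=
  idealr_closed (mem P) /\ prime_idealr_closed (mem P).

(* P 0 `<` P 1 `<` ... `<` P d; the values of P beyond d are irrelevant. *)
Definition is_prime_chain I (d : nat) (P : nat -> set S) : Prop :=
  (forall k, (k <= d)%N -> is_prime_ideal (P k) /\ I `<=` P k) /\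
  (forall k, (k < d)%N -> P k `<` P k.+1).

Definition is_krull_dim I (d : nat) : Prop :=
  (exists P, is_prime_chain I d P) /\
  (forall e P, is_prime_chain I e P -> (e <= d)%N).

(* dim_K (S / I)_i = m: some m forms of degree i induce a K-basis of
   S_i / I_i. *)
Definition is_hilbert_value I (i m : nat) : Prop :=
  exists B : 'I_m -> S,
  [/\ forall k, B k \is i.-homog,
      forall c : 'I_m -> K, I (\sum_k c k *: B k) -> forall k, c k = 0
    & forall f : S, f \is i.-homog ->
        exists c : 'I_m -> K, I (f - \sum_k c k *: B k)].

(* The last clause is h(t) = (1 - t)^d * \sum_i H(i) t^i, read off
   coefficientwise in the power series ring Z[[t]], where 1 - t is a unit. *)
Definition is_h_polynomial I (h : {poly int}) : Prop :=
  exists (d : nat) (H : nat -> nat),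
  [/\ is_krull_dim I d,
      forall i, is_hilbert_value I i (H i)
    & forall i, h`_i =
        \sum_(j < i.+1) ((1 - 'X : {poly int}) ^+ d)`_j * (H (i - j)%N)%:Z].

(* A graded free resolution  ... -> F_1 -> F_0 -> S / I -> 0  with
   F_i = \bigoplus_k S(- gfr_shift i k).  Elements of F_i are row vectors and
   maps act by right multiplication; gfr_aug lists representatives in S of the
   images of the basis of F_0.  The maps have degree 0, so the (k, l) entry of
   gfr_diff i is homogeneous of degree gfr_shift i.+1 k - gfr_shift i l (hence
   0 if this is negative).  Shifts in nat suffice for minimal resolutions, as
   S / I lives in nonnegative degrees. *)
Record graded_free_resolution I := GradedFreeResolution {
  gfr_rank : nat -> nat;
  gfr_shift : forall i, 'I_(gfr_rank i) -> nat;
  gfr_aug : 'cV[S]_(gfr_rank 0);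
  gfr_diff : forall i, 'M[S]_(gfr_rank i.+1, gfr_rank i);
  gfr_aug_homog : forall k, gfr_aug k 0 \is (gfr_shift k).-homog;
  gfr_diff_homog : forall i k l,
    {in msupp (gfr_diff i k l),
      forall m, (mdeg m + gfr_shift l)%N = gfr_shift k};
  gfr_aug_surj : forall f : S,
    exists v : 'rV[S]_(gfr_rank 0), I (f - (v *m gfr_aug) 0 0);
  gfr_exact0 : forall v : 'rV[S]_(gfr_rank 0),
    I ((v *m gfr_aug) 0 0) <-> exists w, v = w *m gfr_diff 0;
  gfr_exact : forall i (v : 'rV[S]_(gfr_rank i.+1)),
    v *m gfr_diff i = 0 <-> exists w, v = w *m gfr_diff i.+1
}.

(* All matrix entries lie in the ideal (X_1, ..., X_N). *)
Definition is_minimal I (F : graded_free_resolution I) : Prop :=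
  forall i k l, (gfr_diff F i k l)@_0%MM = 0.

(* reg(S / I) = max { j - i | beta_{i,j}(S / I) <> 0 }, where beta_{i,j} is the
   number of shifts equal to j in step i of the minimal graded free resolution,
   which is unique up to isomorphism. *)
Definition is_regularity I (r : nat) : Prop :=
  exists F : graded_free_resolution I,
  [/\ is_minimal F,
      exists i (k : 'I_(gfr_rank F i)), gfr_shift k = (i + r)%N
    & forall i (k : 'I_(gfr_rank F i)), (gfr_shift k <= i + r)%N].

End GradedQuotient.

(* K[x, y] is {mpoly K[n + n]}: the first n variables are the x_i, the last n
   the y_i. *)
Definition xvar (K : fieldType) (n : nat) (i : 'I_n) : {mpoly K[n + n]} :=
  'X_(lshift n i).

Definition yvar (K : fieldType) (n : nat) (i : 'I_n) : {mpoly K[n + n]} :=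
  'X_(rshift n i).

Definition binomial_edge_ideal (K : fieldType) (n : nat) (e : rel 'I_n) :
    set {mpoly K[n + n]} :=
  [set p | exists c : 'I_n -> 'I_n -> {mpoly K[n + n]},
     p = \sum_(i < n) \sum_(j < n | e i j)
           c i j * (xvar K i * yvar K j - xvar K j * yvar K i)].

Arguments binomial_edge_ideal K {n} e.

(* Main.v *)
Require Import Defs.
From HB Require Import structures.
From mathcomp Require Import all_boot all_order all_algebra.
From mathcomp Require Import classical_sets mpoly.
From mathcomp Require boolp.
From mathcomp Require Import ring zify.

Set Implicit Arguments.
Unset Strict Implicit.
Unset Printing Implicit Defensive.

Import GRing.Theory.
Local Open Scope ring_scope.

(* The graph is a star K_{1,m} together with k = r - 2 disjoint edges, where
   m = s - r + 2.

   Let J be the ideal of the star with centre 0 and leaves 1, ..., m.  The ideal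
   N = (x_0, y_0) / J is a free module of finite rank over a polynomial subring
   A, with basis x_0, y_0, x_0 x_2, ..., x_0 x_m, and the remaining variables
   x_1, ..., x_m act on it by commuting matrices T_i over A.  The Koszul complex
   of the x_i - T_i is therefore a graded free resolution of N over S = A[x].  The
   horseshoe lemma with the Koszul resolution of S / (x_0, y_0) gives a resolution
   of S / J, and each disjoint edge adds a nonzerodivisor of degree 2, i.e. a
   mapping cone.  The result has length m + k, shifts at most i + k + 2 in step i,
   and K-polynomial
     (1 - t^2)^k ((1 - t)^m (2 t + (m - 1) t^2) + (1 - t)^2),
   of degree m + 2k + 2.  Cancelling the unit entries yields a minimal resolution
   with the same bounds and the same K-polynomial; since the degree of the latter
   is the largest shift that the bounds allow, the regularity is k + 2 = r.

   The quotient has dimension 2m + 3k, and dividing the K-polynomial by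
   (1 - t)^(k + 2) gives
     h = (1 + t)^k (1 + (2 t + (m - 1) t^2) (1 - t)^(m - 2)),
   of degree m + k = s.  The dimension is at most 2m + 3k because for a chain
   P_0 < ... < P_e of primes any f_i in P_(i+1) \ P_i are algebraically
   independent modulo P_0, so that e is bounded by the growth of the Hilbert
   function; kernels of explicit substitutions give a chain of that length. *)

(** * Graded modules and free resolutions *)

(** In the variables of the star, the zero set of J has a component of dimension m + 2, where all
    columns (x_i, y_i) are proportional, and the component x_0 = y_0 = 0 of dimension 2m. N lives on
    the former and S / (x_0, y_0) on the latter; over the denominator (1 - t)^(2m) the series of N
    acquires the factor (1 - t)^(m - 2). This raises the degree of h by m - 2 = s - r without
    touching the regularity, while a disjoint edge raises both by one. A is generated by x_0, y_m,
    the differences x_(i+1) - y_i and the variables outside the star. For these forms the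
    parametrization x_i = u_i, y_i = u_i w turns the freeness of N into a count of degrees in w
    modulo m + 1. Freeness makes the matrices T_i unique, and hence commuting. Regular elements are
    all detected in the same way: a substitution S -> S[t] that translates some variables by t
    preserves what was built so far and makes the new element monic in t. No Betti number is
    computed; a bound on the shifts and one coefficient of the K-polynomial suffice for the
    regularity. *)

Section GradedModules.

(* A grading of S in nonnegative degrees is encoded by the coaction S -> S[t]
   sending p to the sum of p_d t^d, where p_d is the component of degree d. *)
Variables (S : comNzRingType) (sc : {rmorphism S -> {poly S}}).
Hypothesis sc_coef : forall p d, sc (sc p)`_d = ((sc p)`_d)%:P * 'X^d.

(* An entry of a homogeneous matrix in a row of shift s and a column of shift t:
   a is homogeneous of degree s - t, hence 0 if s < t. *)
Definition homog_entry (s t : nat) (a : S) := sc a * 'X^t = a%:P * 'X^s.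

Definition homog_mx p q (c : 'I_p -> nat) (b : 'I_q -> nat) (A : 'M[S]_(p, q)) :=
  forall k l, homog_entry (c k) (b l) (A k l).

Definition component q (b : 'I_q -> nat) d (v : 'rV[S]_q) : 'rV[S]_q :=
  \row_k (sc (v 0 k) * 'X^(b k))`_d.

Lemma hentry_component (b d : nat) p : homog_entry d b (sc p * 'X^b)`_d.
Proof.
rewrite /homog_entry coefMXn; case: ltnP => h; first by rewrite rmorph0 !mul0r.
by rewrite sc_coef -mulrA -exprD subnK.
Qed.

(** The coaction is multiplicative, and homogeneity of [A k l] trades the factor ['X^(b l)] for
    ['X^(c k)]. *)
Lemma component_mul p q (c : 'I_p -> nat) (b : 'I_q -> nat) A d v :
  homog_mx c b A -> component b d (v *m A) = component c d v *m A.
Proof.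
move=> hA; apply/rowP => l; rewrite !mxE rmorph_sum mulr_suml coef_sum.
apply: eq_bigr => k _.
have -> : sc (v 0 k * A k l) * 'X^(b l) = sc (v 0 k) * 'X^(c k) * (A k l)%:P.
  rewrite rmorphM -!mulrA; congr (_ * _).
  by rewrite [RHS]mulrC; exact: hA.
by rewrite coefMC !mxE.
Qed.

Lemma component0 q (b : 'I_q -> nat) d : component b d 0 = 0.
Proof. by apply/rowP=> k; rewrite !mxE rmorph0 mul0r coef0. Qed.

Lemma component_id q (b : 'I_q -> nat) d (v : 'rV[S]_q) :
  (forall k, homog_entry d (b k) (v 0 k)) <-> component b d v = v.
Proof.
split=> [h | <- k]; last by rewrite mxE; exact: hentry_component.
by apply/rowP => k; rewrite mxE h coefCM coefXn eqxx mulr1.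
Qed.

Lemma component_idem q (b : 'I_q -> nat) d (v : 'rV[S]_q) :
  component b d (component b d v) = component b d v.
Proof. by apply/component_id => k; rewrite mxE; apply: hentry_component. Qed.

Definition submodule q (L : 'rV[S]_q -> Prop) :=
  L 0 /\ forall a u v, L u -> L v -> L (a *: u + v).

Definition graded q (b : 'I_q -> nat) (L : 'rV[S]_q -> Prop) :=
  forall v, L v -> forall d, L (component b d v).

Section Smod.
Variables (q : nat) (L : 'rV[S]_q -> Prop) (hL : submodule L).

Lemma submoduleD u v : L u -> L v -> L (u + v).
Proof. by move=> hu hv; rewrite -[u]scale1r; apply: hL.2. Qed.

Lemma submoduleZ a u : L u -> L (a *: u).
Proof. by move=> hu; rewrite -[_ *: _]addr0; apply: hL.2 => //; exact: hL.1. Qed.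

Lemma submoduleN u : L u -> L (- u).
Proof. by move=> hu; rewrite -scaleN1r; apply: submoduleZ. Qed.

Lemma submoduleB u v : L u -> L v -> L (u - v).
Proof. by move=> hu hv; apply: submoduleD => //; apply: submoduleN. Qed.

Lemma submodule_sum (I : Type) (r : seq I) (P : pred I) (F : I -> 'rV[S]_q) :
  (forall i, P i -> L (F i)) -> L (\sum_(i <- r | P i) F i).
Proof. by move=> h; elim/big_ind: _ => //; [exact: hL.1 | exact: submoduleD]. Qed.

Lemma submodule_mulmx p (A : 'M[S]_(p, q)) (w : 'rV_p) :
  (forall k, L (row k A)) -> L (w *m A).
Proof.
by move=> h; rewrite mulmx_sum_row; apply: submodule_sum => k _; apply: submoduleZ.
Qed.

End Smod.

Definition rowspan p q (A : 'M[S]_(p, q)) (v : 'rV[S]_q) := exists w, v = w *m A.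

Definition kernel p q (A : 'M[S]_(p, q)) (w : 'rV[S]_p) := w *m A = 0.

Lemma submodule_kernel p q (A : 'M[S]_(p, q)) : submodule (kernel A).
Proof.
split; first by rewrite /kernel mul0mx.
by move=> a u v; rewrite /kernel mulmxDl -scalemxAl => -> ->; rewrite scaler0 addr0.
Qed.

Lemma submodule_rowspan p q (A : 'M[S]_(p, q)) : submodule (rowspan A).
Proof.
split; first by exists 0; rewrite mul0mx.
by move=> a u v [w ->] [w' ->]; exists (a *: w + w'); rewrite mulmxDl -scalemxAl.
Qed.

Lemma graded_kernel p q c b (A : 'M[S]_(p, q)) : homog_mx c b A -> graded c (kernel A).
Proof. by move=> hA v hv d; rewrite /kernel -(component_mul d v hA) hv component0. Qed.

Lemma row_rowspan p q (A : 'M[S]_(p, q)) k : rowspan A (row k A).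
Proof. by exists (delta_mx 0 k); rewrite -rowE. Qed.

(* A submodule L of S(-b_1) + ... + S(-b_q) has a graded free resolution of
   length at most l whose i-th step only has shifts at most r + i; P is the
   K-polynomial of L, the alternating sum of 'X^c over the shifts c. *)
Fixpoint fres (l r q : nat) (b : 'I_q -> nat) (L : 'rV[S]_q -> Prop)
    (P : {poly int}) : Prop :=
  if l is l'.+1 then
    exists p (c : 'I_p -> nat) (A : 'M[S]_(p, q)) (P' : {poly int}),
    [/\ homog_mx c b A, forall k, (c k <= r)%N, forall v, L v <-> rowspan A v,
        fres l' r.+1 c (kernel A) P' & P = \sum_k 'X^(c k) - P']
  else (forall v, L v <-> v = 0) /\ P = 0.

Lemma fres_eq l r q b (L L' : 'rV[S]_q -> Prop) P :
  (forall v, L v <-> L' v) -> fres l r b L P -> fres l r b L' P.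
Proof.
case: l => [|l] e /=.
  by case=> h ->; split=> // v; rewrite -e.
move=> [p [c [A [P' [h1 h2 h3 h4 h5]]]]]; exists p, c, A, P'; split=> // v.
by rewrite -e.
Qed.

Lemma fres_pad l r q b (L : 'rV[S]_q -> Prop) P :
  fres l r b L P -> fres l.+1 r b L P.
Proof.
elim: l r q b L P => [|l IH] r q b L P.
  move=> [h ->]; exists 0%N, (fun=> 0%N), 0, 0; split.
  - by case.
  - by case.
  - move=> v; rewrite h; split=> [->|[w ->]]; first by exists 0; rewrite mul0mx.
    by rewrite mulmx0.
  - split=> // v; split=> [_|->]; last by rewrite /kernel mul0mx.
    by apply/rowP; case.
  - by rewrite big_ord0 subr0.
move=> [p [c [A [P' [h1 h2 h3 h4 h5]]]]]; exists p, c, A, P'; split=> //.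
exact: IH.
Qed.

Lemma fres_leql l l' r q b (L : 'rV[S]_q -> Prop) P :
  (l <= l')%N -> fres l r b L P -> fres l' r b L P.
Proof.
move=> /subnK <- h; elim: (l' - l)%N => //= n IH; exact: fres_pad.
Qed.

Lemma fres_leqr l r r' q b (L : 'rV[S]_q -> Prop) P :
  (r <= r')%N -> fres l r b L P -> fres l r' b L P.
Proof.
elim: l r r' q b L P => [|l IH] r r' q b L P le_r //.
move=> [p [c [A [P' [h1 h2 h3 h4 h5]]]]]; exists p, c, A, P'; split=> //.
  by move=> k; apply: leq_trans le_r.
exact: IH h4.
Qed.

Lemma fres_shift e l r q (b : 'I_q -> nat) (L : 'rV[S]_q -> Prop) P :
  fres l r b L P -> fres l (r + e) (fun k => b k + e)%N L ('X^e * P).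
Proof.
elim: l r q b L P => [|l IH] r q b L P.
  by move=> [h ->]; split=> //; rewrite mulr0.
move=> [p [c [A [P' [h1 h2 h3 h4 h5]]]]].
exists p, (fun k => c k + e)%N, A, ('X^e * P'); split=> //.
- by move=> k l'; rewrite /homog_entry !exprD !mulrA h1.
- by move=> k; rewrite leq_add2r.
- by rewrite -addSn; apply: IH.
- rewrite h5 mulrBr mulr_sumr; congr (_ - _).
  by apply: eq_bigr => k _; rewrite exprD mulrC.
Qed.

Lemma submodule_fres l r q b (L : 'rV[S]_q -> Prop) P : fres l r b L P -> submodule L.
Proof.
(* Padding provides a generating matrix also when the length is 0. *)
move=> /fres_pad [p [c [A [P' [_ _ h _ _]]]]].
have [s1 s2] := submodule_rowspan A.
split; first exact/h.
by move=> a u v /h hu /h hv; apply/h; apply: s2.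
Qed.

Definition shift_cat p q (b1 : 'I_p -> nat) (b2 : 'I_q -> nat) (k : 'I_(p + q)) :=
  match split k with inl i => b1 i | inr j => b2 j end.

Lemma shift_catl p q (b1 : 'I_p -> nat) (b2 : 'I_q -> nat) i :
  shift_cat b1 b2 (lshift q i) = b1 i.
Proof. by rewrite /shift_cat (unsplitK (inl i : 'I_p + 'I_q)). Qed.

Lemma shift_catr p q (b1 : 'I_p -> nat) (b2 : 'I_q -> nat) i :
  shift_cat b1 b2 (rshift p i) = b2 i.
Proof. by rewrite /shift_cat (unsplitK (inr i : 'I_p + 'I_q)). Qed.

Lemma shift_catP p q (b1 : 'I_p -> nat) (b2 : 'I_q -> nat) (T : nat -> Prop) :
  (forall i, T (b1 i)) -> (forall i, T (b2 i)) -> forall k, T (shift_cat b1 b2 k).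
Proof. by move=> h1 h2 k; rewrite /shift_cat; case: split. Qed.

Lemma component_row_mx p q (b1 : 'I_p -> nat) (b2 : 'I_q -> nat) d u v :
  component (shift_cat b1 b2) d (row_mx u v) =
  row_mx (component b1 d u) (component b2 d v).
Proof.
apply/rowP => k; rewrite -[k]splitK /unsplit; case: (split k) => i.
  by rewrite row_mxEl !mxE shift_catl (unsplitK (inl i : 'I_p + 'I_q)).
by rewrite row_mxEr !mxE shift_catr (unsplitK (inr i : 'I_p + 'I_q)).
Qed.

Lemma homog_mx0 p q (b : 'I_p -> nat) (c : 'I_q -> nat) : homog_mx b c 0.
Proof. by move=> k l; rewrite /homog_entry mxE rmorph0 !mul0r. Qed.

Lemma homog_mx_col p1 p2 q (c1 : 'I_p1 -> nat) (c2 : 'I_p2 -> nat) (b : 'I_q -> nat) A B :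
  homog_mx c1 b A -> homog_mx c2 b B -> homog_mx (shift_cat c1 c2) b (col_mx A B).
Proof.
move=> hA hB k l; rewrite -[k](splitK) /unsplit; case: (split k) => i.
  by rewrite shift_catl col_mxEu; apply: hA.
by rewrite shift_catr col_mxEd; apply: hB.
Qed.

Lemma homog_mx_row p q1 q2 (c : 'I_p -> nat) (b1 : 'I_q1 -> nat) (b2 : 'I_q2 -> nat) A B :
  homog_mx c b1 A -> homog_mx c b2 B -> homog_mx c (shift_cat b1 b2) (row_mx A B).
Proof.
move=> hA hB k l; rewrite -[l](splitK) /unsplit; case: (split l) => i.
  by rewrite shift_catl row_mxEl; apply: hA.
by rewrite shift_catr row_mxEr; apply: hB.
Qed.

Lemma homog_mx_row_component p q c b (A : 'M[S]_(p, q)) :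
  homog_mx c b A <-> forall k, component b (c k) (row k A) = row k A.
Proof.
split=> h k; first by apply/component_id => l; rewrite mxE; apply: h.
by move=> l; have /component_id /(_ l) := h k; rewrite mxE.
Qed.

End GradedModules.

(** * Horseshoe lemma, mapping cones and injectivity by monic substitution *)

Section Extensions.

Variables (S : comNzRingType) (sc : {rmorphism S -> {poly S}}).
Hypothesis sc_coef : forall p d, sc (sc p)`_d = ((sc p)`_d)%:P * 'X^d.
Local Notation homog_mx := (homog_mx sc).
Local Notation component := (component sc).
Local Notation graded := (graded sc).
Local Notation fres := (fres sc).

Lemma sum_shift_cat p q (b1 : 'I_p -> nat) (b2 : 'I_q -> nat) :
  \sum_k 'X^(shift_cat b1 b2 k) =
  \sum_k 'X^(b1 k) + \sum_k 'X^(b2 k) :> {poly int}.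
Proof.
rewrite big_split_ord /=; congr (_ + _); apply: eq_bigr => k _.
  by rewrite shift_catl.
by rewrite shift_catr.
Qed.

(* The horseshoe lemma: W is an extension of its projection to the last q
   coordinates by its intersection with the first p coordinates. *)
Lemma fres_ext l r p q (b1 : 'I_p -> nat) (b2 : 'I_q -> nat)
    (W : 'rV[S]_(p + q) -> Prop) P1 P2 :
  submodule W -> graded (shift_cat b1 b2) W ->
  fres l r b1 (fun u => W (row_mx u 0)) P1 ->
  fres l r b2 (fun v => exists u, W (row_mx u v)) P2 ->
  fres l r (shift_cat b1 b2) W (P1 + P2).
Proof.
elim: l r p q b1 b2 W P1 P2 => [|l IH] r p q b1 b2 W P1 P2 sW gW /=.
  move=> [h1 ->] [h2 ->]; split; last by rewrite addr0.
  move=> w; split=> [|->]; last exact: sW.1.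
  rewrite -[w]hsubmxK => hw; move: (hw).
  have -> : rsubmx w = 0 by apply/h2; exists (lsubmx w).
  by move/h1 => ->; rewrite row_mx0.
move=> [p1 [c1 [A1 [Q1 [hA1 r1 e1 f1 ->]]]]] [p2 [c2 [A2 [Q2 [hA2 r2 e2 f2 ->]]]]].
(* A lift of row [k] of [A2] to [W] can be taken homogeneous: the component of degree [c2 k] of any
   lift lies in [W] and still projects to that row. *)
have /boolp.choice [psi hpsi] : forall k : 'I_p2, exists u : 'rV[S]_p,
    component b1 (c2 k) u = u /\ W (row_mx u (row k A2)).
  move=> k.
  have /e2 [u hu] := row_rowspan A2 k.
  exists (component b1 (c2 k) u); split.
    exact: (component_idem sc_coef).
  move: (gW _ hu (c2 k)); rewrite component_row_mx.
  by rewrite ((homog_mx_row_component sc_coef _ _ _).1 hA2).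
pose Psi := \matrix_k psi k.
have rPsi k : row k Psi = psi k by rewrite rowK.
have hPsi : homog_mx c2 b1 Psi.
  refine ((homog_mx_row_component sc_coef c2 b1 Psi).2 _) => k; rewrite rPsi; by case: (hpsi k).
pose M := block_mx A1 0 Psi A2.
have kM s u : kernel M (row_mx s u) <-> s *m A1 + u *m Psi = 0 /\ u *m A2 = 0.
  rewrite /kernel mul_row_block mulmx0 add0r -[0 in X in X <-> _]row_mx0.
  by split=> [/eq_row_mx //|[-> ->]].
have hM : homog_mx (shift_cat c1 c2) (shift_cat b1 b2) M.
  by apply: homog_mx_col; apply: homog_mx_row => //; apply: homog_mx0.
exists (p1 + p2)%N, (shift_cat c1 c2), M, (Q1 + Q2); split=> //.
- exact: (shift_catP (T := fun x => x <= r)%N).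
- move=> w; split.
    rewrite -[w]hsubmxK => hw.
    have /e2 [z hz] : exists u, W (row_mx u (rsubmx w)) by exists (lsubmx w).
    have hz' : W (row_mx (z *m Psi) (z *m A2)).
      rewrite -mul_mx_row; apply: submodule_mulmx => // k.
      by rewrite row_row_mx rPsi; case: (hpsi k).
    have := submoduleB sW hw hz'; rewrite opp_row_mx add_row_mx hz subrr.
    move=> /e1 [y hy]; exists (row_mx y z).
    by rewrite mul_row_block mulmx0 add0r -hy subrK.
  move=> [z ->]; apply: submodule_mulmx => // k.
  rewrite -[k](splitK) /unsplit; case: (split k) => i.
    by rewrite /M /block_mx rowKu row_row_mx row0; apply/e1; apply: row_rowspan.
  by rewrite /M /block_mx rowKd row_row_mx rPsi; case: (hpsi i).
- apply: IH.
  + exact: submodule_kernel.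
  + exact: graded_kernel hM.
  + apply: fres_eq f1 => v; rewrite kM mul0mx addr0 mul0mx.
    by split=> [|[]].
  (* Every syzygy of [A2] extends to one of [M]: its combination of the rows of [Psi] lies in the
     first part of [W], which the rows of [A1] generate. *)
  + apply: fres_eq f2 => v; split; last by move=> [u /kM []].
    move=> hv; have /e1 [w hw] : W (row_mx (v *m Psi) 0).
      rewrite -[X in row_mx _ X]hv -mul_mx_row; apply: submodule_mulmx => // k.
      by rewrite row_row_mx rPsi; case: (hpsi k).
    by exists (- w); rewrite kM mulNmx -hw addNr.
- by rewrite sum_shift_cat; ring.
Qed.

(* The mapping cone of the multiplication by Phi on S^q / L. *)
Lemma fres_cone l r r' e q (b : 'I_q -> nat) (L : 'rV[S]_q -> Prop) P
    (Phi : 'M[S]_q) :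
  fres l r b L P -> homog_mx (fun k => b k + e)%N b Phi ->
  (forall v, L v <-> L (v *m Phi)) ->
  (r <= r')%N -> (r + e <= r'.+1)%N -> (forall k, b k + e <= r')%N ->
  fres l.+1 r' b (fun v => exists u w, L u /\ v = u + w *m Phi)
    (P + 'X^e * (\sum_k 'X^(b k) - P)).
Proof.
move=> fL hPhi LPhi le1 le2 le3.
have sL := submodule_fres fL.
have [p [c [A [P' [hA rA eA fA eP]]]]] := fres_pad fL.
have hM : homog_mx (shift_cat c (fun k => b k + e)%N) b (col_mx A Phi) by exact: homog_mx_col.
exists (p + q)%N, (shift_cat c (fun k => b k + e)%N), (col_mx A Phi), (P' + 'X^e * P).
split=> //.
- apply: (shift_catP (T := fun x => x <= r')%N) => // k.
  exact: leq_trans (rA k) _.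
- move=> v; split=> [[u [w [/eA [z ->] ->]]]|[z]].
    by exists (row_mx z w); rewrite mul_row_col.
  rewrite -[z]hsubmxK mul_row_col => ->.
  by exists (lsubmx z *m A), (rsubmx z); split=> //; apply/eA; exists (lsubmx z).
(* The syzygies of the stacked matrix form an extension: those supported on [A] are the kernel of
   [A], and by injectivity of [Phi] modulo [L] the last coordinates run through [L], shifted by
   [e]. *)
- have kM s u : kernel (col_mx A Phi) (row_mx s u) <-> s *m A + u *m Phi = 0.
    by rewrite /kernel mul_row_col.
  apply: fres_ext.
  + exact: submodule_kernel.
  + exact: graded_kernel hM.
  + apply: fres_leqr (fres_eq _ fA) => // v.
    by rewrite kM mul0mx addr0.
  + apply: fres_leqr (fres_eq _ (fres_shift e fL)) => // v.
    split=> [/LPhi/eA [z hz]|[u /kM h]].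
      by exists (- z); rewrite kM mulNmx -hz addNr.
    apply/LPhi; apply/eA; exists (- u); rewrite mulNmx.
    by apply/eqP; rewrite -addr_eq0 addrC h.
- rewrite sum_shift_cat eP.
  under [X in _ = _ + X - _]eq_bigr do rewrite exprD mulrC.
  by rewrite -mulr_sumr; ring.
Qed.

Definition coef_vec (f : S -> {poly S}) e q (v : 'rV[S]_q) : 'rV[S]_q :=
  \row_k (f (v 0 k))`_e.

Lemma coef_vecD (f : {rmorphism S -> {poly S}}) e n (u v : 'rV[S]_n) :
  coef_vec f e (u + v) = coef_vec f e u + coef_vec f e v.
Proof. by apply/rowP => k; rewrite !mxE rmorphD coefD. Qed.

Lemma coef_vec_mul (f : {rmorphism S -> {poly S}}) e n p (v : 'rV[S]_n)
    (M : 'M[S]_(n, p)) :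
  (forall k l, f (M k l) = (M k l)%:P) -> coef_vec f e (v *m M) = coef_vec f e v *m M.
Proof.
move=> fM; apply/rowP => l; rewrite !mxE rmorph_sum coef_sum.
by apply: eq_bigr => k _; rewrite rmorphM fM coefMC mxE.
Qed.

(* If a substitution S -> S[t] turns Phi into a polynomial which is monic in t,
   then Phi is injective modulo every L compatible with the substitution:
   compare the coefficients of t from the top. *)
Lemma monic_regular (tau : {rmorphism S -> {poly S}}) q (L : 'rV[S]_q -> Prop)
    (D : nat) (Psi : nat -> 'M[S]_q) (Phi : 'M[S]_q) :
  (forall s, (tau s).[0] = s) -> submodule L ->
  (forall v e, L v -> L (coef_vec tau e v)) ->
  (forall k l, tau (Phi k l) = \sum_(e < D.+1) (Psi e k l)%:P * 'X^e) ->
  Psi D = 1%:M -> (forall e v, L v -> L (v *m Psi e)) ->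
  forall v, L (v *m Phi) -> L v.
Proof.
move=> tau0 sL tauL tauPhi PsiD LPsi v hv.
pose co i := coef_vec tau i v.
(* The coefficient of [t^n] in the image of [v *m Phi]; the bound [D <= n] keeps [n - e] from being
   truncated. *)
have hco n : (D <= n)%N -> L (\sum_(e < D.+1) co (n - e)%N *m Psi e).
  move=> hn; have := tauL _ n hv; congr L; apply/rowP => l.
  rewrite !mxE summxE rmorph_sum coef_sum.
  transitivity (\sum_(e < D.+1) \sum_k (tau (v 0 k))`_(n - e) * Psi e k l); last first.
    by apply: eq_bigr => e _; rewrite mxE; apply: eq_bigr => k _; rewrite mxE.
  rewrite exchange_big /=; apply: eq_bigr => k _.
  rewrite rmorphM tauPhi mulr_sumr coef_sum.
  apply: eq_bigr => e _; rewrite mulrA coefMXn ltnNge.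
  by rewrite (leq_trans _ hn) ?coefMC // -ltnS.
have [B hB] : exists B, forall i, (B <= i)%N -> co i = 0.
  pose F k := size (tau (v 0 k)).
  exists (\max_k F k) => i hi; apply/rowP => k; rewrite !mxE.
  by apply: nth_default; apply: leq_trans hi; apply: (leq_bigmax (F := F)).
(* Descending induction from the degree [B] beyond which all coefficients vanish; [n] bounds the
   distance from [i] to [B]. *)
suff h n : forall i, (B <= i + n)%N -> L (co i).
  have <- : co 0%N = v by apply/rowP => k; rewrite mxE -horner_coef0 tau0.
  by apply: (h B); rewrite add0n.
elim: n => [|n IH] i hi; first by rewrite hB; [exact: sL.1 | rewrite addn0 in hi].
have := hco (i + D)%N (leq_addl _ _); rewrite big_ord_recr /= addnK PsiD mulmx1.
move=> h; rewrite -[co i](addKr (\sum_(e < D) co (i + D - e)%N *m Psi e)).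
rewrite addrC; apply: submoduleB => //; apply: submodule_sum => // e _.
apply: LPsi; apply: IH; apply: leq_trans hi _.
by have := ltn_ord e; lia.
Qed.

End Extensions.

(** * Minimal resolutions *)

Section Minimal.

Variables (S : comNzRingType) (sc : {rmorphism S -> {poly S}}).
Variables (K : fieldType) (aug : {rmorphism S -> K}).
Hypothesis unitE : forall s t a, homog_entry sc s t a -> aug a != 0 ->
  s = t /\ exists u, u * a = 1 /\ sc u = u%:P.
Local Notation hentry := (homog_entry sc).
Local Notation homog_mx := (homog_mx sc).
Local Notation fres := (fres sc).

Lemma hentryB s t a a' : hentry s t a -> hentry s t a' -> hentry s t (a - a').
Proof. by rewrite /homog_entry rmorphB mulrBl polyCB mulrBl => -> ->. Qed.

Lemma hentryM s t u a a' : hentry s t a -> hentry t u a' -> hentry s u (a * a').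
Proof.
rewrite /homog_entry rmorphM polyCM => h h'.
by rewrite -mulrA h' mulrCA h mulrCA mulrA.
Qed.

Lemma hentryZ s t a u : sc u = u%:P -> hentry s t a -> hentry s t (u * a).
Proof. by rewrite /homog_entry rmorphM polyCM => -> h; rewrite -!mulrA h. Qed.

Lemma hentry_sum s t (I : Type) (r : seq I) (Q : pred I) F :
  (forall i, Q i -> hentry s t (F i)) -> hentry s t (\sum_(i <- r | Q i) F i).
Proof.
rewrite /homog_entry => h; rewrite rmorph_sum raddf_sum !mulr_suml.
by apply: eq_bigr.
Qed.

Lemma hentry_add e s t a : hentry s t a -> hentry (s + e) (t + e) a.
Proof. by rewrite /homog_entry !exprD !mulrA => ->. Qed.

Lemma homog_mx_scalar (n : nat) d a (b : 'I_n -> nat) :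
  hentry d 0 a -> homog_mx (fun k => b k + d)%N b a%:M.
Proof.
move=> ha k l; rewrite !mxE; case: (k =P l) => [<-|_]; rewrite ?mulr1n ?mulr0n.
  by have := hentry_add (b k) ha; rewrite add0n addnC.
by rewrite /homog_entry rmorph0 !mul0r.
Qed.

Lemma homog_mx_mul p q r b c d (A : 'M[S]_(p, q)) (B : 'M_(q, r)) :
  homog_mx b c A -> homog_mx c d B -> homog_mx b d (A *m B).
Proof.
move=> hA hB k l; rewrite mxE; apply: hentry_sum => i _.
exact: hentryM (hA k i) (hB i l).
Qed.

Section Insert.
Variables (p : nat) (k : 'I_p.+1).

Definition insert_mx : 'M[S]_(p, p.+1) := row' k 1%:M.

Lemma insert_mxE (m : nat) (w : 'M[S]_(m, p)) i j :
  (w *m insert_mx) i j = if unlift k j is Some j' then w i j' else 0.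
Proof.
rewrite mxE; case: unliftP => [j' ->|->].
  rewrite (bigD1 j') //= big1 ?addr0 => [|i' ne].
    by rewrite !mxE eqxx mulr1.
  by rewrite !mxE (inj_eq lift_inj) (negbTE ne) mulr0.
by apply: big1 => i' _; rewrite !mxE eq_sym (negbTE (neq_lift _ _)) mulr0.
Qed.

Lemma insert_mxK m (w : 'M[S]_(m, p)) : col' k (w *m insert_mx) = w.
Proof. by apply/matrixP => i j; rewrite mxE insert_mxE liftK. Qed.

Lemma insert_mx_eq0 m (w : 'M[S]_(m, p)) i : (w *m insert_mx) i k = 0.
Proof. by rewrite insert_mxE unlift_none. Qed.

Lemma col'_insert m (v : 'M[S]_(m, p.+1)) :
  (forall i, v i k = 0) -> col' k v *m insert_mx = v.
Proof.
move=> v0; apply/matrixP => i j; rewrite insert_mxE.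
by case: unliftP => [j' ->|->]; rewrite ?v0 // mxE.
Qed.

Lemma row_insert n (w : 'rV[S]_p.+1) (A : 'M[S]_(p.+1, n)) :
  w *m A = w 0 k *: row k A + col' k w *m row' k A.
Proof.
apply/rowP => j; rewrite !mxE (bigD1_ord k) //=; congr (_ + _).
by apply: eq_bigr => i _; rewrite !mxE.
Qed.

Lemma insert_mulmx m n (w : 'M[S]_(m, p)) (A : 'M[S]_(p.+1, n)) :
  w *m insert_mx *m A = w *m row' k A.
Proof.
rewrite -mulmxA; congr (_ *m _); apply/matrixP => i j.
rewrite mxE (bigD1 (lift k i)) //= !mxE eqxx mul1r big1 ?addr0 // => l ne.
by rewrite !mxE eq_sym (negbTE ne) mul0r.
Qed.

Lemma mul_col' m n (A : 'M[S]_(m, n)) (B : 'M_(n, p.+1)) :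
  A *m col' k B = col' k (A *m B).
Proof. by apply/matrixP => i j; rewrite !mxE; apply: eq_bigr => l _; rewrite mxE. Qed.

Lemma insert_homog_mx (b : 'I_p.+1 -> nat) : homog_mx (b \o lift k) b insert_mx.
Proof.
move=> i j; rewrite /homog_entry !mxE; case: eqP => [<-|_].
  by rewrite rmorph1.
by rewrite rmorph0 !mul0r.
Qed.

End Insert.

(** If forgetting coordinate [k] is injective on [L], then [A] and [col' k A] have the same kernel,
    so the rest of the resolution is kept. *)
Lemma fres_drop l r p (b : 'I_p.+1 -> nat) k (L : 'rV[S]_p.+1 -> Prop) P :
  fres l r b L P -> (forall v, L v -> col' k v = 0 -> v = 0) ->
  fres l r (b \o lift k) (fun w => exists v, L v /\ w = col' k v) P.
Proof.
case: l => [|l] /=.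
  move=> [h ->] _; split=> // w; split=> [[v [/h -> ->]]|->].
    by apply/rowP => j; rewrite !mxE.
  by exists 0; split; [apply/h | apply/rowP => j; rewrite !mxE].
move=> [p' [c [A [P' [hA rA eA fA ->]]]]] inj.
exists p', c, (col' k A), P'; split=> //.
- by move=> i j; rewrite mxE; apply: hA.
- move=> w; split=> [[v [/eA [z ->] ->]]|[z ->]].
    by exists z; rewrite mul_col'.
  by exists (z *m A); split; [apply/eA; exists z | rewrite mul_col'].
- apply: fres_eq fA => z; rewrite /kernel mul_col'; split=> [->|h].
    by apply/rowP => j; rewrite !mxE.
  by apply: inj h; apply/eA; exists z.
Qed.

(** [v] is a combination of homogeneous generators, so one of these has a nonzero constant term at
    [k]; being homogeneous, that entry is a unit. *)
Lemma unit_vector l r p (b : 'I_p -> nat) (L : 'rV[S]_p -> Prop) P k v :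
  fres l r b L P -> L v -> aug (v 0 k) != 0 -> exists2 v1, L v1 & v1 0 k = 1.
Proof.
move=> /fres_pad [p' [c [A [P' [hA _ eA _ _]]]]] /eA [z ->].
rewrite mxE rmorph_sum => nz.
have [i nzi] : exists i, aug (A i k) != 0.
  apply/existsP; apply: contraNT nz; rewrite negb_exists => /forallP h.
  apply/eqP; apply: big1 => i _; rewrite rmorphM.
  by have := h i; rewrite negbK => /eqP ->; rewrite mulr0.
have [_ [u [u1 _]]] := unitE (hA i k) nzi.
exists (u *: row i A); last by rewrite !mxE.
by apply/eA; exists (u *: delta_mx 0 i); rewrite -scalemxAl -rowE.
Qed.

(* Cancellation of a unit entry of a differential. *)
Lemma fres_split l r p (b : 'I_p.+1 -> nat) (L : 'rV[S]_p.+1 -> Prop) P k v :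
  fres l r b L P -> L v -> aug (v 0 k) != 0 ->
  fres l r (b \o lift k) (fun w => L (w *m insert_mx k)) (P - 'X^(b k)).
Proof.
case: l => [|l] /=.
  by move=> [h _] /h ->; rewrite mxE rmorph0 eqxx.
move=> [p' [c [A [P' [hA rA eA fA ->]]]]] /eA [z0 ->].
rewrite mxE rmorph_sum => nz.
have [i0 nzi] : exists i, aug (A i k) != 0.
  apply/existsP; apply: contraNT nz; rewrite negb_exists => /forallP h.
  apply/eqP; apply: big1 => i _; rewrite rmorphM.
  by have := h i; rewrite negbK => /eqP ->; rewrite mulr0.
case: p' c A hA rA eA fA z0 {nz} i0 nzi => [|p'] c A hA rA eA fA z0 i0 nzi.
  by case: i0 nzi.
have [cb [u [u1 scu]]] := unitE (hA i0 k) nzi.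
(* Gaussian elimination with the pivot [A i0 k]: row [i0] and column [k] of [A'] both vanish. *)
pose A' := A - (u *: col k A) *m row i0 A.
have A'i0 j : A' i0 j = 0.
  by rewrite !mxE big_ord1 !mxE u1 mul1r subrr.
have A'k i : A' i k = 0.
  by rewrite !mxE big_ord1 !mxE mulrAC u1 mul1r subrr.
have zA' (z : 'rV_p'.+1) : z *m A' = col' i0 z *m row' i0 A'.
  rewrite (row_insert i0); have -> : row i0 A' = 0 by apply/rowP => j; rewrite mxE A'i0 mxE.
  by rewrite scaler0 add0r.
have zA (z : 'rV_p'.+1) : (z *m A) 0 k = 0 -> z *m A' = z *m A.
  move=> h; rewrite mulmxBr -[RHS]subr0; congr (_ - _).
  have zc : z *m col k A = 0.
    apply/rowP => j; rewrite ord1 [RHS]mxE -[RHS]h !mxE.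
    by apply: eq_bigr => i _; rewrite mxE.
  by rewrite mulmxA -scalemxAr zc scaler0 mul0mx.
(* The lift of [y] whose coordinate [i0] is adjusted so that [E y *m A] vanishes at [k]. *)
pose E (y : 'rV[S]_p') := y *m insert_mx i0 -
  ((y *m insert_mx i0) *m (u *: col k A)) 0 0 *: delta_mx 0 i0.
have EA y : E y *m A = y *m row' i0 A'.
  rewrite -insert_mulmx /E mulmxBl mulmxBr; congr (_ - _).
  rewrite -[LHS]scalemxAl -rowE [RHS]mulmxA.
  by apply/rowP => j; rewrite [LHS]mxE [RHS]mxE big_ord1.
have dE y : col' i0 (E y) = y.
  have cd (a : S) : col' i0 (a *: delta_mx 0 i0) = 0 :> 'rV_p'.
    by apply/rowP => j; rewrite !mxE eq_sym (negbTE (neq_lift _ _)) mulr0.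
  by rewrite /E linearB /= cd subr0 insert_mxK.
pose B := col' k (row' i0 A').
have yB y : y *m B *m insert_mx k = E y *m A.
  rewrite EA mul_col' col'_insert // => i; rewrite mxE.
  by apply: big1 => j _; rewrite mxE A'k mulr0.
exists p', (c \o lift i0), B, (P' : {poly int}); split.
- move=> i j; rewrite !mxE big_ord1 !mxE; apply: hentryB; first exact: hA.
  rewrite -mulrA; apply: hentryZ => //.
  by apply: hentryM (hA _ _) _; rewrite -cb; apply: hA.
- by move=> i; apply: rA.
- move=> w; split=> [/eA [z hz]|[y ->]]; last first.
    by apply/eA; rewrite yB; exists (E y).
  have := zA z; rewrite -hz insert_mx_eq0 => /(_ erefl) h.
  exists (col' i0 z); rewrite -[LHS](insert_mxK k) -h zA'.
  by rewrite mul_col'.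
(* A syzygy of [A] is determined by its coordinates other than [i0], the pivot being a unit; these
   coordinates are the syzygies of [B]. *)
- have drop : fres l r.+1 (c \o lift i0)
      (fun w => exists v, kernel A v /\ w = col' i0 v) P'.
    apply: fres_drop fA _ => z hz; rewrite -{2}[z]mulmx1 (row_insert i0) => zd.
    move: hz; rewrite /kernel (row_insert i0) zd mul0mx addr0.
    move=> /rowP /(_ k); rewrite !mxE => h.
    have -> : z 0 i0 = 0 by rewrite -[LHS]mulr1 -u1 mulrCA h mulr0.
    by rewrite scale0r mul0mx addr0.
  apply: fres_eq drop => y; split=> [[z [hz ->]]|hy].
    rewrite /kernel mul_col' -zA' zA hz ?mxE //.
    by apply/rowP => j; rewrite !mxE.
  exists (E y); rewrite dE; split=> //.
  by rewrite /kernel -yB hy mul0mx.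
(* The cancelled generator and the cancelled relation have the same shift, [c i0 = b k]. *)
- by rewrite (bigD1_ord i0) //= cb; ring.
Qed.

(** Unit entries are cancelled one at a time until no element of [L] has a coordinate with nonzero
    constant term. [E] embeds the surviving generators, which still generate modulo [L]; the
    K-polynomial of the quotient by [L] does not change. *)
Lemma trim l r p (b : 'I_p -> nat) (L : 'rV[S]_p -> Prop) P : fres l r b L P ->
  exists p' (b' : 'I_p' -> nat) (E : 'M[S]_(p', p)) (P' : {poly int}),
  [/\ fres l r b' (fun w => L (w *m E)) P',
      homog_mx b' b E /\ (forall i, exists j, b' i = b j),
      forall w, L (w *m E) -> forall k, aug (w 0 k) = 0,
      forall v, exists w u, L u /\ v = w *m E + u
    & \sum_k 'X^(b k) - P = \sum_k 'X^(b' k) - P'].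
Proof.
elim: p b L P => [|p IH] b L P fL.
  exists 0%N, b, 1%:M, P; split=> //.
  - by apply: fres_eq fL => v; rewrite mulmx1.
  - by split=> [[]|[]].
  - by move=> w _ [].
  - move=> v; exists v, 0; rewrite mulmx1 addr0; split=> //.
    by case: (submodule_fres fL).
case: (boolp.EM (exists v k, L v /\ aug (v 0 k) != 0)) => [[v [k [Lv nz]]]|no].
  have [v1 Lv1 v1k] := unit_vector fL Lv nz.
  have [p' [b' [E [P' [fL' [hE hb'] aug0 gen e]]]]] := IH _ _ _ (fres_split fL Lv nz).
  exists p', b', (E *m insert_mx k), P'; split=> //.
  - by apply: fres_eq fL' => w; rewrite mulmxA.
  - split; first by apply: homog_mx_mul hE (insert_homog_mx _ _).
    by move=> i; have [j ->] := hb' i; exists (lift k j).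
  - by move=> w; rewrite mulmxA; apply: aug0.
  - move=> w; pose w' := w - w 0 k *: v1.
    have w'k i : w' i k = 0 by rewrite ord1 !mxE v1k mulr1 subrr.
    have [x [u [Lu hx]]] := gen (col' k w').
    exists x, (u *m insert_mx k + w 0 k *: v1); split.
      have sL := submodule_fres fL.
      by apply: submoduleD => //; apply: submoduleZ.
    rewrite mulmxA addrA -mulmxDl -hx col'_insert //.
    by rewrite /w' subrK.
  - by rewrite -e (bigD1_ord k) //=; ring.
exists p.+1, b, 1%:M, P; split=> //.
- by apply: fres_eq fL => v; rewrite mulmx1.
- split=> [i j|i]; last by exists i.
  rewrite /homog_entry mxE; case: eqP => [->|_]; first by rewrite rmorph1.
  by rewrite rmorph0 !mul0r.
- move=> w; rewrite mulmx1 => Lw k; apply/eqP/negP => /negP nz.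
  by case: no; exists w, k.
- move=> v; exists v, 0; rewrite mulmx1 addr0; split=> //.
  by case: (submodule_fres fL).
Qed.

(** Every syzygy module is trimmed in turn. The last clause is how shifts of the minimal resolution
    become known: cancellation preserves the K-polynomial, so each nonzero coefficient needs a
    surviving shift. *)
Lemma min_res l r q (b : 'I_q -> nat) (L : 'rV[S]_q -> Prop) P : fres l r b L P ->
  exists (rk : nat -> nat) (sh : forall i, 'I_(rk i) -> nat)
         (d0 : 'M[S]_(rk 0%N, q)) (d : forall i, 'M[S]_(rk i.+1, rk i)),
  [/\ homog_mx (sh 0%N) b d0 /\ (forall i, homog_mx (sh i.+1) (sh i) (d i)),
      (forall v, L v <-> rowspan d0 v) /\
      (forall v, kernel d0 v <-> rowspan (d 0%N) v),
      forall i v, kernel (d i) v <-> rowspan (d i.+1) v,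
      forall i k j, aug (d i k j) = 0
    & (forall i k, sh i k <= r + i)%N /\
      (forall D, P`_D != 0 -> exists i k, (i < l)%N /\ sh i k = D)].
Proof.
elim: l r q b L P => [|l IH] r q b L P.
  move=> [h ->].
  exists (fun=> 0%N), (fun _ _ => 0%N), 0, (fun _ => 0).
  have e0 (v : 'rV[S]_0) : v = 0 by apply/rowP; case.
  split.
  - by split=> [[]|i []].
  - split=> v; first rewrite h; split.
    + by move=> ->; exists 0; rewrite mul0mx.
    + by move=> [w ->]; rewrite mulmx0.
    + by move=> _; exists 0; rewrite [LHS]e0 mul0mx.
    + by move=> _; rewrite /kernel mulmx0.
  - move=> i v; split=> [_|_]; first by exists 0; rewrite [LHS]e0 mul0mx.
    by rewrite /kernel mulmx0.
  - by move=> i [].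
  - by split=> [i []|D]; rewrite ?coef0 ?eqxx.
move=> [p [c [A [P' [hA rA eA fA ->]]]]].
have [p' [c' [E [P'' [fL [hE hc'] aug0 gen e]]]]] := trim fA.
have [rk [sh [d0 [d [[hd0 hd] [ex0 ex1] ex augd [rsh hP]]]]]] := IH _ _ _ _ _ fL.
pose rk' i := if i is j.+1 then rk j else p'.
pose sh' i : 'I_(rk' i) -> nat := match i with 0 => c' | j.+1 => sh j end.
pose d' i : 'M[S]_(rk' i.+1, rk' i) := match i with 0 => d0 | j.+1 => d j end.
exists rk', sh', (E *m A), d'; split.
- split; first exact: homog_mx_mul hE hA.
  by case.
- split=> v.
    rewrite eA; split=> [[w ->]|[w ->]]; last by exists (w *m E); rewrite mulmxA.
    have [x [u [hu ->]]] := gen w.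
    by exists x; rewrite mulmxDl hu addr0 mulmxA.
  by rewrite -ex0 /kernel mulmxA.
- by case.
- case=> //= k j; have /aug0 /(_ j) : kernel A (row k d0 *m E).
    by apply/ex0; exact: row_rowspan.
  by rewrite mxE.
- split=> [[|i] k /=|D].
  + by have [j ->] := hc' k; rewrite addn0.
  + by rewrite addnS -addSn.
  + rewrite e coefB coef_sum.
    have [->|nz _] := eqVneq P''`_D 0; last first.
      by have [i [k [il <-]]] := hP D nz; exists i.+1, k.
    rewrite subr0 => nz.
    have [k hk] : exists k, c' k == D.
      apply/existsP; apply: contraNT nz; rewrite negb_exists => /forallP h.
      apply/eqP; apply: big1 => k _; rewrite coefXn eq_sym.
      by rewrite (negbTE (h k)).
    by exists 0%N, k; split=> //; apply/eqP.
Qed.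

Lemma minimal_resolution (I : S -> Prop) r l q (b : 'I_q -> nat)
    (g : 'cV[S]_q) P :
  (forall f f', I f -> I f' -> I (f + f')) ->
  (forall k, hentry (b k) 0 (g k 0)) ->
  (forall f, exists v : 'rV_q, I (f - (v *m g) 0 0)) ->
  fres l r b (fun v => I ((v *m g) 0 0)) P ->
  exists (rk : nat -> nat) (sh : forall i, 'I_(rk i) -> nat)
         (g' : 'cV[S]_(rk 0%N)) (d : forall i, 'M[S]_(rk i.+1, rk i)),
  [/\ (forall k, hentry (sh 0%N k) 0 (g' k 0)) /\
       (forall i, homog_mx (sh i.+1) (sh i) (d i)),
      forall f, exists v : 'rV_(rk 0%N), I (f - (v *m g') 0 0),
      (forall v, I ((v *m g') 0 0) <-> rowspan (d 0%N) v) /\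
      (forall i v, kernel (d i) v <-> rowspan (d i.+1) v),
      forall i k j, aug (d i k j) = 0
    & [/\ forall k, exists j, sh 0%N k = b j,
      (forall i k, sh i.+1 k <= r + i)%N
    & forall D, (\sum_k 'X^(b k) - P)`_D != 0 ->
        exists i k, (i <= l)%N /\ sh i k = D]].
Proof.
move=> Iadd hg surj fW.
have [p [c [E [P' [fW' [hE hc] aug0 gen e]]]]] := trim fW.
have [rk [sh [d0 [d [[hd0 hd] [ex0 ex1] ex augd [rsh hP]]]]]] := min_res fW'.
pose rk' i := if i is j.+1 then rk j else p.
pose sh' i : 'I_(rk' i) -> nat := match i with 0 => c | j.+1 => sh j end.
pose d' i : 'M[S]_(rk' i.+1, rk' i) := match i with 0 => d0 | j.+1 => d j end.
have hgE : homog_mx c (fun _ : 'I_1 => 0%N) (E *m g).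
  by apply: homog_mx_mul hE _ => k j; rewrite ord1; apply: hg.
exists rk', sh', (E *m g), d'; split.
- by split=> [k|[|i]]; [apply: hgE | apply: hd0 | apply: hd].
- move=> f; have [v hv] := surj f.
  have [w [u [Lu hw]]] := gen v; exists w.
  have -> : f - (w *m (E *m g)) 0 0 = (f - (v *m g) 0 0) + (u *m g) 0 0.
    by rewrite hw mulmxDl -mulmxA [in RHS]mxE opprD addrA subrK.
  exact: Iadd.
- split=> [v|]; first by rewrite mulmxA; exact: ex0.
  by case=> [|i] v; [exact: ex1 | exact: ex].
- move=> [|i] k j /=; last exact: augd.
  have /aug0 /(_ j) : I ((row k d0 *m E *m g) 0 0).
    by apply/ex0; exact: row_rowspan.
  by rewrite mxE.
- split=> [k|i k|D]; [exact: hc | exact: rsh |].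
  rewrite e coefB coef_sum => nz.
  have [P0|P0] := eqVneq P'`_D 0; last first.
    by have [i [k [il shD]]] := hP _ P0; exists i.+1, k.
  rewrite P0 subr0 in nz.
  have [k hk] : exists k, c k == D.
    apply/existsP; apply: contraNT nz; rewrite negb_exists => /forallP h.
    apply/eqP; apply: big1 => k _; rewrite coefXn eq_sym.
    by rewrite (negbTE (h k)).
  by exists 0%N, k; rewrite /= (eqP hk).
Qed.

End Minimal.

(** * Hilbert functions *)

Section Hilbert.

Variables (S : comNzRingType) (sc : {rmorphism S -> {poly S}}).
Hypothesis sc_coef : forall p d, sc (sc p)`_d = ((sc p)`_d)%:P * 'X^d.
Variables (K : fieldType) (iota : {rmorphism K -> S}).
Hypothesis sc_iota : forall c, sc (iota c) = (iota c)%:P.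
Local Notation hentry := (homog_entry sc).
Local Notation homog_mx := (homog_mx sc).
Local Notation fres := (fres sc).
Local Notation "c ^i" := (map_mx iota c) (at level 2, format "c ^i").

Definition has_dim q (U : 'rV[S]_q -> Prop) n := exists B : 'M[S]_(n, q),
  [/\ forall c : 'rV[K]_n, U (c^i *m B),
      forall c : 'rV[K]_n, c^i *m B = 0 -> c = 0
    & forall v, U v -> exists c : 'rV[K]_n, v = c^i *m B].

Definition subspace q (U : 'rV[S]_q -> Prop) :=
  U 0 /\ forall a u v, U u -> U v -> U (iota a *: u + v).

Lemma has_dim_eq q (U U' : 'rV[S]_q -> Prop) n :
  (forall v, U v <-> U' v) -> has_dim U n -> has_dim U' n.
Proof.
move=> e [B [h1 h2 h3]]; exists B; split=> // [c|v /e]; last exact: h3.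
exact/e.
Qed.

Lemma subspace_comb n q (U : 'rV[S]_q -> Prop) (B : 'M_(n, q)) (c : 'rV[K]_n) :
  subspace U -> (forall k, U (row k B)) -> U (c^i *m B).
Proof.
move=> [U0 Uc] h; rewrite mulmx_sum_row.
elim/big_rec: _ => [|k v _ hv]; first exact: U0.
by rewrite mxE; apply: Uc.
Qed.

(** In the coordinates given by a basis of [U], the intersection with [W] becomes the row space of a
    matrix [C] over [K], and a basis of a complement of it gives [D]. *)
Lemma has_dim_quotient q (U W : 'rV[S]_q -> Prop) n a :
  subspace W -> has_dim U n -> has_dim (fun v => U v /\ W v) a ->
  (a <= n)%N /\ exists D : 'M[S]_(n - a, q),
  [/\ forall c : 'rV[K]_(n - a), U (c^i *m D),
      forall c : 'rV[K]_(n - a), W (c^i *m D) -> c = 0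
    & forall v, U v -> exists (c : 'rV[K]_(n - a)) w, W w /\ v = w + c^i *m D].
Proof.
move=> kW [B [B1 B2 B3]] [B0 [C1 C2 C3]].
have /boolp.choice [ch hch] : forall k, exists c : 'rV[K]_n, row k B0 = c^i *m B.
  move=> k; apply: B3; have [] := C1 (delta_mx 0 k).
  by rewrite map_delta_mx -rowE.
pose C := \matrix_k ch k.
have eB0 : B0 = C^i *m B.
  by apply/row_matrixP => k; rewrite hch row_mul -map_row rowK.
have Cfree (x : 'rV_a) : x *m C = 0 -> x = 0.
  move=> h; apply: C2; rewrite eB0 mulmxA -map_mxM h.
  by rewrite map_mx0 mul0mx.
have rC : \rank C = a.
  apply/eqP; rewrite -/(row_free C) -kermx_eq0; apply/eqP/row_matrixP => k.
  rewrite row0; apply: Cfree; apply/sub_kermxP; exact: row_sub.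
have rD : \rank (C^C)%MS = (n - a)%N by rewrite mxrank_compl rC.
have le_an : (a <= n)%N by rewrite -rC rank_leq_col.
split=> //; rewrite -rD; pose D := row_base (C^C)%MS.
exists (D^i *m B); split=> [c|c|v /B3 [c ->]].
- by rewrite mulmxA -map_mxM.
- rewrite mulmxA -map_mxM => Wc.
  have [y hy] : exists y : 'rV_a, (c *m D)^i *m B = y^i *m B0 by apply: C3; split.
  have /eqP e : c *m D - y *m C = 0.
    apply: B2; rewrite map_mxB mulmxBl hy eB0 mulmxA -map_mxM.
    by rewrite subrr.
  rewrite subr_eq0 in e; have : (c *m D <= C :&: C^C)%MS.
    rewrite sub_capmx {1}(eqP e) submxMl /=.
    by apply: submx_trans (submxMl _ _) _; rewrite eq_row_base.
  rewrite capmx_compl submx0 => /eqP cD.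
  by apply: (row_free_inj (row_base_free _)); rewrite cD mul0mx.
- have : (c <= C + C^C)%MS by rewrite submx_full ?addsmx_compl_full.
  move=> /sub_addsmxP [[y1 y2] /= ->].
  have /submxP [z hz] : (y2 *m C^C <= D)%MS.
    by rewrite eq_row_base submxMl.
  rewrite hz; exists z, (y1^i *m B0); split; first by case: (C1 y1).
  by rewrite map_mxD mulmxDl eB0 !map_mxM !mulmxA.
Qed.

Lemma has_dim_image p q (A : 'M[S]_(p, q)) (U : 'rV[S]_p -> Prop) n a :
  has_dim U n -> has_dim (fun v => U v /\ kernel A v) a ->
  (a <= n)%N /\ has_dim (fun w => exists v, U v /\ w = v *m A) (n - a).
Proof.
move=> hU hK; have kK : subspace (kernel A).
  by have [k0 k1] := submodule_kernel A; split=> // x; apply: k1.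
have [le [D [D1 D2 D3]]] := has_dim_quotient kK hU hK; split=> //.
exists (D *m A); split=> [c|c h|w [v [/D3 [c [u [hu ->]]] ->]]].
- by exists (c^i *m D); rewrite mulmxA.
- by apply: D2; rewrite /kernel -mulmxA.
- by exists c; rewrite mulmxDl hu add0r mulmxA.
Qed.

Lemma has_dim_ext p q (U : 'rV[S]_(p + q) -> Prop) a b :
  subspace U -> has_dim (fun u => U (row_mx u 0)) a ->
  has_dim (fun v => exists u, U (row_mx u v)) b -> has_dim U (a + b).
Proof.
move=> kU [A [A1 A2 A3]] [B [B1 B2 B3]].
have /boolp.choice [psi hpsi] : forall k, exists u, U (row_mx u (row k B)).
  move=> k; have [u] := B1 (delta_mx 0 k).
  by rewrite map_delta_mx -rowE; exists u.
pose Psi := \matrix_k psi k.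
have hPsi c : U (row_mx (c^i *m Psi) (c^i *m B)).
  rewrite -mul_mx_row; apply: subspace_comb => // k.
  by rewrite row_row_mx rowK.
exists (block_mx A 0 Psi B); split=> [c|c|v Uv].
- rewrite -[c]hsubmxK map_row_mx mul_row_block mulmx0 add0r.
  have := kU.2 1 _ _ (A1 (lsubmx c)) (hPsi (rsubmx c)).
  by rewrite rmorph1 scale1r add_row_mx add0r.
- rewrite -[c]hsubmxK map_row_mx mul_row_block mulmx0 add0r -[0 in X in X -> _]row_mx0.
  move=> /eq_row_mx [h1 h2]; have c2 := B2 _ h2.
  move: h1; rewrite c2 map_mx0 mul0mx addr0 => /A2 ->.
  by rewrite row_mx0.
- rewrite -[v]hsubmxK in Uv *.
  have [c hc] : exists c : 'rV[K]_b, rsubmx v = c^i *m B.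
    by apply: B3; exists (lsubmx v).
  have := kU.2 (-1) _ _ (hPsi c) Uv.
  rewrite rmorphN1 scaleN1r opp_row_mx add_row_mx -hc addNr => /A3 [d hd].
  exists (row_mx d c); rewrite map_row_mx mul_row_block mulmx0 add0r -hc -hd.
  by rewrite addrAC addNr add0r.
Qed.

Definition homog_vec q (b : 'I_q -> nat) d (v : 'rV[S]_q) :=
  forall k, hentry d (b k) (v 0 k).

Lemma subspace_homog_vec q (b : 'I_q -> nat) d : subspace (homog_vec b d).
Proof.
split=> [k|a u v hu hv k]; first by rewrite /homog_entry mxE rmorph0 !mul0r.
rewrite /homog_entry !mxE rmorphD rmorphM sc_iota polyCD polyCM !mulrDl -!mulrA.
by rewrite hu hv.
Qed.

Variable nm : nat -> nat.
Hypothesis nmE : forall e, has_dim (homog_vec (fun _ : 'I_1 => 0%N) e) (nm e).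

Lemma hentry_sub s t a : (t <= s)%N -> hentry s t a <-> hentry (s - t) 0 a.
Proof.
move=> le; rewrite /homog_entry expr0 mulr1; split=> [h|->]; last first.
  by rewrite -mulrA -exprD subnK.
have reg := monic_rreg (monicXn S t).
by apply: reg; rewrite h -mulrA -exprD subnK.
Qed.

Lemma hentry_lt s t a : (s < t)%N -> hentry s t a -> a = 0.
Proof.
move=> lt /(congr1 (fun p : {poly S} => p`_s)) /=.
by rewrite coefMXn lt coefMXn ltnn subnn coefC eqxx => <-.
Qed.

(* The Hilbert function of a module with K-polynomial P, where nm is that of S. *)
Definition hilbert_coef (P : {poly int}) d : int := \sum_(e < d.+1) P`_e * (nm (d - e))%:Z.

Lemma hilbert_coefD P Q d : hilbert_coef (P + Q) d = hilbert_coef P d + hilbert_coef Q d.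
Proof. by rewrite -big_split; apply: eq_bigr => e _; rewrite coefD mulrDl. Qed.

Lemma hilbert_coefB P Q d : hilbert_coef (P - Q) d = hilbert_coef P d - hilbert_coef Q d.
Proof. by rewrite -sumrB; apply: eq_bigr => e _; rewrite coefB mulrBl. Qed.

Lemma hilbert_coefXn b d : hilbert_coef 'X^b d = (if (b <= d)%N then nm (d - b) else 0%N)%:Z.
Proof.
case: leqP => h.
  rewrite /hilbert_coef (bigD1 (inord b)) //= inordK ?ltnS // coefXn eqxx mul1r.
  rewrite big1 ?addr0 // => e ne; rewrite coefXn; case: eqP => [eb|]; last by rewrite mul0r.
  by case/eqP: ne; apply: val_inj; rewrite /= inordK ?ltnS.
apply: big1 => e _; rewrite coefXn; case: eqP => [eb|]; last by rewrite mul0r.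
by have := ltn_ord e; rewrite eb ltnS leqNgt h.
Qed.

Lemma has_dim_homog_vec q (b : 'I_q -> nat) d :
  exists2 h, has_dim (homog_vec b d) h & h%:Z = hilbert_coef (\sum_k 'X^(b k)) d.
Proof.
elim: q b => [|q IH] b.
  exists 0%N; last first.
    by rewrite big_ord0 /hilbert_coef big1 // => e _; rewrite coef0 mul0r.
  exists 0; split=> [c|c _|v _]; first by case.
    by apply/rowP; case.
  by exists 0; apply/rowP; case.
have [h hd hE] := IH (b \o @rshift 1 q).
exists ((if (b ord0 <= d)%N then nm (d - b ord0) else 0%N) + h)%N; last first.
  rewrite PoszD hE -hilbert_coefXn -hilbert_coefD big_ord_recl; congr (hilbert_coef (_ + _) d).
  by apply: eq_bigr => i _; congr ('X^(b _)); apply: val_inj.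
have hrow u (v : 'rV[S]_q) : @homog_vec (1 + q) b d (row_mx u v) <->
    hentry d (b ord0) (u 0 0) /\ homog_vec (b \o @rshift 1 q) d v.
  split=> [h'|[h1 h2] k].
    split=> [|k]; last by have := h' (rshift 1 k); rewrite row_mxEr.
    have := h' (lshift q 0); rewrite row_mxEl.
    by have -> : lshift q (0 : 'I_1) = ord0 by apply: val_inj.
  rewrite -[k](@splitK 1 q) /unsplit; case: (split (k : 'I_(1 + q))) => i.
    rewrite row_mxEl ord1; have -> : lshift q (0 : 'I_1) = ord0 by apply: val_inj.
    exact: h1.
  by rewrite row_mxEr; apply: h2.
apply: (@has_dim_ext 1 q); first exact: (@subspace_homog_vec (1 + q)).
  have hv0 : homog_vec (b \o @rshift 1 q) d 0.
    by move=> k; rewrite /homog_entry mxE rmorph0 !mul0r.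
  (* The first coordinate contributes the forms of degree [d - b ord0], and only 0 if
     [d < b ord0]. *)
  case: leqP => le.
    apply: has_dim_eq (nmE _) => v; rewrite hrow; split=> [h'|[h' _] k].
      by split=> //; apply/(hentry_sub _ le); apply: h'.
    by rewrite ord1; apply/(hentry_sub _ le).
  exists 0; split=> [c|c _|v /hrow [h' _]].
  - rewrite mulmx0; apply/hrow; split=> //.
    by rewrite /homog_entry mxE rmorph0 !mul0r.
  - by apply/rowP; case.
  - exists 0; rewrite mulmx0; apply/rowP => k; rewrite ord1 [RHS]mxE.
    exact: hentry_lt h'.
apply: has_dim_eq hd => v; split=> [h'|[u /hrow [] //]].
exists 0; apply/hrow; split=> //.
by rewrite /homog_entry mxE rmorph0 !mul0r.
Qed.

(** Rank-nullity in degree [d], along the resolution. *)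
Lemma fres_has_dim l r q (b : 'I_q -> nat) (L : 'rV[S]_q -> Prop) P d :
  fres l r b L P ->
  exists2 h, has_dim (fun v => homog_vec b d v /\ L v) h & h%:Z = hilbert_coef P d.
Proof.
elim: l r q b L P => [|l IH] r q b L P.
  move=> [h ->]; exists 0%N; last first.
    by rewrite /hilbert_coef big1 // => e _; rewrite coef0 mul0r.
  exists 0; split=> [c|c _|v [_ /h ->]].
  - rewrite mulmx0; split; last exact/h.
    by have [] := subspace_homog_vec b d.
  - by apply/rowP; case.
  - by exists 0; rewrite mulmx0.
move=> [p [c [A [P' [hA rA eA fA ->]]]]].
have [a ha aE] := IH _ _ _ _ _ fA.
have [n hn nE] := has_dim_homog_vec c d.
have [le hi] := has_dim_image hn ha.
exists (n - a)%N; last by rewrite hilbert_coefB -nE -aE subzn.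
apply: has_dim_eq hi => v; split=> [[w [hw ->]]|[hv /eA [w hw]]].
  split; last by apply/eA; exists w.
  apply/(component_id sc_coef b); rewrite (component_mul d w hA).
  by rewrite ((component_id sc_coef c d w).1 hw).
(* A preimage of a homogeneous vector may be replaced by its component of degree [d]. *)
exists (component sc c d w); split.
  by apply/(component_id sc_coef c); apply: (component_idem sc_coef).
rewrite -(component_mul d w hA) -hw.
by rewrite ((component_id sc_coef b d v).1 hv).
Qed.

Lemma fres_quotient l r q (b : 'I_q -> nat) (L : 'rV[S]_q -> Prop) P d :
  fres l r b L P ->
  exists2 n, n%:Z = hilbert_coef (\sum_k 'X^(b k) - P) d &
  exists D : 'M[S]_(n, q),
  [/\ forall c : 'rV[K]_n, homog_vec b d (c^i *m D),
      forall c : 'rV[K]_n, L (c^i *m D) -> c = 0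
    & forall v, homog_vec b d v -> exists (c : 'rV[K]_n) w, L w /\ v = w + c^i *m D].
Proof.
move=> fL; have [a ha aE] := fres_has_dim d fL.
have [n hn nE] := has_dim_homog_vec b d.
have kL : subspace L.
  by have [L0 Lc] := submodule_fres fL; split=> // x; apply: Lc.
have [le [D hD]] := has_dim_quotient kL hn ha.
exists (n - a)%N; last by exists D.
by rewrite hilbert_coefB -nE -aE subzn.
Qed.

Lemma quotient_basis (I : S -> Prop) r l q (b : 'I_q -> nat)
    (g : 'cV[S]_q) P d :
  (forall f f', I f -> I f' -> I (f + f')) ->
  (forall f d, I f -> I (sc f)`_d) ->
  (forall k, hentry (b k) 0 (g k 0)) ->
  (forall f, exists v : 'rV_q, I (f - (v *m g) 0 0)) ->
  fres l r b (fun v => I ((v *m g) 0 0)) P ->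
  exists2 n, n%:Z = hilbert_coef (\sum_k 'X^(b k) - P) d & exists B : 'I_n -> S,
  [/\ forall k, hentry d 0 (B k),
      forall c : 'I_n -> K, I (\sum_k iota (c k) * B k) -> forall k, c k = 0
    & forall f, hentry d 0 f ->
        exists c : 'I_n -> K, I (f - \sum_k iota (c k) * B k)].
Proof.
move=> Iadd Igr hg surj fW.
have [n nE [D [D1 D2 D3]]] := fres_quotient d fW.
exists n => //; exists (fun k => (row k D *m g) 0 0).
have hgm : homog_mx b (fun _ : 'I_1 => 0%N) g.
  by move=> k j; rewrite ord1; apply: hg.
have homg (v : 'rV[S]_q) : homog_vec b d v -> hentry d 0 ((v *m g) 0 0).
  move=> hv; rewrite mxE; apply: hentry_sum => k _.
  exact: hentryM (hv k) (hg k).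
have sumE (c : 'I_n -> K) : \sum_k iota (c k) * (row k D *m g) 0 0 =
    ((\row_k c k)^i *m D *m g) 0 0.
  rewrite -mulmxA [RHS]mxE; apply: eq_bigr => k _.
  by rewrite !mxE; congr (_ * _); apply: eq_bigr => j _; rewrite mxE.
split=> [k|c|f hf].
- apply: homg; have := D1 (delta_mx 0 k).
  by rewrite map_delta_mx -rowE.
- by rewrite sumE => /D2 /rowP h k; have := h k; rewrite !mxE.
- have [v hv] := surj f.
  have := Igr _ d hv; rewrite rmorphB coefB.
  have -> : (sc f)`_d = f.
    move: hf; rewrite /homog_entry expr0 mulr1 => ->.
    by rewrite coefCM coefXn eqxx mulr1.
  have -> : (sc ((v *m g) 0 0))`_d = (component sc b d v *m g) 0 0.
    rewrite -(component_mul d v hgm) [RHS]mxE.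
    by rewrite expr0 mulr1.
  move=> hv'.
  have hc : homog_vec b d (component sc b d v).
    by apply/(component_id sc_coef); apply: component_idem.
  have [c [w [Lw hw]]] := D3 _ hc.
  exists (fun k => c 0 k); rewrite sumE.
  have -> : \row_k c 0 k = c by apply/rowP => k; rewrite mxE.
  have := Iadd _ _ hv' Lw; rewrite {1}hw mulmxDl [X in _ - X]mxE opprD addrA.
  by rewrite addrAC subrK.
Qed.

End Hilbert.

(** * The standard grading of a polynomial ring *)

Section PolynomialRing.

Variables (K : fieldType) (N : nat).
Local Notation S := {mpoly K[N]}.

Lemma rmorph_mpoly_ext (R : nzRingType) (f g : {rmorphism S -> R}) :
  (forall c, f c%:MP = g c%:MP) -> (forall i, f 'X_i = g 'X_i) -> f =1 g.
Proof.
move=> fgC fgX; elim/mpolyind => [|c m p _ _ IH]; first by rewrite !rmorph0.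
rewrite !rmorphD {}IH; congr (_ + _).
rewrite -mul_mpolyC !rmorphM fgC; congr (_ * _).
rewrite mpolyXE_id !rmorph_prod; apply: eq_bigr => i _.
by rewrite !rmorphXn fgX.
Qed.

(* The coefficient of 'X^d in the image of p is the component of p of
   degree d. *)
Definition scaleX : S -> {poly S} :=
  mmap (polyC \o @mpolyC N K) (fun i => ('X_i : S)%:P * 'X).

HB.instance Definition _ := GRing.RMorphism.on scaleX.

Lemma scaleX_0 : scaleX 0 = 0. Proof. exact: rmorph0. Qed.

Lemma scaleX_D p q : scaleX (p + q) = scaleX p + scaleX q.
Proof. exact: rmorphD. Qed.

Lemma scaleX_M p q : scaleX (p * q) = scaleX p * scaleX q.
Proof. exact: rmorphM. Qed.

Lemma scaleXC c : scaleX c%:MP = (c%:MP)%:P.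
Proof. exact: mmapC. Qed.

Lemma scaleXX i : scaleX 'X_i = ('X_i)%:P * 'X.
Proof. by rewrite /scaleX mmapX mmap1U. Qed.

#[global] Opaque scaleX.

Lemma scaleX1 p : (scaleX p).[1] = p.
Proof.
suff /(_ p) : (horner_eval (1 : S) \o scaleX) =1 idfun by [].
apply: rmorph_mpoly_ext => [c|i] /=.
  by rewrite scaleXC /horner_eval hornerC.
by rewrite scaleXX /horner_eval hornerM hornerC hornerX mulr1.
Qed.

Lemma scaleXM (m : 'X_{1..N}) : scaleX 'X_[m] = ('X_[m])%:P * 'X^(mdeg m).
Proof.
rewrite mpolyXE_id rmorph_prod mdegE -prodrXr rmorph_prod -big_split /=.
by apply: eq_bigr => i _; rewrite !rmorphXn /= scaleXX exprMn.
Qed.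

Lemma scaleX_coef p d :
  scaleX (scaleX p)`_d = ((scaleX p)`_d)%:P * 'X^d.
Proof.
elim/mpolyind: p => [|c m p _ _ IH].
  by rewrite scaleX_0 coef0 scaleX_0 mul0r.
have -> : scaleX (c *: 'X_[m] + p) =
    (c%:MP * 'X_[m])%:P * 'X^(mdeg m) + scaleX p.
  rewrite -mul_mpolyC scaleX_D scaleX_M.
  by rewrite scaleXC scaleXM mulrA -polyCM.
rewrite coefD scaleX_D IH polyCD mulrDl; congr (_ + _).
rewrite coefCM coefXn; case: eqP => [->|_].
  by rewrite mulr1 scaleX_M scaleXC scaleXM polyCM mulrA.
by rewrite mulr0 scaleX_0 mul0r.
Qed.


Lemma mcoeff_scaleX p d m : ((scaleX p)`_d)@_m = p@_m *+ (mdeg m == d).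
Proof.
elim/mpolyind: p => [|c m' p _ _ IH].
  by rewrite scaleX_0 coef0 !mcoeff0 mul0rn.
have -> : scaleX (c *: 'X_[m'] + p) =
    (c%:MP * 'X_[m'])%:P * 'X^(mdeg m') + scaleX p.
  by rewrite -mul_mpolyC scaleX_D scaleX_M scaleXC scaleXM mulrA -polyCM.
rewrite coefD coefCM coefXn !mcoeffD {}IH mulrnDl; congr (_ + _).
rewrite mcoeffZ mcoeffX.
case: (m' =P m) => [->|ne]; last first.
  rewrite mulr0 mul0rn; case: eqP => _; last by rewrite mulr0 mcoeff0.
  by rewrite mulr1 mul_mpolyC mcoeffZ mcoeffX (introF eqP ne) mulr0.
rewrite mulr1 eq_sym; case: eqP => _; last by rewrite mulr0 mcoeff0.
by rewrite mulr1 mul_mpolyC mcoeffZ mcoeffX eqxx mulr1.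
Qed.

Lemma hentryP s t (a : S) :
  homog_entry scaleX s t a <-> {in msupp a, forall m, (mdeg m + t)%N = s}.
Proof.
split=> [h m|h].
  rewrite mcoeff_msupp => nz.
  have : (a%:P * 'X^s)`_(mdeg m + t) @_m != 0.
    rewrite -h coefMXn ltnNge leq_addl /= addnK mcoeff_scaleX eqxx.
    by rewrite mulr1n.
  rewrite coefCM coefXn; case: ((mdeg m + t)%N =P s) => [//|_].
  by rewrite mulr0 mcoeff0 eqxx.
apply/polyP => d; apply/mpolyP => m.
rewrite coefCM coefXn coefMXn.
have [am|/memN_msupp_eq0 am] := boolP (m \in msupp a).
  rewrite -(h m am); case: ltnP => lt.
    by rewrite (ltn_eqF (leq_trans lt (leq_addl _ _))) mulr0.
  rewrite mcoeff_scaleX -(eqn_add2r t) subnK // (eq_sym d).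
  by case: (_ == d); rewrite ?mulr1 ?mulr0 ?mcoeff0.
have a0 : (a * (d == s)%:R)@_m = 0.
  by case: eqP => _; rewrite ?mulr1 ?mulr0 ?mcoeff0.
by rewrite a0; case: ltnP; rewrite ?mcoeff0 // mcoeff_scaleX am mul0rn.
Qed.

Lemma dhomog_hentry d (f : S) : f \is d.-homog <-> homog_entry scaleX d 0 f.
Proof.
split=> [/dhomogP h|/hentryP h].
  by apply/hentryP => m mf; rewrite addn0; apply: h.
by apply/dhomogP => m mf; rewrite -(h m mf) addn0.
Qed.

Definition const_coef : S -> K := mcoeff 0%MM.
HB.instance Definition _ := GRing.RMorphism.on const_coef.

(** A nonzero constant term puts the monomial 1 into the support, so the degree [s - t] is 0 and [a]
    is a nonzero constant. *)
Lemma unit_entry s t (a : S) : homog_entry scaleX s t a -> const_coef a != 0 ->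
  s = t /\ exists u, u * a = 1 /\ scaleX u = u%:P.
Proof.
move=> /hentryP h nz.
have st : s = t by rewrite -(h 0%MM) ?mcoeff_msupp // mdeg0 add0n.
split=> //; have -> : a = (a@_0)%:MP.
  apply: msize1_polyC; rewrite msizeE; apply/bigmax_leqP_seq => m ma _.
  by rewrite ltnS leqn0 -(eqn_add2r t) add0n h // st.
exists ((a@_0)^-1)%:MP; rewrite scaleXC -mpolyCM mulVf //.
Qed.

End PolynomialRing.

(* The number of monomials of degree e in N > 0 variables. *)
Definition binom (N e : nat) : nat := 'C(e + N.-1, e).

(** * Regularity and Hilbert function read off a free resolution *)

Section PolynomialRing.

Variables (K : fieldType) (N : nat).
Local Notation S := {mpoly K[N]}.

Lemma forms_has_dim e : (0 < N)%N ->
  has_dim (@mpolyC N K) (homog_vec (@scaleX K N) (fun _ : 'I_1 => 0%N) e) (binom N e).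
Proof.
case: N => // n _.
have [f flin [g fK gK]] := dhomog_vecaxiom n K e.
have glin c (u v : 'rV[K]_('C(e + n, e))) : g (c *: u + v) = c *: g u + g v.
  by apply: (can_inj fK); rewrite gK flin !gK.
have g0 : g 0 = 0.
  have f0 : f 0 = 0 by have := flin (-1) 0 0; rewrite scaler0 addr0 scaleN1r addNr.
  by rewrite -f0 fK.
pose B : 'M[{mpoly K[n.+1]}]_('C(e + n, e), 1) :=
  \matrix_(i, j) (g (delta_mx 0 i) : {mpoly K[n.+1]}).
have gB (c : 'rV[K]_('C(e + n, e))) :
    (map_mx (@mpolyC n.+1 K) c *m B) = const_mx (g c : {mpoly K[n.+1]}).
  apply/rowP => j; rewrite !mxE; under eq_bigr do rewrite !mxE mul_mpolyC.
  rewrite {2}[c]row_sum_delta.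
  apply: (big_ind2 (fun x u => x = (g u : {mpoly K[n.+1]}))) => [|x u y v -> ->|i _].
  - by rewrite g0.
  - by rewrite -[u in RHS]scale1r glin scale1r.
  - by rewrite -[_ *: delta_mx _ _]addr0 glin g0 addr0.
exists B; split=> [c k|c|v hv].
- rewrite gB mxE; have /dhomog_hentry := dhomog_is_dhomog (g c); exact.
- rewrite gB => /matrixP /(_ 0 0); rewrite !mxE => h.
  by rewrite -[c]gK (_ : g c = 0) -1?[in RHS](gK 0) ?g0 //; apply: val_inj.
- have hh : v 0 0 \is e.-homog by apply/dhomog_hentry; apply: hv.
  exists (f (DHomog hh)); rewrite gB fK.
  by apply/rowP => j; rewrite !mxE ord1.
Qed.

(** In the minimal resolution the shifts of step [i] are at most [i + R]. The nonzero coefficient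
    yields a shift [l + R] in some step [i <= l], and the bound forces [i = l]. The bound given to
    [fres] is [R.+1] because [fres] starts at the first syzygies. *)
Lemma regularity_of_fres (I : set S) R l q (b : 'I_q -> nat) (g : 'cV[S]_q) P :
  (forall f f', I f -> I f' -> I (f + f')) ->
  (forall k, homog_entry (@scaleX K N) (b k) 0 (g k 0)) ->
  (forall f, exists v : 'rV_q, I (f - (v *m g) 0 0)) ->
  fres (@scaleX K N) l R.+1 b (fun v => I ((v *m g) 0 0)) P ->
  (forall k, (b k <= R)%N) -> (\sum_k 'X^(b k) - P)`_(l + R) != 0 ->
  is_regularity I R.
Proof.
move=> Iadd hg surj fW bR nz.
have [rk [sh [g' [d [[hg' hd] surj' [ex0 ex] augd [hc rsh hP]]]]]] :=
  minimal_resolution (@unit_entry K N) Iadd hg surj fW.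
have hd' i k j : {in msupp (d i k j),
    forall m, (mdeg m + sh i j)%N = sh i.+1 k}.
  by apply/hentryP; apply: hd.
have hg'' k : g' k 0 \is (sh 0%N k).-homog by apply/dhomog_hentry.
exists (GradedFreeResolution hg'' hd' surj' ex0 ex).
have bound i (k : 'I_(rk i)) : (sh i k <= i + R)%N.
  case: i k => [|i] k; first by have [j ->] := hc k; rewrite add0n.
  by have := rsh i k; lia.
split=> //.
have [i [k [il shk]]] := hP _ nz; exists i, k => /=.
by have := bound i k; lia.
Qed.

Lemma hilbert_of_fres (I : set S) r l q (b : 'I_q -> nat) (g : 'cV[S]_q) P :
  (0 < N)%N ->
  (forall f f', I f -> I f' -> I (f + f')) ->
  (forall f d, I f -> I (scaleX f)`_d) ->
  (forall k, homog_entry (@scaleX K N) (b k) 0 (g k 0)) ->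
  (forall f, exists v : 'rV_q, I (f - (v *m g) 0 0)) ->
  fres (@scaleX K N) l r b (fun v => I ((v *m g) 0 0)) P ->
  forall d, exists2 n : nat, n%:Z = hilbert_coef (binom N) (\sum_k 'X^(b k) - P) d &
    is_hilbert_value I d n.
Proof.
move=> N0 Iadd Igr hg surj fW d.
have [n nE [B [B1 B2 B3]]] := quotient_basis (@scaleX_coef K N) (@scaleXC K N)
  (fun e => forms_has_dim e N0) d Iadd Igr hg surj fW.
have sumE (c : 'I_n -> K) : \sum_k c k *: B k = \sum_k (c k)%:MP * B k.
  by apply: eq_bigr => k _; rewrite mul_mpolyC.
exists n => //; exists B; split=> [k|c|f /dhomog_hentry /B3 [c hc]].
- exact/dhomog_hentry.
- by rewrite sumE; apply: B2.
- by exists c; rewrite sumE.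
Qed.

End PolynomialRing.

(** * Power series: the h-polynomial and the growth of the Hilbert function *)

Section Series.

Definition upto i (p q : {poly int}) := forall j, (j <= i)%N -> p`_j = q`_j.

Lemma upto_mul i r p q : upto i p q -> upto i (r * p) (r * q).
Proof.
move=> h j ji; rewrite !coefM; apply: eq_bigr => k _; congr (_ * _).
by apply: h; apply: leq_trans (leq_subr _ _) ji.
Qed.

(** For positive [N], the power series of [(1 - t)^(-N)] cut off after [t^i]; identities of power
    series become congruences [upto i]. *)
Definition binser N i : {poly int} := \poly_(j < i.+1) (binom N j)%:Z.

Lemma binser_step N i : (0 < N)%N ->
  upto i ((1 - 'X) * binser N.+1 i) (binser N i).
Proof.
case: N => // N _ [|j] ji.
  by rewrite mulrBl mul1r coefB coefXM subr0 !coef_poly /= /binom !bin0.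
rewrite mulrBl mul1r coefB coefXM !coef_poly /= !ltnS ji (ltnW ji) /binom /=.
by rewrite !addSn !addnS binS PoszD addrK.
Qed.

Lemma binser_sub a d i : (0 < d)%N ->
  upto i ((1 - 'X) ^+ a * binser (d + a) i) (binser d i).
Proof.
move=> d0; elim: a => [|a IH]; first by rewrite addn0 expr0 mul1r.
move=> j ji; rewrite -(IH j ji) exprSr -mulrA addnS.
by apply: upto_mul ji; apply: binser_step; rewrite addn_gt0 d0.
Qed.

Lemma binser_inv N i : (0 < N)%N -> upto i ((1 - 'X) ^+ N * binser N i) 1.
Proof.
case: N => // N _ j ji; rewrite exprS -mulrA.
rewrite (upto_mul _ (@binser_sub N 1 i isT)) //.
case: j ji => [|j] ji; rewrite mulrBl mul1r coefB coefXM !coef_poly /= coef1.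
  by rewrite subr0 /binom addn0 bin0.
by rewrite !ltnS ji (ltnW ji) /binom !addn0 !binn subrr.
Qed.

Lemma hilbert_coef_binser N P i j : (j <= i)%N -> hilbert_coef (binom N) P j = (P * binser N i)`_j.
Proof.
move=> ji; rewrite coefM; apply: eq_bigr => e _; rewrite coef_poly ltnS.
by rewrite (leq_trans (leq_subr _ _) ji).
Qed.

Variables (N d : nat) (h : {poly int}) (H : nat -> nat).
Hypotheses (d0 : (0 < d)%N) (dN : (d <= N)%N).
Hypothesis HE : forall i, (H i)%:Z = hilbert_coef (binom N) (h * (1 - 'X) ^+ (N - d)) i.

Lemma hilbert_h i :
  h`_i = \sum_(j < i.+1) ((1 - 'X : {poly int}) ^+ d)`_j * (H (i - j)%N)%:Z.
Proof.
transitivity (((1 - 'X) ^+ d * (h * (1 - 'X) ^+ (N - d) * binser N i))`_i); last first.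
  rewrite coefM; apply: eq_bigr => j _; congr (_ * _).
  by rewrite HE (@hilbert_coef_binser _ _ i) // leq_subr.
have -> : (1 - 'X) ^+ d * (h * (1 - 'X) ^+ (N - d) * binser N i) =
    h * ((1 - 'X) ^+ N * binser N i).
  by rewrite -[in RHS](subnKC dN) exprD (subnKC dN); ring.
rewrite (upto_mul _ (@binser_inv N i (leq_trans d0 dN))) //.
by rewrite mulr1.
Qed.

Lemma bin_bound n k : ('C(n + k, k) <= n.+1 ^ k)%N.
Proof.
elim: k => [|k IH]; first by rewrite bin0.
have := mul_bin_diag (n + k.+1) k; rewrite addnS /= => e.
rewrite -(leq_pmul2l (ltn0Sn k)) -e expnS mulnA.
by apply: leq_mul => //; nia.
Qed.

(** After cancelling powers of [1 - t] the series is [h] over [(1 - t)^d], so [H i] combines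
    binomial coefficients of size at most [i.+1 ^ d.-1], weighted by the coefficients of [h]. *)
Lemma hilbert_bound : exists C, forall i, (H i <= C * i.+1 ^ d.-1)%N.
Proof.
exists (\sum_(0 <= e < size h) absz (h`_e)%R)%N => i.
have e1 : (H i)%:Z = \sum_(e < i.+1) h`_e * (binom d (i - e))%:Z.
  rewrite HE (@hilbert_coef_binser _ _ i) // -mulrA -{2}(subnKC dN).
  rewrite (upto_mul _ (@binser_sub _ d i d0)) // coefM.
  apply: eq_bigr => e _; rewrite coef_poly ltnS.
  by rewrite (leq_trans (leq_subr _ _)).
have -> : H i = absz (\sum_(e < i.+1) h`_e * (binom d (i - e))%:Z) by rewrite -e1.
apply: (@leq_trans (\sum_(e < i.+1) absz (h`_e)%R * i.+1 ^ d.-1)%N).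
  elim/big_ind2: _ => // [x a y b le1 le2|e _].
    by lia.
  rewrite abszM leq_mul2l; apply/orP; right.
  rewrite absz_nat /binom addnC -bin_sub ?leq_addl // addnK addnC.
  apply: leq_trans (bin_bound _ _) _.
  by case: (d.-1) => // k; rewrite leq_exp2r // ltnS leq_subr.
rewrite -big_distrl leq_mul2r /=; apply/orP; right.
rewrite -(big_mkord xpredT (fun e => absz (h`_e)%R)%N).
apply: (@leq_trans (\sum_(0 <= e < size h + i.+1) absz (h`_e)%R)%N).
  by rewrite [leqRHS](@big_cat_nat _ _ _ i.+1) ?leq_addr ?leq_addl.
rewrite (@big_cat_nat _ _ _ (size h)) ?leq_addr //= [X in (_ + X)%N]big_nat.
rewrite [X in (_ + X)%N]big1 ?addn0 // => e /andP [le _].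
by rewrite nth_default.
Qed.

End Series.

(** * Krull dimension *)

Section Krull.

Variables (S : comNzRingType) (sc : {rmorphism S -> {poly S}}).
Hypothesis sc1 : forall p, (sc p).[1] = p.
Hypothesis sc_coef : forall p d, sc (sc p)`_d = ((sc p)`_d)%:P * 'X^d.
Variables (K : fieldType) (iota : {rmorphism K -> S}).

Definition prime_like (P : S -> Prop) :=
  [/\ P 0, forall a u v, P u -> P v -> P (a * u + v)
    & forall u v, P (u * v) -> P u \/ P v].

Definition indep_mod (T : finType) (g : T -> S) (P : S -> Prop) :=
  forall c : T -> K, P (\sum_a iota (c a) * g a) -> forall a, c a = 0.

Lemma prime_like_mul (P : S -> Prop) a u : prime_like P -> P u -> P (a * u).
Proof. by move=> [P0 Pc _] Pu; rewrite -[_ * _]addr0; apply: Pc. Qed.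

Lemma prime_like_sub (P : S -> Prop) u v : prime_like P -> P u -> P (u + v) -> P v.
Proof.
move=> [P0 Pc _] Pu Puv; have := Pc (-1) _ _ Pu Puv.
by rewrite mulN1r addrA addNr add0r.
Qed.

(* Elements f_i of P i.+1 outside of P i are algebraically independent
   modulo P 0: the family consists of the monomials in the f_i. *)
Lemma chain_indep e (P : nat -> S -> Prop) :
  (forall k, (k <= e)%N -> prime_like (P k) /\ ~ P k 1) ->
  (forall k, (k < e)%N -> (forall u, P k u -> P k.+1 u) /\ exists2 f, P k.+1 f & ~ P k f) ->
  exists D, forall t, exists (T : finType) (g : T -> S),
  [/\ #|T| = (t ^ e)%N, forall a, (size (sc (g a)) <= (D * t).+1)%N
    & indep_mod g (P 0%N)].
Proof.
elim: e P => [|e IH] P hP hlt.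
  exists 0%N => t; exists unit, (fun=> 1); split; first by rewrite card_unit.
    by move=> _; rewrite rmorph1 size_poly1.
  move=> c; have [[P0 Pc _] P1] := hP 0%N isT.
  rewrite (big_pred1 tt) => [|[] //].
  rewrite mulr1 => Pc0 []; apply/eqP/negP => /negP nz; apply: P1.
  have := Pc (iota (c tt)^-1) _ _ Pc0 P0.
  by rewrite -rmorphM mulVf // rmorph1 addr0.
have [||D hD] := IH (fun k => P k.+1).
- by move=> k ke; apply: (hP k.+1).
- by move=> k ke; apply: (hlt k.+1).
have [sub [f f1 f0]] := hlt 0%N isT.
have [pP _] := hP 0%N isT; have [pP1 _] := hP 1%N isT.
exists (D + size (sc f))%N => t; have [T [g [cT sg ig]]] := hD t.
exists ('I_t * T)%type, (fun x : 'I_t * T => f ^+ (x.1 : 'I_t) * g x.2); split.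
- by rewrite card_prod card_ord cT expnS.
- move=> [i a] /=; rewrite rmorphM rmorphXn.
  apply: leq_trans (size_polyMleq _ _) _.
  have s1 := size_poly_exp_leq (sc f) i; have s2 := sg a.
  have : ((size (sc f)).-1 * i <= size (sc f) * t)%N.
    by apply: leq_mul; [exact: leq_pred | exact: ltnW].
  move=> h; rewrite mulnDl -subn1 leq_subLR; apply: leq_trans (leq_add s1 s2) _.
  by rewrite addSn addnS add1n !ltnS addnC leq_add2l.
(* The summand without [f] lies in [P 1] because [f] does, so its coefficients vanish by
   independence modulo [P 1]; then [f], which is outside the prime [P 0], can be cancelled. *)
have key u (c : nat -> T -> K) :
    P 0%N (\sum_(i < u) f ^+ i * \sum_a iota (c i a) * g a) ->
    forall i a, (i < u)%N -> c i a = 0.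
  elim: u c => [|u IHu] c //; rewrite big_ord_recl expr0 mul1r.
  set G0 := \sum_a _; set R := \sum_(i < u) _.
  have -> : R = f * \sum_(i < u) f ^+ i * \sum_a iota (c i.+1 a) * g a.
    by rewrite mulr_sumr; apply: eq_bigr => i _; rewrite exprS mulrA.
  move=> h; have /ig c0 : P 1%N G0.
    apply: (@prime_like_sub _ (f * \sum_(i < u) f ^+ i * \sum_a iota (c i.+1 a) * g a)) => //.
      by rewrite mulrC; apply: prime_like_mul.
    by rewrite addrC; apply: sub.
  have G00 : G0 = 0 by apply: big1 => a _; rewrite c0 rmorph0 mul0r.
  move: h; rewrite G00 add0r => h.
  have [//|/(IHu (fun i => c i.+1)) h'] : P 0%N f \/ P 0%N (\sum_(i < u) f ^+ i * \sum_a iota (c i.+1 a) * g a).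
    by case: pP => _ _; apply.
  by case=> [|i] a ui; [exact: c0 | exact: h'].
move=> c; case: t cT sg ig c {hD} => [|t] cT sg ig c; first by move=> _ [[]].
have -> : \sum_x iota (c x) * (f ^+ (x.1 : 'I_t.+1) * g x.2) =
    \sum_(i < t.+1) f ^+ i * \sum_a iota (c (inord i, a)) * g a.
  transitivity (\sum_(i < t.+1) \sum_a iota (c (i, a)) * (f ^+ i * g a)).
    by rewrite pair_bigA; apply: eq_bigr => [[]].
  apply: eq_bigr => i _; rewrite mulr_sumr; apply: eq_bigr => a _.
  by rewrite inord_val mulrCA.
move=> /(key t.+1 (fun i a => c (inord i, a))) h [i a].
by have := h i a (ltn_ord i); rewrite inord_val.
Qed.

(** A linear relation between the rows of coordinates would be a relation between the [g a] modulo
    [I], hence modulo [P]. *)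
Lemma indep_leq (I P : S -> Prop) (T : finType) (g : T -> S) v (G : 'I_v -> S) :
  prime_like P -> (forall f, I f -> P f) -> indep_mod g P ->
  (forall a, exists c : 'I_v -> K, I (g a - \sum_k iota (c k) * G k)) ->
  (#|T| <= v)%N.
Proof.
move=> pP IP ig /boolp.choice [c hc].
pose C := \matrix_(i < #|T|, k < v) c (enum_val i) k.
rewrite -(eqP (_ : row_free C)) ?rank_leq_col // -kermx_eq0.
apply/eqP/row_matrixP => k; rewrite row0.
set x := row k _; have xC : x *m C = 0 by apply/sub_kermxP; exact: row_sub.
clearbody x.
have sumT (R : nmodType) (F : T -> R) : \sum_a F a = \sum_(i < #|T|) F (enum_val i).
  rewrite (reindex (@enum_val T T)) //=.
  by apply: onW_bij; apply: enum_val_bij.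
pose xa a := x 0 (enum_rank a).
suff h : P (\sum_a iota (xa a) * g a).
  by apply/rowP => i; have := ig xa h (enum_val i); rewrite /xa enum_valK mxE.
have z : \sum_a iota (xa a) * (\sum_k iota (c a k) * G k) = 0.
  under eq_bigr do rewrite mulr_sumr.
  rewrite exchange_big /=; apply: big1 => j _.
  under eq_bigr do rewrite mulrA -rmorphM.
  rewrite -mulr_suml -rmorph_sum sumT.
  have -> : \sum_(i < #|T|) xa (enum_val i) * c (enum_val i) j = (x *m C) 0 j.
    by rewrite mxE; apply: eq_bigr => i _; rewrite /xa enum_valK mxE.
  by rewrite xC mxE rmorph0 mul0r.
have -> : \sum_a iota (xa a) * g a =
    \sum_a iota (xa a) * (g a - \sum_k iota (c a k) * G k).
  by under [RHS]eq_bigr do rewrite mulrBr; rewrite sumrB z subr0.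
elim/big_rec: _ => [|a s _ Ps]; first by case: pP.
by case: (pP) => _ Pc _; apply: Pc => //; apply: IP.
Qed.

Variables (I : S -> Prop) (H : nat -> nat).
Hypothesis I_add : forall f f', I f -> I f' -> I (f + f').
Hypothesis I0 : I 0.
Hypothesis HE : forall d, exists B : 'I_(H d) -> S, forall f, homog_entry sc d 0 f ->
  exists c : 'I_(H d) -> K, I (f - \sum_k iota (c k) * B k).

(** [size (sc f) <= M] says that all components of [f] have degree below [M]; the top one is split
    off at each step. *)
Lemma span_leq M : exists G : 'I_(\sum_(d < M) H d) -> S, forall f,
  (size (sc f) <= M)%N -> exists c, I (f - \sum_k iota (c k) * G k).
Proof.
elim: M => [|M [G hG]].
  exists (fun=> 0) => f; rewrite leqn0 size_poly_eq0 => /eqP f0.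
  have -> : f = 0 by rewrite -[f]sc1 f0 horner0.
  exists (fun=> 0); rewrite big1 ?subr0 // => k _.
  by rewrite mulr0.
have [B hB] := HE M; rewrite big_ord_recr /=.
exists (fun k => match split k with inl i => G i | inr j => B j end) => f sf.
pose fM := (sc f)`_M.
have [c hc] : exists c, I (f - fM - \sum_k iota (c k) * G k).
  apply: hG; apply/leq_sizeP => j Mj; rewrite rmorphB coefB sc_coef coefCM coefXn.
  have [->|ne] := eqVneq j M; first by rewrite mulr1 subrr.
  rewrite mulr0 subr0; apply/(leq_sizeP _ _ sf).
  by rewrite ltn_neqAle eq_sym ne.
have [c2 hc2] : exists c, I (fM - \sum_k iota (c k) * B k).
  by apply: hB; rewrite /homog_entry expr0 mulr1; apply: sc_coef.
exists (fun k => match split k with inl i => c i | inr j => c2 j end).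
rewrite big_split_ord /=.
under eq_bigr do rewrite (unsplitK (inl _)).
under [X in _ - (_ + X)]eq_bigr do rewrite (unsplitK (inr _)).
have := I_add hc hc2; congr I.
by ring.
Qed.

(** A chain of length [e > d] gives [t^e] elements of degree at most [D * t] that are independent
    modulo [P 0], in a space whose dimension grows only like [t^d]. *)
Lemma krull_bound d C e (P : nat -> S -> Prop) :
  (0 < d)%N -> (forall i, (H i <= C * i.+1 ^ d.-1)%N) ->
  (forall k, (k <= e)%N -> prime_like (P k) /\ ~ P k 1) ->
  (forall k, (k < e)%N -> (forall u, P k u -> P k.+1 u) /\ exists2 f, P k.+1 f & ~ P k f) ->
  (forall f, I f -> P 0%N f) -> (e <= d)%N.
Proof.
move=> d0 HC hP hlt IP; rewrite leqNgt; apply/negP => lt_de.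
have [D hD] := chain_indep hP hlt.
(* As [t > C * D.+1 ^ d], the number [t ^ d.+1] exceeds [C * (D.+1 * t) ^ d]. *)
pose t := (C * D.+1 ^ d).+1.
have [T [g [cT sg ig]]] := hD t.
have [G hG] := span_leq (D * t).+1.
have [pP _] := hP 0%N isT.
have := indep_leq pP IP ig (fun a => hG _ (sg a)).
rewrite cT leqNgt => /negP; apply.
apply: (@leq_ltn_trans (C * (D.+1 * t) ^ d)%N).
  apply: (@leq_trans (\sum_(i < (D * t).+1) C * (D.+1 * t) ^ d.-1)%N).
    apply: leq_sum => i _; apply: leq_trans (HC i) _; rewrite leq_mul2l.
    apply/orP; right; case: (d.-1) => // k; rewrite leq_exp2r //.
    by have := ltn_ord i; rewrite /t mulSn; lia.
  rewrite sum_nat_const card_ord mulnCA leq_mul2l; apply/orP; right.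
  by rewrite -{2}(prednK d0) expnS leq_mul // /t mulSn; lia.
apply: (@leq_trans (t ^ d.+1)%N); last by rewrite leq_pexp2l.
by rewrite expnMn mulnA expnS ltn_mul2r expn_gt0 /= ltnS.
Qed.

End Krull.

(** * The star *)

(** A nonzero summand of largest size is the only one of that size, so its leading coefficient would
    survive in the sum. *)
Lemma sum_distinct_sizes (R : nzRingType) (I : finType) (F : I -> {poly R}) :
  (forall i j, F i != 0 -> F j != 0 -> size (F i) = size (F j) -> i = j) ->
  \sum_i F i = 0 -> forall i, F i = 0.
Proof.
move=> inj sF i0; apply/eqP/negP => /negP nz.
case: (@arg_maxnP I i0 (fun i => F i != 0) (fun i => size (F i)) nz) => i nzi imax.
have /(congr1 (fun p : {poly R} => p`_(size (F i)).-1)) := sF.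
rewrite coef0 coef_sum (bigD1 i) //= big1 ?addr0 => [/eqP|j ne].
  by rewrite -/(lead_coef _) lead_coef_eq0 (negbTE nzi).
have [->|nzj] := eqVneq (F j) 0; first by rewrite coef0.
apply: nth_default; rewrite -ltnS prednK ?size_poly_gt0 //.
have le := imax j nzj; rewrite /= in le; rewrite ltn_neqAle le andbT.
by apply: contra ne => /eqP /(inj _ _ nzj nzi) ->.
Qed.

Section Star.

Variables (S : idomainType) (sc : {rmorphism S -> {poly S}}).
Hypothesis sc_coef : forall p d, sc (sc p)`_d = ((sc p)`_d)%:P * 'X^d.
Local Notation hentry := (homog_entry sc).
Local Notation homog_mx := (homog_mx sc).
Local Notation fres := (fres sc).

Variables (m : nat) (x y : nat -> S).
Hypothesis m2 : (1 < m)%N.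
Hypothesis sc_x : forall i, (i <= m)%N -> sc (x i) = (x i)%:P * 'X.
Hypothesis sc_y : forall i, (i <= m)%N -> sc (y i) = (y i)%:P * 'X.

Definition star_gen i := x 0 * y i - x i * y 0.

Definition star_ideal (p : S) :=
  exists c : nat -> S, p = \sum_(i < m.+1) c i * star_gen i.

Local Notation J := star_ideal.

Lemma star_ideal_lin a u v : J u -> J v -> J (a * u + v).
Proof.
move=> [c ->] [d ->]; exists (fun i => a * c i + d i).
rewrite mulr_sumr -big_split; apply: eq_bigr => i _.
by rewrite mulrDl mulrA.
Qed.

Lemma star_ideal0 : J 0.
Proof. by exists (fun=> 0); rewrite big1 // => i _; rewrite mul0r. Qed.

Lemma star_idealD u v : J u -> J v -> J (u + v).
Proof. by move=> hu hv; rewrite -[u]mul1r; apply: star_ideal_lin. Qed.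

Lemma star_idealM a u : J u -> J (a * u).
Proof. by move=> hu; rewrite -[_ * _]addr0; apply: star_ideal_lin => //; apply: star_ideal0. Qed.

Lemma star_idealN u : J u -> J (- u).
Proof. by rewrite -mulN1r; apply: star_idealM. Qed.

Lemma star_idealB u v : J u -> J v -> J (u - v).
Proof. by move=> hu hv; apply: star_idealD => //; apply: star_idealN. Qed.

Lemma star_ideal_sum (I : Type) (r : seq I) (P : pred I) (F : I -> S) :
  (forall i, P i -> J (F i)) -> J (\sum_(i <- r | P i) F i).
Proof. by move=> h; elim/big_ind: _ => //; [exact: star_ideal0 | exact: star_idealD]. Qed.

Lemma star_ideal_gen i : (i <= m)%N -> J (star_gen i).
Proof.
move=> im; exists (fun j => (j == i)%:R).
rewrite (bigD1 (inord i)) //= inordK ?ltnS // eqxx mul1r big1 ?addr0 // => j ne.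
case: eqP => [ji|]; last by rewrite mul0r.
by case/eqP: ne; apply: val_inj; rewrite /= inordK ?ltnS.
Qed.

(* The image of rho is the polynomial ring A generated by x_0, y_m and the
   x_{i+1} - y_i (and the variables outside the star). *)
Variable rho : {rmorphism S -> S}.
Definition from_base (a : S) := exists alpha, a = rho alpha.
Definition theta i := x i.+1 - y i.

Hypothesis base_x0 : from_base (x 0).
Hypothesis base_ym : from_base (y m).
Hypothesis base_theta : forall i, (i < m)%N -> from_base (theta i).

Lemma from_base1 : from_base 1. Proof. by exists 1; rewrite rmorph1. Qed.
Lemma from_base0 : from_base 0. Proof. by exists 0; rewrite rmorph0. Qed.
Lemma from_baseN a : from_base a -> from_base (- a).
Proof. by move=> [s ->]; exists (- s); rewrite rmorphN. Qed.
Lemma from_baseD a b : from_base a -> from_base b -> from_base (a + b).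
Proof. by move=> [s ->] [t ->]; exists (s + t); rewrite rmorphD. Qed.
Lemma from_baseM a b : from_base a -> from_base b -> from_base (a * b).
Proof. by move=> [s ->] [t ->]; exists (s * t); rewrite rmorphM. Qed.
Lemma from_base_sum (I : Type) (r : seq I) (P : pred I) (F : I -> S) :
  (forall i, P i -> from_base (F i)) -> from_base (\sum_(i <- r | P i) F i).
Proof. by move=> h; elim/big_ind: _ => //; [exact: from_base0 | exact: from_baseD]. Qed.

Definition basis_elt (j : nat) : S :=
  match j with 0 => x 0 | 1 => y 0 | j => x 0 * x j end.
Definition basis_deg (j : nat) : nat := if (j < 2)%N then 1%N else 2%N.
Local Notation q := m.+1.
Definition basis_shift (l : 'I_q) := basis_deg l.

Definition basis_col : 'cV[S]_q := \col_l basis_elt l.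

Definition basis_comb (a : 'rV[S]_q) : S := \sum_l a 0 l * basis_elt l.

Lemma basis_combE a : basis_comb a = (a *m basis_col) 0 0.
Proof. by rewrite mxE; apply: eq_bigr => l _; rewrite mxE. Qed.

Lemma basis_combD a b : basis_comb (a + b) = basis_comb a + basis_comb b.
Proof. by rewrite -big_split; apply: eq_bigr => l _; rewrite mxE mulrDl. Qed.

Lemma basis_combZ c a : basis_comb (c *: a) = c * basis_comb a.
Proof. by rewrite mulr_sumr; apply: eq_bigr => l _; rewrite mxE mulrA. Qed.

Lemma hentryE d a : hentry d 0 a <-> sc a = a%:P * 'X^d.
Proof. by rewrite /homog_entry expr0 mulr1. Qed.

Lemma hentry_x i : (i <= m)%N -> hentry 1 0 (x i).
Proof. by move=> im; rewrite hentryE expr1 sc_x. Qed.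

Lemma hentry_y i : (i <= m)%N -> hentry 1 0 (y i).
Proof. by move=> im; rewrite hentryE expr1 sc_y. Qed.

Lemma hentry_theta i : (i < m)%N -> hentry 1 0 (theta i).
Proof. by move=> im; apply: hentryB; [apply: hentry_x | apply/hentry_y/ltnW]. Qed.

Lemma hentryM0 d e a b : hentry d 0 a -> hentry e 0 b -> hentry (d + e) 0 (a * b).
Proof.
rewrite !hentryE rmorphM => -> ->.
by rewrite polyCM exprD mulrACA.
Qed.

Lemma hentry_basis j : (j <= m)%N -> hentry (basis_deg j) 0 (basis_elt j).
Proof.
case: j => [|[|j]] jm; [exact: hentry_x | exact: hentry_y |].
by apply: (@hentryM0 1 1); apply: hentry_x.
Qed.

Definition spanned d f := exists a : 'rV[S]_q,
  (forall l, from_base (a 0 l) /\ hentry d (basis_shift l) (a 0 l)) /\ J (f - basis_comb a).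

Lemma spanned_eq d f f' : J (f - f') -> spanned d f' -> spanned d f.
Proof.
move=> jf [a [ha Ja]]; exists a; split=> //.
by have := star_idealD jf Ja; rewrite addrA subrK.
Qed.

Lemma spannedD d f f' : spanned d f -> spanned d f' -> spanned d (f + f').
Proof.
move=> [a [ha Ja]] [b [hb Jb]]; exists (a + b); split=> [l|].
  have [Aa h1] := ha l; have [Ab h2] := hb l.
  rewrite mxE; split; first exact: from_baseD.
  by move: h1 h2; rewrite /homog_entry rmorphD polyCD !mulrDl => -> ->.
by rewrite basis_combD opprD addrACA; apply: star_idealD.
Qed.

Lemma spannedM d e c f : from_base c -> hentry e 0 c -> spanned d f -> spanned (d + e) (c * f).
Proof.
move=> Ac hc [a [ha Ja]]; exists (c *: a); split=> [l|].
  have [Aa h1] := ha l; rewrite mxE; split; first exact: from_baseM.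
  by apply: hentryM h1; have := hentry_add d hc; rewrite add0n addnC.
by rewrite basis_combZ -mulrBr; apply: star_idealM.
Qed.

Lemma spanned_basis j : (j <= m)%N -> spanned (basis_deg j) (basis_elt j).
Proof.
move=> jm; pose i0 : 'I_q := inord j.
exists (delta_mx 0 i0); split=> [l|]; last first.
  rewrite /basis_comb (bigD1 i0) //= mxE !eqxx mul1r big1 ?addr0 => [|l ne].
    by rewrite inordK ?ltnS // subrr; apply: star_ideal0.
  by rewrite mxE eqxx (negbTE ne) mul0r.
rewrite mxE eqxx /=; case: eqP => [->|_].
  split; first exact: from_base1.
  by rewrite /homog_entry rmorph1 /basis_shift /= inordK ?ltnS.
by split; [exact: from_base0 | rewrite /homog_entry rmorph0 !mul0r].
Qed.

(* With x_{m+1} = y_m the equation x_{i+1} = y_i + theta_i holds for all i <= m. *)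
Definition x_ext i := if (i <= m)%N then x i else y m.
Definition theta_ext i := if (i < m)%N then theta i else 0.

Lemma x_ext_y i : (i <= m)%N -> x_ext i.+1 = y i + theta_ext i.
Proof.
rewrite /x_ext /theta_ext /theta => im; case: ltnP => h; first by rewrite addrC subrK.
by rewrite addr0; congr y; apply/eqP; rewrite eqn_leq im h.
Qed.

Lemma base_theta_ext i : from_base (theta_ext i).
Proof. by rewrite /theta_ext; case: ifP => h; [exact: base_theta | exact: from_base0]. Qed.

Lemma hentry_theta_ext i : hentry 1 0 (theta_ext i).
Proof.
rewrite /theta_ext; case: ifP => h; first exact: hentry_theta.
by rewrite /homog_entry rmorph0 !mul0r.
Qed.

Lemma spanned_x0x j : (j <= m.+1)%N -> spanned 2 (x 0 * x_ext j).
Proof.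
case: (leqP j m) => jm jm1; last first.
  rewrite /x_ext leqNgt jm /= mulrC.
  apply: (@spannedM 1 1) => //; last exact: (@spanned_basis 0).
  exact: hentry_y.
rewrite /x_ext jm; case: j jm {jm1} => [|[|j]] jm.
- apply: (@spannedM 1 1) => //; last exact: (@spanned_basis 0).
  exact: hentry_x.
- have -> : x 0 * x 1%N = theta 0 * x 0 + x 0 * y 0 by rewrite /theta; ring.
  apply: spannedD; apply: (@spannedM 1 1) => //.
  + exact: base_theta.
  + exact: hentry_theta.
  + exact: (@spanned_basis 0).
  + exact: hentry_x.
  + exact: (@spanned_basis 1).
- exact: (@spanned_basis j.+2).
Qed.

(** Modulo the ideal, [x 0 * (x i * y j - x j * y i)] vanishes, so [x 0 * x i.+1 * x j] and
    [x 0 * x i * x_ext j.+1] differ by base multiples of products covered by [spanned_x0x]. Lowering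
    [i] and raising [j] ends with an extra factor [x 0] or [y m], both from the base. *)
Lemma spanned_x0xx i j : (i <= m)%N -> (j <= m.+1)%N -> spanned 3 (x 0 * x i * x_ext j).
Proof.
elim: i j => [|i IH] j im jm.
  have -> : x 0 * x 0 * x_ext j = x 0 * (x 0 * x_ext j) by ring.
  by apply: (@spannedM 2 1); [| exact: hentry_x | exact: spanned_x0x].
have im' : (i <= m)%N by apply: ltnW.
case: (leqP j m) => jm'; last first.
  rewrite {1}/x_ext leqNgt jm' /= mulrC.
  have := @spanned_x0x i.+1 (ltnW im); rewrite /x_ext im => h.
  by apply: (@spannedM 2 1) => //; exact: hentry_y.
have := IH j.+1 im' jm'; rewrite x_ext_y // => h1.
have h2 : spanned 3 (theta i * (x 0 * x_ext j)).
  apply: (@spannedM 2 1); [exact: base_theta | exact: hentry_theta |].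
  exact: spanned_x0x.
have h3 : spanned 3 (- theta_ext j * (x 0 * x_ext i)).
  apply: (@spannedM 2 1); first exact/from_baseN/base_theta_ext.
    by have := hentry_theta_ext j; rewrite !hentryE rmorphN polyCN mulNr => ->.
  by apply: spanned_x0x; apply: ltnW.
apply: spanned_eq (spannedD h1 (spannedD h2 h3)).
rewrite /x_ext jm' im' /theta.
have -> : x 0 * x i.+1 * x j - (x 0 * x i * (y j + theta_ext j) +
    ((x i.+1 - y i) * (x 0 * x j) + - theta_ext j * (x 0 * x i))) =
    x j * star_gen i + - x i * star_gen j by rewrite /star_gen; ring.
by apply: star_ideal_lin; [exact: star_ideal_gen | apply: star_idealM; exact: star_ideal_gen].
Qed.

Lemma spanned_x_basis i j : (0 < i <= m)%N -> (j <= m)%N ->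
  spanned (basis_deg j).+1 (x i * basis_elt j).
Proof.
move=> /andP [i0 im]; case: j => [|[|j]] jm.
- have := @spanned_x0x i (leqW im); rewrite /x_ext im mulrC; exact.
- have e : y i = x_ext i.+1 - theta_ext i by rewrite x_ext_y // addrK.
  apply: (@spanned_eq _ _ (x 0 * y i)).
    have -> : x i * basis_elt 1 - x 0 * y i = - star_gen i by rewrite /star_gen /=; ring.
    exact/star_idealN/star_ideal_gen.
  have -> : x 0 * y i = x 0 * x_ext i.+1 + - theta_ext i * x 0 by rewrite e; ring.
  apply: spannedD; first exact: spanned_x0x.
  apply: (@spannedM 1 1); last exact: (@spanned_basis 0).
    exact/from_baseN/base_theta_ext.
  by have := hentry_theta_ext i; rewrite !hentryE rmorphN polyCN mulNr => ->.
- have := @spanned_x0xx i j.+2 im (leqW jm); rewrite /x_ext jm.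
  by have -> : x 0 * x i * x j.+2 = x i * basis_elt j.+2 by rewrite /=; ring.
Qed.

Lemma mult_matrix i : (0 < i <= m)%N -> exists T : 'M[S]_q,
  [/\ forall k l, from_base (T k l), homog_mx (fun k => basis_shift k + 1)%N basis_shift T
    & forall k : 'I_q, J (x i * basis_elt k - basis_comb (row k T))].
Proof.
move=> im; have /boolp.choice [t ht] : forall k : 'I_q, exists a : 'rV[S]_q,
    (forall l, from_base (a 0 l) /\ hentry (basis_shift k + 1) (basis_shift l) (a 0 l)) /\
    J (x i * basis_elt k - basis_comb a).
  by move=> k; rewrite addn1; apply: spanned_x_basis => //; rewrite -ltnS.
exists (\matrix_k t k); split=> [k l|k l|k]; rewrite ?rowK ?mxE.
- by case: (ht k) => /(_ l) [].
- by case: (ht k) => /(_ l) [].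
- by case: (ht k).
Qed.

Variables (phi kappa : {rmorphism S -> {poly S}}).
Hypothesis phi_x : forall i, (i <= m)%N ->
  phi (x i) = \sum_(l < i.+1) (x l)%:P * 'X^(i - l).
Hypothesis phi_y : forall i, (i <= m)%N -> phi (y i) = phi (x i) * 'X.
Hypothesis phi_rho : forall a, phi (rho a) = kappa a \Po (phi (x m) * 'X).
Hypothesis kappa_inj : forall a, kappa a = 0 -> rho a = 0.
Hypothesis x0_neq0 : x 0 != 0.

Lemma phi_x0 : phi (x 0) = (x 0)%:P.
Proof. by rewrite phi_x // big_ord_recl big_ord0 addr0 subnn mulr1. Qed.

(** The leading coefficient is [x 0], from the summand [l = 0]. *)
Lemma size_phi_x i : (i <= m)%N -> size (phi (x i)) = i.+1.
Proof.
move=> im; rewrite phi_x // big_ord_recl /= subn0.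
rewrite size_polyDl; first by rewrite size_Cmul // size_polyXn.
rewrite size_Cmul // size_polyXn ltnS.
apply: leq_trans (size_sum _ _ _) _; apply/bigmax_leqP => l _.
rewrite /bump /= add1n; apply: leq_trans (size_polyMleq _ _) _.
rewrite size_polyXn addnS /=.
apply: leq_trans (leq_add (size_polyC_leq1 _) (leqnn _)) _.
by have := ltn_ord l; lia.
Qed.

Lemma phi_star_ideal p : J p -> phi p = 0.
Proof.
move=> [c ->]; rewrite rmorph_sum; apply: big1 => i _; rewrite rmorphM.
have im : (i <= m)%N by rewrite -ltnS.
by rewrite rmorphB !rmorphM phi_y // phi_y // mulrCA mulrA [phi (x i) * _]mulrC subrr mulr0.
Qed.

Lemma size_phi_basis j : (j <= m)%N -> size (phi (basis_elt j)) = j.+1.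
Proof.
case: j => [|[|j]] jm /=; first by rewrite size_phi_x.
  by rewrite phi_y // phi_x0 size_Cmul ?size_polyX.
by rewrite rmorphM phi_x0 size_Cmul // size_phi_x.
Qed.

(* phi kills J, is injective on A apart from y_m, which it sends to a polynomial
   of degree m + 1, and sends the basis elements to polynomials of degrees
   0, ..., m: so the nonzero terms have degrees distinct modulo m + 1. *)
Lemma basis_free (a : 'rV[S]_q) : (forall l, from_base (a 0 l)) -> J (basis_comb a) -> a = 0.
Proof.
move=> /boolp.choice [al hal] /phi_star_ideal; rewrite rmorph_sum => h.
pose C := phi (x m) * 'X.
have sC : size C = m.+2 by rewrite size_mulX ?size_phi_x // -size_poly_gt0 size_phi_x.
pose F (l : 'I_q) := (kappa (al l) \Po C) * phi (basis_elt l).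
have Fnz l : F l != 0 -> kappa (al l) != 0 /\
    size (F l) = ((size (kappa (al l))).-1 * m.+1 + l.+1)%N.
  move=> nz; have k0 : kappa (al l) != 0.
    by apply: contraNneq nz => k0; rewrite /F k0 comp_poly0 mul0r.
  split=> //; have c0 : kappa (al l) \Po C != 0.
    by apply: contraNneq nz => k1; rewrite /F k1 mul0r.
  have sl : size (phi (basis_elt l)) = l.+1 by rewrite size_phi_basis // -ltnS.
  rewrite size_mul // -?size_poly_gt0 ?sl // addnS /=.
  have := size_comp_poly (kappa (al l)) C; rewrite sC /= => <-.
  by rewrite addnS -addSn prednK // size_poly_gt0.
have F0 l : F l = 0.
  apply: sum_distinct_sizes => [i j /Fnz [_ ->] /Fnz [_ ->] e|].
    apply: ord_inj; move: e; rewrite !addnS => /eqP; rewrite eqSS => /eqP.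
    move=> /(congr1 (fun n => n %% m.+1)%N).
    by rewrite !modnMDl !modn_small // ltn_ord.
  rewrite -[RHS]h; apply: eq_bigr => i _.
  by rewrite /F rmorphM hal phi_rho.
apply/rowP => l; rewrite hal mxE; apply: kappa_inj.
have /eqP := F0 l; rewrite mulf_eq0 => /orP [|/eqP b0]; last first.
  by have := @size_phi_basis l; rewrite b0 size_poly0 -ltnS ltn_ord => /(_ isT).
by rewrite comp_poly_eq0 ?sC // => /eqP.
Qed.

Variable T : nat -> 'M[S]_q.
Hypothesis base_T : forall i, (0 < i <= m)%N -> forall k l, from_base (T i k l).
Hypothesis hT : forall i, (0 < i <= m)%N -> homog_mx (fun k => basis_shift k + 1)%N basis_shift (T i).
Hypothesis JT : forall i, (0 < i <= m)%N ->
  forall k : 'I_q, J (x i * basis_elt k - basis_comb (row k (T i))).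

Lemma basis_comb_mul (v : 'rV[S]_q) (M : 'M[S]_q) :
  basis_comb (v *m M) = \sum_k v 0 k * basis_comb (row k M).
Proof.
rewrite basis_combE -mulmxA mxE; apply: eq_bigr => k _; congr (_ * _).
by rewrite basis_combE -row_mul [RHS]mxE.
Qed.

Lemma basis_comb_T i (v : 'rV[S]_q) : (0 < i <= m)%N ->
  J (x i * basis_comb v - basis_comb (v *m T i)).
Proof.
move=> im; rewrite basis_comb_mul mulr_sumr -sumrB; apply: star_ideal_sum => k _.
by rewrite mulrCA -mulrBr; apply: star_idealM; apply: JT.
Qed.

(** Both products describe multiplication by [x i * x j] on the same module, and their entries lie
    in the base, over which the basis is free. *)
Lemma T_comm i j : (0 < i <= m)%N -> (0 < j <= m)%N -> T i *m T j = T j *m T i.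
Proof.
move=> im jm; apply/row_matrixP => k; apply/eqP; rewrite -subr_eq0; apply/eqP.
apply: basis_free => [l|].
  rewrite !mxE; apply: from_baseD; first by apply: from_base_sum => ? _; apply: from_baseM; apply: base_T.
  by apply/from_baseN/from_base_sum => ? _; apply: from_baseM; apply: base_T.
rewrite -scaleN1r basis_combD basis_combZ !row_mul mulN1r.
have h1 := basis_comb_T (row k (T i)) jm; have h2 := basis_comb_T (row k (T j)) im.
have h3 := star_idealM (x j) (JT im k); have h4 := star_idealM (x i) (JT jm k).
have := star_idealB (star_idealB (star_idealD h2 h4) h1) h3; congr J.
ring.
Qed.

Definition Phi i : 'M[S]_q := (x i.+1)%:M - T i.+1.

Lemma Phi_comm i j : (i < m)%N -> (j < m)%N -> Phi i *m Phi j = Phi j *m Phi i.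
Proof.
move=> im jm.
have cs a (M : 'M[S]_q) : GRing.comm (a%:M : 'M_q) M by exact/esym/scalar_mxC.
have ct : GRing.comm (T i.+1) (T j.+1) by exact: T_comm.
apply: (commrB (R := 'M[S]_q)).
  exact/commr_sym/cs.
by apply/commr_sym/commrB; [exact/commr_sym/cs | exact/commr_sym].
Qed.

(* The sum of the images of Phi 0, ..., Phi (i - 1). *)
Fixpoint koszul i (v : 'rV[S]_q) : Prop :=
  if i is j.+1 then exists u w, koszul j u /\ v = u + w *m Phi j else v = 0.

Lemma submodule_koszul i : submodule (koszul i).
Proof.
elim: i => [|i [L0 Lc]] /=.
  by split=> // a u v -> ->; rewrite scaler0 addr0.
split; first by exists 0, 0; rewrite mul0mx addr0.
move=> a _ _ [u [w [hu ->]]] [u' [w' [hu' ->]]].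
exists (a *: u + u'), (a *: w + w'); split; first exact: Lc.
by rewrite mulmxDl -scalemxAl scalerDr addrACA.
Qed.

Lemma koszul_mul_Phi i j v : (i <= m)%N -> (j < m)%N -> koszul i v -> koszul i (v *m Phi j).
Proof.
move=> im jm; elim: i im v => [|i IH] im v /=; first by move=> ->; rewrite mul0mx.
move=> [u [w [hu ->]]]; exists (u *m Phi j), (w *m Phi j); split.
  exact: (IH (ltnW im)).
by rewrite mulmxDl -!mulmxA Phi_comm.
Qed.

Variable tau : nat -> {rmorphism S -> {poly S}}.
Hypothesis tau0 : forall j s, (tau j s).[0] = s.
Hypothesis tau_A : forall j a, (j < m)%N -> from_base a -> tau j a = a%:P.
Hypothesis tau_x : forall j i, (j < m)%N -> (i < m)%N ->
  tau j (x i.+1) = (x i.+1)%:P + (if i == j then 'X else 0).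

Lemma tau_Phi i j k l : (i < m)%N -> (j < m)%N ->
  tau j (Phi i k l) = (Phi i k l)%:P + (if (i == j) && (k == l) then 'X else 0).
Proof.
move=> im jm; rewrite !mxE rmorphB rmorphMn /= (tau_A jm (base_T (im : (0 < i.+1 <= m)%N) k l)).
rewrite tau_x // polyCB polyCMn mulrnDl addrAC; congr (_ + _).
by case: (i == j); case: (k == l); rewrite ?mulr1n ?mulr0n.
Qed.

(** Among [x 1], ..., [x m] the substitution [tau j] moves only [x j.+1], and it fixes the base; so
    it fixes [Phi i] for [i < j]. *)
Lemma koszul_tau i j e v : (i <= j)%N -> (j < m)%N -> koszul i v -> koszul i (coef_vec (tau j) e v).
Proof.
move=> + jm; elim: i v => [|i IH] v ij /=.
  by move=> ->; apply/rowP => k; rewrite !mxE rmorph0 coef0.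
move=> [u [w [hu ->]]]; exists (coef_vec (tau j) e u), (coef_vec (tau j) e w).
split; first exact: (IH _ (ltnW ij)).
rewrite coef_vecD coef_vec_mul // => k l.
by rewrite tau_Phi ?(ltn_trans ij) // (ltn_eqF ij) addr0.
Qed.

Lemma koszul_regular j v : (j < m)%N -> koszul j (v *m Phi j) -> koszul j v.
Proof.
move=> jm; apply: (@monic_regular S (tau j) q (koszul j) 1
  (fun e => if e is 0 then Phi j else 1%:M)) => //.
- exact: submodule_koszul.
- by move=> w e; apply: koszul_tau.
- move=> k l; rewrite tau_Phi // eqxx big_ord_recr big_ord1 /= expr0 mulr1 expr1.
  by congr (_ + _); rewrite mxE; case: (k == l); rewrite ?mul1r ?mul0r.
- by case=> [|e] w hw; [apply: koszul_mul_Phi => //; apply: ltnW | rewrite mulmx1].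
Qed.

Lemma homog_mx_Phi i : (i < m)%N -> homog_mx (fun k => basis_shift k + 1)%N basis_shift (Phi i).
Proof.
move=> im k l; rewrite !mxE; apply: hentryB; last exact: hT.
have hx := hentry_x (im : (i.+1 <= m)%N).
case: (k =P l) => [<-|_]; rewrite ?mulr1n ?mulr0n.
  by have := hentry_add (basis_shift k) hx; rewrite add0n addnC.
by rewrite /homog_entry rmorph0 !mul0r.
Qed.

Lemma basis_shift_le l : (basis_shift l <= 2)%N.
Proof. by rewrite /basis_shift /basis_deg; case: ifP. Qed.

(** Each [Phi i] contributes a mapping cone. It has degree 1 and the basis has degree at most 2, so
    the bound 3 on the first shifts is kept throughout. *)
Lemma koszul_fres i : (i <= m)%N -> exists2 P, fres i 3 basis_shift (koszul i) P &
  \sum_k 'X^(basis_shift k) - P = (1 - 'X) ^+ i * \sum_k 'X^(basis_shift k).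
Proof.
elim: i => [|i IH] im.
  by exists 0; [split | rewrite subr0 mul1r].
have [P fP eP] := IH (ltnW im).
exists (P + 'X^1 * (\sum_k 'X^(basis_shift k) - P)); last first.
  by rewrite (exprS _ i) -mulrA -eP expr1; ring.
apply: fres_cone fP (homog_mx_Phi im) _ _ _ _ => // [v|k].
  split; last exact: koszul_regular.
  by apply: koszul_mul_Phi => //; apply: ltnW.
by rewrite addn1 ltnS basis_shift_le.
Qed.

Hypothesis base_ind : forall Q : S -> Prop,
  (forall u v, Q u -> Q v -> Q (u + v)) -> (forall a u, from_base a -> Q u -> Q (a * u)) ->
  (forall i u, (i < m)%N -> Q u -> Q (x i.+1 * u)) -> Q 1 -> forall s, Q s.

Lemma koszul_leq i j v : (i <= j)%N -> koszul i v -> koszul j v.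
Proof.
move=> /subnK <-; elim: (j - i)%N => [|n IH] //= h.
by exists v, 0; rewrite mul0mx addr0; split=> //; apply: IH.
Qed.

Lemma koszul_Phi i w : (i < m)%N -> koszul m (w *m Phi i).
Proof.
move=> im; apply: (koszul_leq im); exists 0, w; rewrite add0r; split=> //.
by case: (submodule_koszul i).
Qed.

Lemma koszul_sub_star_ideal i v : (i <= m)%N -> koszul i v -> J (basis_comb v).
Proof.
elim: i v => [|i IH] v im /=.
  by move=> ->; rewrite /basis_comb big1 => [|l _]; rewrite ?mxE ?mul0r //; apply: star_ideal0.
move=> [u [w [hu ->]]]; rewrite basis_combD; apply: star_idealD; first exact: (IH _ (ltnW im)).
rewrite /Phi mulmxBr mul_mx_scalar -scaleN1r basis_combD !basis_combZ mulN1r.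
exact: basis_comb_T.
Qed.

(** Modulo the images of the [Phi i], each [x i.+1] acts as the matrix [T i.+1], so every vector
    reduces to one with entries in the base; if it represents an element of the ideal, freeness
    makes the reduction zero. *)
Lemma koszulE v : koszul m v <-> J (basis_comb v).
Proof.
split; first exact: koszul_sub_star_ideal.
have red s (l : 'I_q) : exists2 a : 'rV[S]_q, (forall k, from_base (a 0 k)) & koszul m (s *: delta_mx 0 l - a).
  have [Ls0 Lsc] := submodule_koszul m.
  move: s; apply: base_ind => [u u' [a Aa La] [a' Aa' La']|c u Ac [a Aa La]|i u im [a Aa La]|].
  - exists (a + a') => [k|]; first by rewrite mxE; apply: from_baseD.
    rewrite scalerDl opprD addrACA; have h := submoduleD (submodule_koszul m) La La'. exact: h.
  - exists (c *: a) => [k|]; first by rewrite mxE; apply: from_baseM.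
    have h := submoduleZ (submodule_koszul m) c La; by rewrite -scalerA -scalerBr.
  - exists (a *m T i.+1) => [k|].
      by rewrite mxE; apply: from_base_sum => ? _; apply: from_baseM => //; apply: base_T.
    have := Lsc (x i.+1) _ _ La (koszul_Phi a im).
    congr koszul; rewrite /Phi mulmxBr mul_mx_scalar scalerBr scalerA.
    by rewrite addrA subrK.
  - exists (delta_mx 0 l) => [k|]; last by rewrite scale1r subrr.
    by rewrite mxE; case: (_ && _); [exact: from_base1 | exact: from_base0].
have [a Aa La] : exists2 a : 'rV[S]_q, (forall k, from_base (a 0 k)) & koszul m (v - a).
  have /boolp.choice [f hf] : forall l : 'I_q, exists a : 'rV[S]_q,
      (forall k, from_base (a 0 k)) /\ koszul m (v 0 l *: delta_mx 0 l - a).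
    by move=> l; have [a h1 h2] := red (v 0 l) l; exists a.
  exists (\sum_l f l) => [k|].
    by rewrite summxE; apply: from_base_sum => l _; case: (hf l).
  rewrite {1}[v]row_sum_delta -sumrB; apply: (submodule_sum (submodule_koszul m)) => l _.
  by case: (hf l).
move=> Jv; have a0 : a = 0.
  apply: basis_free => //; have := star_idealB Jv (koszul_sub_star_ideal (leqnn m) La).
  by rewrite basis_combD -scaleN1r basis_combZ mulN1r opprB addrC subrK.
by rewrite a0 subr0 in La.
Qed.

Variables tx0 ty0 : {rmorphism S -> {poly S}}.
Hypothesis tx00 : forall s, (tx0 s).[0] = s.
Hypothesis ty00 : forall s, (ty0 s).[0] = s.
Hypothesis tx0_x : tx0 (x 0) = (x 0)%:P + 'X.
Hypothesis ty0_x : ty0 (x 0) = (x 0)%:P.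
Hypothesis ty0_y : ty0 (y 0) = (y 0)%:P + 'X.

Lemma monic_scalar (f : {rmorphism S -> {poly S}}) (a : S) (L : 'rV[S]_1 -> Prop) v :
  (forall s, (f s).[0] = s) -> submodule L -> (forall w e, L w -> L (coef_vec f e w)) ->
  f a = a%:P + 'X -> L (v *m a%:M) -> L v.
Proof.
move=> f0 sL fL fa; apply: (@monic_regular S f 1 L 1
  (fun e => if e is 0 then a%:M else 1%:M)) => //.
  move=> k l; rewrite !ord1 big_ord_recr big_ord1 /= expr0 mulr1 expr1 !mxE.
  by rewrite mulr1n mul1r.
case=> [|e] w hw; last by rewrite mulmx1.
by rewrite mul_mx_scalar; apply: submoduleZ.
Qed.

Definition pair_ideal (v : 'rV[S]_1) := exists a c, v 0 0 = a * x 0 + c * y 0.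

Lemma pair_fres : exists2 P, fres 2 1 (fun _ : 'I_1 => 0%N) pair_ideal P &
  \sum_(k < 1) 'X^0 - P = (1 - 'X) ^+ 2.
Proof.
pose b := fun _ : 'I_1 => 0%N.
pose L0 (v : 'rV[S]_1) := v = 0.
have sL0 : submodule L0 by split=> // a u v -> ->; rewrite scaler0 addr0.
have f0 : fres 0 1 b L0 0 by split.
have bE : \sum_(k < 1) 'X^(b k) = 1 :> {poly int} by rewrite big_ord1 expr0.
have f1 := @fres_cone S sc sc_coef 0 1 1 1 1 b L0 0 (x 0)%:M f0 (homog_mx_scalar b (hentry_x (leq0n m))).
have {}f1 := f1 _ (leqnn _) (leqnn _) (fun=> leqnn _).
pose L1 v := exists u w, L0 u /\ v = u + w *m (x 0)%:M.
have sL1 : submodule L1.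
  split; first by exists 0, 0; rewrite mul0mx addr0.
  move=> a _ _ [u [w [-> ->]]] [u' [w' [-> ->]]].
  by exists 0, (a *: w + w'); rewrite !add0r mulmxDl -scalemxAl.
have {}f1 : fres 1 1 b L1 (0 + 'X^1 * (\sum_k 'X^(b k) - 0)).
  apply: f1 => v; split=> [->|]; first by rewrite mul0mx.
  apply: (monic_scalar tx00 sL0 _ tx0_x) => w e ->.
  by apply/rowP => k; rewrite !mxE rmorph0 coef0.
have f2 := @fres_cone S sc sc_coef 1 1 1 1 1 b L1 _ (y 0)%:M f1 (homog_mx_scalar b (hentry_y (leq0n m))).
have {}f2 := f2 _ (leqnn _) (leqnn _) (fun=> leqnn _).
have inj v : L1 v <-> L1 (v *m (y 0)%:M).
  split; first by rewrite mul_mx_scalar; apply: submoduleZ.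
  apply: (monic_scalar ty00 sL1 _ ty0_y) => w e [_ [w' [-> ->]]].
  exists 0, (coef_vec ty0 e w'); split=> //; rewrite !add0r.
  apply: coef_vec_mul => k l; rewrite !mxE !ord1 mulr1n; exact: ty0_x.
refine (ex_intro2 _ _ _ (fres_eq _ (f2 inj)) _).
  move=> v /=; split=> [[_ [w [[_ [w' [-> ->]]] ->]]]|[a [c hv]]].
    exists (w' 0 0), (w 0 0).
    by rewrite add0r !mul_mx_scalar !mxE mulrC [y 0 * _]mulrC.
  exists (a%:M *m (x 0)%:M), c%:M; split; first by exists 0, a%:M; rewrite add0r.
  by apply/rowP => k; rewrite !ord1 hv !mul_mx_scalar !mxE !mulr1n mulrC [y 0 * _]mulrC.
by rewrite bE expr1; ring.
Qed.

Lemma star_ideal_graded p d : J p -> J (sc p)`_d.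
Proof.
move=> [c ->]; rewrite rmorph_sum coef_sum; apply: star_ideal_sum => i _.
have im : (i <= m)%N by rewrite -ltnS.
have : hentry 2 0 (star_gen i).
  by apply: hentryB; apply: (@hentryM0 1 1); first [apply: hentry_x | apply: hentry_y].
rewrite hentryE rmorphM => ->; rewrite mulrCA mulrC coefMC coefMXn.
by case: ifP => _; [rewrite mul0r; exact: star_ideal0 | apply: star_idealM; exact: star_ideal_gen].
Qed.

(** The entry 1 makes the other generators redundant, but with them the relations form an extension
    of the ideal of [x 0] and [y 0] by the relations between the basis elements, as the horseshoe
    lemma requires. *)
Definition star_aug : 'cV[S]_(q + 1) := col_mx basis_col 1%:M.
Definition star_shift := shift_cat basis_shift (fun _ : 'I_1 => 0%N).

Lemma star_aug_homog k : hentry (star_shift k) 0 (star_aug k 0).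
Proof.
rewrite -[k]splitK /unsplit; case: (split k) => i.
  rewrite /star_shift shift_catl col_mxEu mxE; apply: hentry_basis.
  by rewrite -ltnS.
by rewrite /star_shift shift_catr col_mxEd !mxE !ord1 /homog_entry rmorph1.
Qed.

Lemma star_fres : exists2 P,
  fres m 3 star_shift (fun v => J ((v *m star_aug) 0 0)) P &
  \sum_k 'X^(star_shift k) - P =
    (1 - 'X) ^+ m * (\sum_k 'X^(basis_shift k)) + (1 - 'X) ^+ 2.
Proof.
have [P1 f1 e1] := koszul_fres (leqnn m).
have [P2 f2 e2] := pair_fres.
exists (P1 + P2); last by rewrite sum_shift_cat -e1 -e2; ring.
have We a s : ((row_mx a s : 'rV[S]_(q + 1)) *m star_aug) 0 0 = basis_comb a + s 0 0.
  by rewrite mul_row_col mulmx1 mxE basis_combE.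
have haug : homog_mx star_shift (fun _ : 'I_1 => 0%N) star_aug.
  by move=> k l; rewrite ord1; apply: star_aug_homog.
apply: fres_ext => //.
- split; first by rewrite mul0mx mxE; apply: star_ideal0.
  move=> a u v hu hv; rewrite mulmxDl -scalemxAl.
  have -> : (a *: (u *m star_aug) + v *m star_aug) 0 0 =
      a * (u *m star_aug) 0 0 + (v *m star_aug) 0 0.
    by rewrite [LHS]mxE; congr (_ + _); rewrite [LHS]mxE.
  exact: star_ideal_lin.
- move=> v hv d; have -> : (component sc star_shift d v *m star_aug) 0 0 =
      (sc ((v *m star_aug) 0 0))`_d.
    by rewrite -(component_mul d v haug) [LHS]mxE expr0 mulr1.
  exact: star_ideal_graded.
- apply: fres_eq f1 => v; rewrite We mxE addr0; exact: koszulE.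
(* The Koszul resolution of the pair has length 2, which is at most [m]. *)
- apply: fres_leqr (isT : (1 <= 3)%N) _; apply: fres_leql m2 _.
  apply: fres_eq f2 => v; split=> [[a [c hv]]|[u]]; last first.
    rewrite We => [[c hc]].
    rewrite /pair_ideal; have -> : v 0 0 = (\sum_(i < m.+1) c i * star_gen i) - basis_comb u by rewrite -hc; ring.
    pose Q s := exists a b, s = a * x 0 + b * y 0.
    have QD s t : Q s -> Q t -> Q (s + t).
      move=> [a [b ->]] [a' [b' ->]]; exists (a + a'), (b + b'); ring.
    have QM s t : Q t -> Q (s * t).
      move=> [a [b ->]]; exists (s * a), (s * b); ring.
    have Q0 : Q 0 by exists 0, 0; rewrite !mul0r addr0.
    have : Q (\sum_(i < m.+1) c i * star_gen i + -1 * basis_comb u).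
      apply: (QD).
        apply: (big_ind Q Q0 QD) => i _; apply: (QM).
        exists (y i), (- x i); rewrite /star_gen; ring.
      apply: (QM); rewrite /basis_comb; apply: (big_ind Q Q0 QD) => i _; apply: (QM).
      case: (nat_of_ord i) => [|[|j]] /=.
      - by exists 1, 0; ring.
      - by exists 0, 1; ring.
      - by exists (x j.+2), 0; ring.
    by rewrite mulN1r.
  pose i1 : 'I_q := inord 1.
  exists (- (a *: delta_mx 0 0 + c *: delta_mx 0 i1)); rewrite We hv.
  have dd i : basis_comb (delta_mx 0 i) = basis_elt i.
    rewrite /basis_comb (bigD1 i) //= mxE !eqxx mul1r big1 ?addr0 // => l ne.
    by rewrite mxE eqxx (negbTE ne) mul0r.
  have -> : basis_comb (- (a *: delta_mx 0 0 + c *: delta_mx 0 i1)) + (a * x 0 + c * y 0) = 0.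
    rewrite -scaleN1r !(basis_combZ, basis_combD) !dd inordK ?ltnS ?(ltnW m2) //=; ring.
  exact: star_ideal0.
Qed.

End Star.

(** * Disjoint edges *)

Section AddRegular.

Variables (S : comNzRingType) (sc : {rmorphism S -> {poly S}}).
Hypothesis sc_coef : forall p d, sc (sc p)`_d = ((sc p)`_d)%:P * 'X^d.
Local Notation hentry := (homog_entry sc).
Local Notation fres := (fres sc).

Definition ideal (I : S -> Prop) := I 0 /\ forall a u v, I u -> I v -> I (a * u + v).

Definition add_ideal (I : S -> Prop) f p := exists u s, I u /\ p = u + s * f.

Lemma ideal_add_ideal I f : ideal I -> ideal (add_ideal I f).
Proof.
move=> [I0 Ic]; split; first by exists 0, 0; rewrite mul0r addr0.
move=> a _ _ [u [s [hu ->]]] [u' [s' [hu' ->]]].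
exists (a * u + u'), (a * s + s'); split; first exact: Ic.
ring.
Qed.

Definition stable (tau : {rmorphism S -> {poly S}}) (I : S -> Prop) :=
  forall p e, I p -> I (tau p)`_e.

Lemma stable_add_ideal (tau : {rmorphism S -> {poly S}}) I f :
  tau f = f%:P -> stable tau I -> stable tau (add_ideal I f).
Proof.
move=> tf st _ e [u [s [hu ->]]]; exists (tau u)`_e, (tau s)`_e.
by rewrite rmorphD rmorphM tf coefD coefMC; split=> //; apply: st.
Qed.

Lemma quadratic_regular (tau : {rmorphism S -> {poly S}}) (I : S -> Prop) f a :
  (forall s, (tau s).[0] = s) -> ideal I -> stable tau I ->
  tau f = f%:P + a%:P * 'X + 'X^2 -> forall s, I (s * f) -> I s.
Proof.
move=> tau0 [I0 Ic] st tf s Isf.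
have sL : submodule (fun v : 'rV[S]_1 => I (v 0 0)).
  by split=> [|c u v]; rewrite !mxE //; apply: Ic.
pose Psi e : 'M[S]_1 := match e with 0 => f | 1 => a | _ => 1 end%:M.
have := @monic_regular S tau 1 (fun v => I (v 0 0)) 2 Psi f%:M tau0 sL.
move=> /(_ _ _ _ _ s%:M); rewrite mul_mx_scalar !mxE mulr1n mulrC.
apply => //.
- by move=> v e hv; rewrite mxE; apply: st.
- move=> k l; rewrite !ord1 !big_ord_recr big_ord0 /= !mxE !mulr1n tf.
  by rewrite add0r expr0 mulr1 expr1 mul1r.
- move=> e v hv; rewrite mul_mx_scalar mxE -[_ * _]addr0; exact: Ic.
Qed.

Variables (q : nat) (b : 'I_q -> nat) (g : 'cV[S]_q).

(** Multiplication by [f] acts through a scalar matrix, so the same generators serve. The cone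
    raises the degree by 2 and the step by 1, hence the bound on the shifts only by one. *)
Lemma fres_add_ideal l r (I : S -> Prop) f P :
  ideal I -> (forall s, exists v : 'rV_q, I (s - (v *m g) 0 0)) ->
  hentry 2 0 f -> (forall s, I (s * f) -> I s) -> (forall k, b k < r)%N ->
  fres l r b (fun v => I ((v *m g) 0 0)) P ->
  fres l.+1 r.+1 b (fun v => add_ideal I f ((v *m g) 0 0))
    (P + 'X^2 * (\sum_k 'X^(b k) - P)).
Proof.
move=> [I0 Ic] surj hf reg br fW.
have vf (v : 'rV[S]_q) : ((v *m f%:M) *m g) 0 0 = (v *m g) 0 0 * f.
  by rewrite mul_mx_scalar -scalemxAl mxE mulrC.
have hm := @homog_mx_scalar S sc q 2 f b hf.
have inj (v : 'rV[S]_q) :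
    I ((v *m g) 0 0) <-> I (((v *m f%:M) *m g) 0 0).
  rewrite vf; split; last exact: reg.
  by move=> hv; rewrite mulrC -[_ * _]addr0; apply: Ic.
have fC := @fres_cone S sc sc_coef l r r.+1 2 q b _ P f%:M fW hm inj.
apply: fres_eq (fC _ _ _) => [v|||k]; rewrite ?addn2 //; last by rewrite ltnS; apply: br.
split=> [[u [w [hu ->]]]|[u [s [hu hv]]]].
  exists ((u *m g) 0 0), ((w *m g) 0 0); split=> //.
  by rewrite mulmxDl -vf [LHS]mxE.
have [w hw] := surj s.
exists (v - w *m f%:M), w; split; last by rewrite subrK.
have -> : ((v - w *m f%:M) *m g) 0 0 = f * (s - (w *m g) 0 0) + u.
  have -> : ((v - w *m f%:M) *m g) 0 0 = (v *m g) 0 0 - (w *m g) 0 0 * f.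
    by rewrite mulmxBl -vf [LHS]mxE; congr (_ + _); rewrite mxE.
  by rewrite hv; ring.
exact: Ic.
Qed.

Variables (k : nat) (f : nat -> S) (alpha : nat -> S)
  (tau : nat -> {rmorphism S -> {poly S}}).
Hypothesis tau0 : forall j s, (tau j s).[0] = s.
Hypothesis tau_f : forall i j, (i < k)%N -> (j < k)%N -> tau j (f i) =
  if i == j then (f i)%:P + (alpha i)%:P * 'X + 'X^2 else (f i)%:P.
Hypothesis hf : forall i, (i < k)%N -> hentry 2 0 (f i).

Fixpoint add_ideals (I : S -> Prop) i : S -> Prop :=
  if i is j.+1 then add_ideal (add_ideals I j) (f j) else I.

Lemma ideal_add_ideals I i : ideal I -> ideal (add_ideals I i).
Proof. by move=> iI; elim: i => [|i IH] //=; apply: ideal_add_ideal. Qed.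

Lemma sub_add_ideals (I : S -> Prop) i p : I p -> add_ideals I i p.
Proof.
move=> Ip; elim: i => [|i IH] //=.
by exists p, 0; rewrite mul0r addr0.
Qed.

Lemma add_idealsP (I : S -> Prop) i p : ideal I ->
  add_ideals I i p <-> exists u (d : nat -> S), I u /\ p = u + \sum_(j < i) d j * f j.
Proof.
move=> [I0 Ic]; elim: i p => [|i IH] p /=.
  split=> [Ip|[u [d [hu ->]]]]; last by rewrite big_ord0 addr0.
  by exists p, (fun=> 0); rewrite big_ord0 addr0.
split=> [[u [s [/IH [u' [d [hu' ->]] ->]]]]|[u [d [hu ->]]]].
  exists u', (fun j => if j == i then s else d j); split=> //.
  rewrite big_ord_recr /= eqxx addrA; congr (_ + _ + _).
  by apply: eq_bigr => j _; rewrite (ltn_eqF (ltn_ord j)).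
exists (u + \sum_(j < i) d j * f j), (d i); rewrite big_ord_recr /= addrA.
by split=> //; apply/IH; exists u, d.
Qed.

Lemma stable_add_ideals I i j : (i <= j)%N -> (j < k)%N ->
  stable (tau j) I -> stable (tau j) (add_ideals I i).
Proof.
move=> ij jk st; elim: i ij => [|i IH] ij //=.
apply: stable_add_ideal; last exact: IH (ltnW ij).
by rewrite tau_f ?(ltn_trans ij) // (ltn_eqF ij).
Qed.

Lemma fres_add_ideals l r (I : S -> Prop) P :
  ideal I -> (forall s, exists v : 'rV_q, I (s - (v *m g) 0 0)) ->
  (forall j, (j < k)%N -> stable (tau j) I) -> (forall k, b k < r)%N ->
  fres l r b (fun v => I ((v *m g) 0 0)) P -> forall i, (i <= k)%N ->
  exists2 P', fres (l + i) (r + i) b (fun v => add_ideals I i ((v *m g) 0 0)) P' &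
    \sum_k 'X^(b k) - P' = (1 - 'X^2) ^+ i * (\sum_k 'X^(b k) - P).
Proof.
move=> iI surj st br fW; elim=> [|i IH] ik.
  by exists P; [rewrite !addn0 | rewrite mul1r].
have [P' fP' eP'] := IH (ltnW ik).
exists (P' + 'X^2 * (\sum_k 'X^(b k) - P')); last first.
  by rewrite (exprS _ i) -mulrA -eP'; ring.
rewrite !addnS; apply: fres_add_ideal => //.
- exact: ideal_add_ideals.
- by move=> s; have [v hv] := surj s; exists v; apply: sub_add_ideals.
- exact: hf.
- apply: (@quadratic_regular (tau i) _ _ (alpha i)) => //.
  + exact: ideal_add_ideals.
  + by apply: stable_add_ideals => //; apply: st.
  + by rewrite tau_f // eqxx.
- by move=> j; apply: leq_trans (br j) _; rewrite leq_addr.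
Qed.

End AddRegular.

(** * The star together with the disjoint edges *)

Section StarAndEdges.

Variables (K : fieldType) (S : idomainType) (iota : {rmorphism K -> S}).
Variables (n : nat) (X Y : nat -> S).

(* The universal property of K[X_0, ..., X_(n-1), Y_0, ..., Y_(n-1)]. *)
Hypothesis ev : forall (R : comNzRingType) (c : {rmorphism K -> R}) (hx hy : nat -> R),
  {h : {rmorphism S -> R} | [/\ forall a, h (iota a) = c a,
     forall i, (i < n)%N -> h (X i) = hx i & forall i, (i < n)%N -> h (Y i) = hy i]}.
Hypothesis ev_ext : forall (R : comNzRingType) (f g : {rmorphism S -> R}),
  (forall a, f (iota a) = g (iota a)) -> (forall i, (i < n)%N -> f (X i) = g (X i)) ->
  (forall i, (i < n)%N -> f (Y i) = g (Y i)) -> f =1 g.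
Hypothesis ev_ind : forall Q : S -> Prop,
  (forall u v, Q u -> Q v -> Q (u + v)) -> (forall a u, Q u -> Q (iota a * u)) ->
  (forall i u, (i < n)%N -> Q u -> Q (X i * u)) ->
  (forall i u, (i < n)%N -> Q u -> Q (Y i * u)) -> Q 1 -> forall s, Q s.

Variable sc : {rmorphism S -> {poly S}}.
Hypothesis sc_coef : forall p d, sc (sc p)`_d = ((sc p)`_d)%:P * 'X^d.
Hypothesis sc_X : forall i, (i < n)%N -> sc (X i) = (X i)%:P * 'X.
Hypothesis sc_Y : forall i, (i < n)%N -> sc (Y i) = (Y i)%:P * 'X.
Hypothesis X0_neq0 : X 0 != 0.

Definition constP : {rmorphism K -> {poly S}} := polyC \o iota.

Definition shift_spec (P Q : pred nat) := ev constP
  (fun i => (X i)%:P + (if P i then 'X else 0))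
  (fun i => (Y i)%:P + (if Q i then 'X else 0)).

Definition shift P Q : {rmorphism S -> {poly S}} := sval (shift_spec P Q).

Lemma shift_iota P Q a : shift P Q (iota a) = (iota a)%:P.
Proof. by rewrite /shift; case: (shift_spec P Q) => h [] /= -> _ _. Qed.

Lemma shift_X P Q i : (i < n)%N ->
  shift P Q (X i) = (X i)%:P + (if P i then 'X else 0).
Proof. by rewrite /shift; case: (shift_spec P Q) => h [] /= _ hx _ /hx. Qed.

Lemma shift_Y P Q i : (i < n)%N ->
  shift P Q (Y i) = (Y i)%:P + (if Q i then 'X else 0).
Proof. by rewrite /shift; case: (shift_spec P Q) => h [] /= _ _ hy /hy. Qed.

Lemma shift0 P Q s : (shift P Q s).[0] = s.
Proof.
pose f : {rmorphism S -> S} := horner_eval (0 : S) \o shift P Q.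
suff : f =1 idfun by apply.
apply: ev_ext => [a|i im|i im]; rewrite /f /= /horner_eval.
- by rewrite shift_iota hornerC.
- by rewrite shift_X // hornerD hornerC; case: ifP; rewrite ?hornerX ?horner0 addr0.
- by rewrite shift_Y // hornerD hornerC; case: ifP; rewrite ?hornerX ?horner0 addr0.
Qed.

Variables (m k : nat).
Hypothesis m2 : (1 < m)%N.
Hypothesis nE : n = (m.+1 + (k + k))%N.

Lemma star_lt i : (i <= m)%N -> (i < n)%N. Proof. by rewrite nE; lia. Qed.

Definition rho_spec := ev iota
  (fun i => if (0 < i <= m)%N then X i - Y i.-1 else X i)
  (fun i => if (i < m)%N then 0 else Y i).
Definition rho : {rmorphism S -> S} := sval rho_spec.

Lemma rho_iota a : rho (iota a) = iota a.
Proof. by rewrite /rho; case: rho_spec => h [] /= -> _ _. Qed.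
Lemma rho_X i : (i < n)%N -> rho (X i) = if (0 < i <= m)%N then X i - Y i.-1 else X i.
Proof. by rewrite /rho; case: rho_spec => h [] /= _ hx _ /hx. Qed.
Lemma rho_Y i : (i < n)%N -> rho (Y i) = if (i < m)%N then 0 else Y i.
Proof. by rewrite /rho; case: rho_spec => h [] /= _ _ hy /hy. Qed.

(* The parametrization x_i = u_i, y_i = u_i w of the matrices of rank 1, in the
   coordinates u_i - u_{i-1} w, which are called X i again. *)
Definition phiX i : {poly S} := \sum_(l < i.+1) (X l)%:P * 'X^(i - l).

Definition phi_spec := ev constP
  (fun i => if (i <= m)%N then phiX i else (X i)%:P)
  (fun i => if (i <= m)%N then phiX i * 'X else (Y i)%:P).
Definition phi : {rmorphism S -> {poly S}} := sval phi_spec.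

Lemma phi_iota a : phi (iota a) = (iota a)%:P.
Proof. by rewrite /phi; case: phi_spec => h [] /= -> _ _. Qed.
Lemma phi_X i : (i < n)%N -> phi (X i) = if (i <= m)%N then phiX i else (X i)%:P.
Proof. by rewrite /phi; case: phi_spec => h [] /= _ hx _ /hx. Qed.
Lemma phi_Y i : (i < n)%N -> phi (Y i) = if (i <= m)%N then phiX i * 'X else (Y i)%:P.
Proof. by rewrite /phi; case: phi_spec => h [] /= _ _ hy /hy. Qed.

Definition kappa_spec := ev constP (fun i => (X i)%:P)
  (fun i => if (i < m)%N then 0 else if i == m then 'X else (Y i)%:P).
Definition kappa : {rmorphism S -> {poly S}} := sval kappa_spec.

Lemma kappa_iota a : kappa (iota a) = (iota a)%:P.
Proof. by rewrite /kappa; case: kappa_spec => h [] /= -> _ _. Qed.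
Lemma kappa_X i : (i < n)%N -> kappa (X i) = (X i)%:P.
Proof. by rewrite /kappa; case: kappa_spec => h [] /= _ hx _ /hx. Qed.
Lemma kappa_Y i : (i < n)%N ->
  kappa (Y i) = if (i < m)%N then 0 else if i == m then 'X else (Y i)%:P.
Proof. by rewrite /kappa; case: kappa_spec => h [] /= _ _ hy /hy. Qed.

Lemma phiXS i : phiX i.+1 = phiX i * 'X + (X i.+1)%:P.
Proof.
rewrite /phiX big_ord_recr /= subnn expr0 mulr1; congr (_ + _).
rewrite mulr_suml; apply: eq_bigr => l _.
have li : (l <= i)%N by rewrite -ltnS.
by rewrite (subSn li) exprSr mulrA.
Qed.

(** By the recursion [phiXS], [phi] sends [X i.+1 - Y i] to the constant [X i.+1], so among the
    generators of the base only [Y m] has a nonconstant image. *)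
Lemma phi_rho a : phi (rho a) = kappa a \Po (phi (X m) * 'X).
Proof.
rewrite phi_X ?star_lt // leqnn.
pose f : {rmorphism S -> {poly S}} := phi \o rho.
pose g : {rmorphism S -> {poly S}} := (comp_poly (phiX m * 'X)) \o kappa.
apply: (ev_ext (f := f) (g := g)) => [c|i im|i im]; rewrite /f /g /=.
- by rewrite rho_iota phi_iota kappa_iota comp_polyC.
- rewrite kappa_X // comp_polyC rho_X //; case: ifP => [/andP [i0 le]|].
    case: i i0 le im => // i _ le im /=.
    rewrite rmorphB phi_X // phi_Y ?(ltnW im) // le (ltnW le) phiXS.
    by rewrite addrAC subrr add0r.
  move=> h; rewrite phi_X //; case: ifP => // le.
  have -> : i = 0%N by move: h; rewrite le andbT; case: i {le im}.
  by rewrite /phiX big_ord_recl big_ord0 addr0 subnn mulr1.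
- rewrite kappa_Y // rho_Y //; case: ltnP => [lt|ge].
    by rewrite rmorph0 comp_poly0.
  rewrite phi_Y //; case: eqP => [->|ne]; first by rewrite leqnn comp_polyX.
  have lt : (m < i)%N by rewrite ltn_neqAle ge andbT eq_sym; apply/eqP.
  by rewrite leqNgt lt comp_polyC.
Qed.

(** [rho] is recovered from [kappa] by applying [rho] to the coefficients and putting [Y m] for the
    variable. *)
Lemma kappa_inj a : kappa a = 0 -> rho a = 0.
Proof.
pose g : {rmorphism S -> S} := horner_eval (Y m) \o map_poly rho \o kappa.
suff e : rho =1 g by move=> k0; rewrite e /g /= k0 rmorph0 /horner_eval horner0.
apply: ev_ext => [c|i im|i im]; rewrite /g /= /horner_eval.
- by rewrite kappa_iota map_polyC hornerC.
- by rewrite kappa_X // map_polyC hornerC.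
- rewrite kappa_Y // rho_Y //; case: ltnP => [lt|ge].
    by rewrite rmorph0 horner0.
  case: eqP => [->|ne]; first by rewrite map_polyX hornerX.
  by rewrite map_polyC hornerC /= rho_Y // ltnNge ge.
Qed.

Local Notation base_rho := (from_base rho).

Lemma base_iota c : base_rho (iota c). Proof. by exists (iota c); rewrite rho_iota. Qed.

Lemma base_X0 : base_rho (X 0).
Proof. by exists (X 0); rewrite rho_X // nE. Qed.

Lemma base_Ym : base_rho (Y m).
Proof. by exists (Y m); rewrite rho_Y ?star_lt // ltnn. Qed.

Lemma base_theta i : (i < m)%N -> base_rho (theta X Y i).
Proof. by move=> im; exists (X i.+1); rewrite rho_X ?star_lt //= im. Qed.

(** Translating [X j.+1] and [Y j] by the same amount fixes their difference and, for [j < m], the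
    whole base. *)
Definition tau j := shift (fun i => i == j.+1) (fun i => i == j).

Lemma tau_A j a : (j < m)%N -> base_rho a -> tau j a = a%:P.
Proof.
move=> jm [s ->].
pose f : {rmorphism S -> {poly S}} := tau j \o rho.
pose g : {rmorphism S -> {poly S}} := polyC \o rho.
apply: (ev_ext (f := f) (g := g)) => [c|i im|i im]; rewrite /f /g /=.
- by rewrite rho_iota shift_iota.
- rewrite rho_X //; case: ifP => [/andP [i0 le]|h].
    case: i i0 le im => // i _ le im /=.
    rewrite rmorphB shift_X // shift_Y ?(ltnW im) // eqSS polyCB.
    by rewrite opprD addrACA subrr addr0.
  rewrite shift_X // ifF ?addr0 //; apply: contraFF h => /eqP ->.
  by rewrite jm.
- rewrite rho_Y //; case: ltnP => [lt|ge]; first by rewrite rmorph0 polyC0.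
  by rewrite shift_Y // gtn_eqF ?addr0 // (leq_trans jm).
Qed.

(** The base and [X 1], ..., [X m] generate the ring, as [Y i] differs from [X i.+1] by a base
    element for [i < m]. *)
Lemma base_ind (Q : S -> Prop) :
  (forall u v, Q u -> Q v -> Q (u + v)) -> (forall a u, base_rho a -> Q u -> Q (a * u)) ->
  (forall i u, (i < m)%N -> Q u -> Q (X i.+1 * u)) -> Q 1 -> forall s, Q s.
Proof.
move=> QD QA QX Q1; apply: ev_ind => // [a u|i u im Qu|i u im Qu].
- by apply: QA; apply: base_iota.
- case: i im => [|i] im; first by apply: QA => //; apply: base_X0.
  case: (ltnP i m) => le; first exact: QX.
  apply: QA => //; exists (X i.+1); rewrite rho_X //.
  by rewrite /= ltnNge le.
- case: (ltnP i m) => le.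
    have -> : Y i * u = X i.+1 * u + - theta X Y i * u by rewrite /theta; ring.
    by apply: QD; [apply: QX | apply: QA => //; apply/from_baseN/base_theta].
  apply: QA => //; exists (Y i); rewrite rho_Y //.
  by rewrite ltnNge le.
Qed.

Definition edge j := X (m.+1 + j) * Y (m.+1 + k + j) - X (m.+1 + k + j) * Y (m.+1 + j).

(** Both factors of the first product in [edge j] are translated, so its image is monic of degree 2
    in [t]; the other edges and the star are left alone. *)
Definition edge_shift j := shift (fun i => i == m.+1 + j)%N (fun i => i == m.+1 + k + j)%N.

Definition star_edges_ideal := add_ideals edge (star_ideal m X Y) k.

Lemma ideal_star : ideal (star_ideal m X Y).
Proof. by split; [exact: star_ideal0 | exact: star_ideal_lin]. Qed.

Lemma edge_homog i : (i < k)%N -> homog_entry sc 2 0 (edge i).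
Proof.
move=> ik; have lt1 : (m.+1 + i < n)%N by rewrite nE; lia.
have lt2 : (m.+1 + k + i < n)%N by rewrite nE; lia.
apply: hentryB; rewrite hentryE rmorphM !(sc_X, sc_Y) // polyCM; ring.
Qed.

Lemma star_edges_fres : exists2 P,
  fres sc (m + k) (3 + k) (@star_shift m)
    (fun v => star_edges_ideal ((v *m star_aug m X Y) 0 0)) P &
  \sum_i 'X^(star_shift (m := m) i) - P = (1 - 'X^2) ^+ k *
    ((1 - 'X) ^+ m * (\sum_i 'X^(basis_shift (m := m) i)) + (1 - 'X) ^+ 2).
Proof.
have sX i : (i <= m)%N -> sc (X i) = (X i)%:P * 'X by move=> h; apply/sc_X/star_lt.
have sY i : (i <= m)%N -> sc (Y i) = (Y i)%:P * 'X by move=> h; apply/sc_Y/star_lt.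
have /boolp.choice [T hT] : forall i, exists T : 'M[S]_m.+1, (0 < i <= m)%N ->
    [/\ forall k l, base_rho (T k l), homog_mx sc (fun k => basis_shift k + 1)%N (@basis_shift m) T
      & forall k : 'I_m.+1, star_ideal m X Y (X i * basis_elt X Y k - basis_comb X Y (row k T))].
  move=> i; case: (boolP (0 < i <= m)%N) => [im|_]; last by exists 0.
  by have [T hT] := mult_matrix sX sY base_X0 base_Ym base_theta im; exists T.
have phiX' i : (i <= m)%N -> phi (X i) = phiX i.
  by move=> im; rewrite phi_X ?star_lt // im.
have phiY' i : (i <= m)%N -> phi (Y i) = phi (X i) * 'X.
  by move=> im; rewrite phi_Y ?phiX' ?star_lt // im.
have tauX j i : (j < m)%N -> (i < m)%N ->
    tau j (X i.+1) = (X i.+1)%:P + (if i == j then 'X else 0).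
  by move=> _ im; rewrite shift_X ?star_lt.
have n0 : (0 < n)%N by rewrite nE.
have t0 := shift_X (fun i => i == 0%N) xpred0 n0.
have t1 := shift_X xpred0 (fun i => i == 0%N) n0.
have t2 := shift_Y xpred0 (fun i => i == 0%N) n0.
rewrite /= addr0 in t0 t1 t2.
have [P fP eP] := @star_fres S sc sc_coef m X Y m2 sX sY rho phi kappa
  phiX' phiY' phi_rho kappa_inj X0_neq0 T
  (fun i im => let: And3 h _ _ := hT i im in h)
  (fun i im => let: And3 _ h _ := hT i im in h)
  (fun i im => let: And3 _ _ h := hT i im in h)
  tau (fun j => shift0 _ _) tau_A tauX base_ind _ _ (shift0 _ _) (shift0 _ _) t0 t1 t2.
have ltE i : (i < k)%N -> (m.+1 + i < n)%N /\ (m.+1 + k + i < n)%N.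
  by rewrite nE; lia.
have tE i j : (i < k)%N -> (j < k)%N -> edge_shift j (edge i) =
    if i == j then (edge i)%:P + (X (m.+1 + i) + Y (m.+1 + k + i))%:P * 'X + 'X^2
    else (edge i)%:P.
  move=> ik jk; have [l1 l2] := ltE i ik.
  rewrite /edge rmorphB !rmorphM !(shift_X, shift_Y) // !eqn_add2l.
  have -> : (m.+1 + k + i == m.+1 + j)%N = false by lia.
  have -> : (m.+1 + i == m.+1 + k + j)%N = false by lia.
  by case: eqP => _; rewrite ?polyCB ?polyCD !polyCM; ring.
have st j : (j < k)%N -> stable (edge_shift j) (star_ideal m X Y).
  move=> jk p e [c ->]; rewrite rmorph_sum coef_sum; apply: star_ideal_sum => i _.
  have im : (i <= m)%N by rewrite -ltnS.
  rewrite rmorphM; have -> : edge_shift j (star_gen X Y i) = (star_gen X Y i)%:P.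
    rewrite /star_gen rmorphB !rmorphM !(shift_X, shift_Y) ?star_lt //.
    have -> : (0 == m.+1 + j)%N = false by [].
    have -> : (i == m.+1 + j :> nat)%N = false by lia.
    have -> : (0 == m.+1 + k + j)%N = false by [].
    have -> : (i == m.+1 + k + j :> nat)%N = false by lia.
    by rewrite !addr0 polyCB !polyCM.
  by rewrite coefMC mulrC -mulrC; apply: star_idealM; apply: star_ideal_gen.
have surj s : exists v : 'rV[S]_(m.+1 + 1), star_ideal m X Y (s - (v *m star_aug m X Y) 0 0).
  exists (row_mx 0 s%:M); rewrite mul_row_col mul0mx add0r mulmx1 !mxE mulr1n subrr.
  exact: star_ideal0.
have br i : (star_shift (m := m) i < 3)%N.
  by apply: (shift_catP (T := fun x => x < 3)%N) => // l; rewrite ltnS basis_shift_le.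
have [P' fP' eP'] := fres_add_ideals sc_coef (fun j => shift0 _ _) tE edge_homog
  ideal_star surj st br fP (leqnn k).
by exists P' => //; rewrite eP' eP.
Qed.

Lemma star_edges_graded p d : star_edges_ideal p -> star_edges_ideal (sc p)`_d.
Proof.
have sX i : (i <= m)%N -> sc (X i) = (X i)%:P * 'X by move=> h; apply/sc_X/star_lt.
have sY i : (i <= m)%N -> sc (Y i) = (Y i)%:P * 'X by move=> h; apply/sc_Y/star_lt.
move=> /(add_idealsP _ _ _ ideal_star) [u [c [hu ->]]].
apply/(add_idealsP _ _ _ ideal_star).
exists (sc u)`_d, (fun j => (sc (c j) * 'X^2)`_d); split; first exact: star_ideal_graded.
rewrite rmorphD coefD rmorph_sum coef_sum; congr (_ + _).
apply: eq_bigr => i _; have := edge_homog (ltn_ord i); rewrite hentryE rmorphM => ->.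
by rewrite mulrCA mulrC coefMC.
Qed.

End StarAndEdges.

(** * A chain of primes of maximal length *)

Section PrimeChain.

Variables (K : fieldType) (S : idomainType) (iota : {rmorphism K -> S}).
Variables (n : nat) (X Y : nat -> S).
Hypothesis ev : forall (R : comNzRingType) (c : {rmorphism K -> R}) (hx hy : nat -> R),
  {h : {rmorphism S -> R} | [/\ forall a, h (iota a) = c a,
     forall i, (i < n)%N -> h (X i) = hx i & forall i, (i < n)%N -> h (Y i) = hy i]}.
Hypothesis ev_ext : forall (R : comNzRingType) (f g : {rmorphism S -> R}),
  (forall a, f (iota a) = g (iota a)) -> (forall i, (i < n)%N -> f (X i) = g (X i)) ->
  (forall i, (i < n)%N -> f (Y i) = g (Y i)) -> f =1 g.
Hypothesis X_neq0 : forall i, (i < n)%N -> X i != 0.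
Hypothesis Y_neq0 : forall i, (i < n)%N -> Y i != 0.
Variables (m k : nat).
Hypothesis nE : n = (m.+1 + (k + k))%N.

(* The order in which the variables are sent to 0: first those of the leaves,
   then X_p', Y_p and X_p for the edges {p, p'}. *)
Definition rankX i := (if i <= m then i.-1
  else if i <= m + k then m.*2 + k.*2 + (i - m.+1) else m.*2 + (i - m.+1 - k))%N.
Definition rankY i := (if i <= m then m + i.-1 else m.*2 + k + (i - m.+1))%N.

Definition liveX t i := if (i == 0%N) || (rankX i < t)%N then 0 else X i.
Definition liveY t i := if (i == 0%N) || (rankY i < t)%N then 0 else Y i.

(* A generic point of the component x_0 = y_0 = 0: the columns p and p' of
   each edge are made proportional by (x, y) = (x_p, x_p y_p), (x_p', x_p' y_p). *)
Definition chain_spec t := ev iota (liveX t)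
  (fun i => if (i <= m)%N then liveY t i
            else liveX t i * liveY t (if (i <= m + k)%N then i else i - k)%N).
Definition chain_hom t : {rmorphism S -> S} := sval (chain_spec t).

Lemma chain_iota t a : chain_hom t (iota a) = iota a.
Proof. by rewrite /chain_hom; case: chain_spec => h [] /= -> _ _. Qed.
Lemma chain_X t i : (i < n)%N -> chain_hom t (X i) = liveX t i.
Proof. by rewrite /chain_hom; case: chain_spec => h [] /= _ hx _ /hx. Qed.
Lemma chain_Y t i : (i < n)%N -> chain_hom t (Y i) =
  if (i <= m)%N then liveY t i
  else liveX t i * liveY t (if (i <= m + k)%N then i else i - k)%N.
Proof. by rewrite /chain_hom; case: chain_spec => h [] /= _ _ hy /hy. Qed.

Definition kill_spec t := ev iota
  (fun i => if rankX i == t then 0 else X i) (fun i => if rankY i == t then 0 else Y i).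
Definition kill t : {rmorphism S -> S} := sval (kill_spec t).

Lemma kill_iota t a : kill t (iota a) = iota a.
Proof. by rewrite /kill; case: kill_spec => h [] /= -> _ _. Qed.
Lemma kill_X t i : (i < n)%N -> kill t (liveX t i) = liveX t.+1 i.
Proof.
move=> im; rewrite /liveX ltnS; case: (i == 0%N) => /=; first exact: rmorph0.
have h : kill t (X i) = if rankX i == t then 0 else X i.
  by rewrite /kill; case: kill_spec => f [] /= _ hh _; apply: hh.
by case: (ltngtP (rankX i) t) h => //= _ h; exact: rmorph0.
Qed.
Lemma kill_Y t i : (i < n)%N -> kill t (liveY t i) = liveY t.+1 i.
Proof.
move=> im; rewrite /liveY ltnS; case: (i == 0%N) => /=; first exact: rmorph0.
have h : kill t (Y i) = if rankY i == t then 0 else Y i.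
  by rewrite /kill; case: kill_spec => f [] /= _ _ hh; apply: hh.
by case: (ltngtP (rankY i) t) h => //= _ h; exact: rmorph0.
Qed.

Lemma chain_step t : chain_hom t.+1 =1 kill t \o chain_hom t.
Proof.
pose g : {rmorphism S -> S} := kill t \o chain_hom t.
apply: (ev_ext (g := g)) => [a|i im|i im]; rewrite /g /=.
- by rewrite !chain_iota kill_iota.
- by rewrite !chain_X // kill_X.
- rewrite !chain_Y //; case: ifP => _; first by rewrite kill_Y.
  rewrite rmorphM kill_X // kill_Y //.
  by case: ifP => // _; apply: leq_ltn_trans im; apply: leq_subr.
Qed.

Lemma chain_ideal t u : star_edges_ideal X Y m k u -> chain_hom t u = 0.
Proof.
move=> /(add_idealsP _ _ _ (ideal_star X Y m)) [v [d [[c ->] ->]]].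
rewrite rmorphD !rmorph_sum !big1 ?addr0 // => i _; rewrite rmorphM.
  rewrite /edge rmorphB !rmorphM !(chain_X, chain_Y); try by have := ltn_ord i; lia.
  have -> : (m.+1 + k + i <= m)%N = false by lia.
  have -> : (m.+1 + i <= m)%N = false by lia.
  have -> : (m.+1 + k + i <= m + k)%N = false by lia.
  have -> : (m.+1 + i <= m + k)%N = true by have := ltn_ord i; lia.
  have -> : (m.+1 + k + i - k = m.+1 + i)%N by lia.
  by rewrite mulrCA subrr mulr0.
have im : (i <= m)%N by rewrite -ltnS.
rewrite /star_gen rmorphB !rmorphM !(chain_X, chain_Y); try by lia.
by rewrite /liveX /liveY /= !mul0r mulr0 subrr mulr0.
Qed.

Definition chain_prime t u := chain_hom t u = 0.

Lemma prime_chain_prime t : prime_like (chain_prime t) /\ ~ chain_prime t 1.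
Proof.
rewrite /chain_prime; split; last by rewrite rmorph1 => /eqP; rewrite oner_eq0.
split=> [|a u v|u v]; first exact: rmorph0.
  by rewrite rmorphD rmorphM => -> ->; rewrite mulr0 addr0.
by rewrite rmorphM => /eqP; rewrite mulf_eq0 => /orP [] /eqP; [left|right].
Qed.

Lemma chain_strict t : (t < m.*2 + 3 * k)%N ->
  (forall u, chain_prime t u -> chain_prime t.+1 u) /\
  exists2 f, chain_prime t.+1 f & ~ chain_prime t f.
Proof.
move=> tm; split; first by move=> u h; rewrite /chain_prime chain_step /= h rmorph0.
have useX i : (0 < i < n)%N -> rankX i = t ->
    exists2 f, chain_prime t.+1 f & ~ chain_prime t f.
  move=> /andP [i0 im] r; exists (X i); rewrite /chain_prime chain_X // /liveX r.
    by rewrite ltnSn orbT.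
  rewrite ltnn orbF (gtn_eqF i0); exact/eqP/X_neq0.
(* On an edge the image of [Y i] is a product with [X i], so it detects the step only while [X i] is
   alive; this is why [X i] comes later in the order. *)
have useY i : (0 < i <= m + k)%N -> rankY i = t -> ((m < i)%N -> (t <= rankX i)%N) ->
    exists2 f, chain_prime t.+1 f & ~ chain_prime t f.
  move=> /andP [i0 im] r al.
  have im' : (i < n)%N by lia.
  have l1 : liveY t.+1 i = 0 by rewrite /liveY r ltnSn orbT.
  have l0 : liveY t i != 0 by rewrite /liveY r ltnn orbF (gtn_eqF i0) Y_neq0.
  exists (Y i); rewrite /chain_prime chain_Y // im.
    by case: ifP => _; rewrite l1 ?mulr0.
  case: leqP => h; first exact/eqP.
  apply/eqP; rewrite mulf_neq0 // /liveX (gtn_eqF i0) /= ltnNge al //=.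
  exact: X_neq0.
have [h1|h1] := ltnP t m.
  by apply: (useX t.+1); [lia | rewrite /rankX; case: ifP; lia].
have [h2|h2] := ltnP t m.*2.
  apply: (useY (t - m).+1); [lia | rewrite /rankY; case: ifP; lia | lia].
have [h3|h3] := ltnP t (m.*2 + k).
  apply: (useX (m.+1 + k + (t - m.*2))%N); first by lia.
  by rewrite /rankX; case: ifP; [lia|]; case: ifP; lia.
have [h4|h4] := ltnP t (m.*2 + k.*2).
  apply: (useY (m.+1 + (t - m.*2 - k))%N); first by lia.
    by rewrite /rankY; case: ifP; lia.
  by rewrite /rankX => _; case: ifP; [lia|]; case: ifP; lia.
apply: (useX (m.+1 + (t - m.*2 - k.*2))%N); first by lia.
by rewrite /rankX; case: ifP; [lia|]; case: ifP; lia.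
Qed.

End PrimeChain.

(** * The binomial edge ideal *)

Section Instance.

Variables (K : fieldType) (n' : nat).
Local Notation n := n'.+1.
Local Notation S := {mpoly K[n + n]}.

Definition Xn (i : nat) : S := xvar K (inord i : 'I_n).
Definition Yn (i : nat) : S := yvar K (inord i : 'I_n).

Lemma mpoly_ev (R : comNzRingType) (c : {rmorphism K -> R}) (hx hy : nat -> R) :
  {h : {rmorphism S -> R} | [/\ forall a, h (@mpolyC (n + n) K a) = c a,
     forall i, (i < n)%N -> h (Xn i) = hx i & forall i, (i < n)%N -> h (Yn i) = hy i]}.
Proof.
pose v (i : 'I_(n + n)) := match split i with inl j => hx j | inr j => hy j end.
exists (mmap c v); split=> [a|i im|i im].
- exact: mmapC.
- transitivity (mmap c v 'X_(lshift n (inord i : 'I_n))) => //.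
  by rewrite mmapX mmap1U /v (unsplitK (inl _)) inordK.
- transitivity (mmap c v 'X_(rshift n (inord i : 'I_n))) => //.
  by rewrite mmapX mmap1U /v (unsplitK (inr _)) inordK.
Qed.

Lemma mpoly_var (i : 'I_(n + n)) : exists j, (j < n)%N /\
  (('X_i : S) = Xn j \/ ('X_i : S) = Yn j).
Proof.
rewrite -[i]splitK; case: (split i) => j; exists (nat_of_ord j); split=> //.
  by left; rewrite /Xn inord_val.
by right; rewrite /Yn inord_val.
Qed.

Lemma mpoly_ev_ext (R : comNzRingType) (f g : {rmorphism S -> R}) :
  (forall a, f (@mpolyC (n + n) K a) = g (@mpolyC (n + n) K a)) ->
  (forall i, (i < n)%N -> f (Xn i) = g (Xn i)) ->
  (forall i, (i < n)%N -> f (Yn i) = g (Yn i)) -> f =1 g.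
Proof.
move=> h1 h2 h3; apply: rmorph_mpoly_ext => // i.
by have [j [jn [->|->]]] := mpoly_var i; [apply: h2 | apply: h3].
Qed.

Lemma mpoly_ev_ind (Q : S -> Prop) :
  (forall u v, Q u -> Q v -> Q (u + v)) ->
  (forall a u, Q u -> Q (@mpolyC (n + n) K a * u)) ->
  (forall i u, (i < n)%N -> Q u -> Q (Xn i * u)) ->
  (forall i u, (i < n)%N -> Q u -> Q (Yn i * u)) -> Q 1 -> forall s, Q s.
Proof.
move=> QD QC QX QY Q1.
have Qv i u : Q u -> Q ('X_i * u).
  by have [j [jn [->|->]]] := mpoly_var i; [apply: QX | apply: QY].
elim/mpolyind => [|c m p _ _ Qp]; first by have := QC 0 _ Q1; rewrite mpolyC0 mul0r.
apply: QD => //; rewrite -mul_mpolyC; apply: QC.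
rewrite mpolyXE_id.
suff h (r : seq 'I_(n + n)) : Q (\prod_(i <- r) 'X_i ^+ m i) by apply: h.
elim: r => [|i r IH]; first by rewrite big_nil.
rewrite big_cons; elim: (m i) => [|e IHe]; first by rewrite expr0 mul1r.
by rewrite exprS -mulrA; apply: Qv.
Qed.

Lemma scaleX_Xn i : (i < n)%N -> scaleX (Xn i) = (Xn i)%:P * 'X.
Proof. by move=> _; apply: scaleXX. Qed.

Lemma scaleX_Yn i : (i < n)%N -> scaleX (Yn i) = (Yn i)%:P * 'X.
Proof. by move=> _; apply: scaleXX. Qed.

Lemma mpolyX_neq0 (i : 'I_(n + n)) : ('X_i : S) != 0.
Proof.
apply/eqP => /(congr1 (mcoeff U_(i))).
by rewrite mcoeffX eqxx mcoeff0 => /eqP; rewrite oner_eq0.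
Qed.

Variables (m k : nat).
Hypothesis n'E : n' = (m + (k + k))%N.

Definition arc (i j : nat) := ((i == 0%N) && (0 < j <= m)%N) ||
  ((m < i <= m + k)%N && (j == i + k)%N).
Definition star_edges : rel 'I_n := fun i j => arc i j || arc j i.

Lemma ideal_binomial_edge_ideal : ideal (binomial_edge_ideal K star_edges).
Proof.
split.
  exists (fun _ _ => 0); rewrite big1 // => i _; rewrite big1 // => j _.
  by rewrite mul0r.
move=> a _ _ [c ->] [d ->]; exists (fun i j => a * c i j + d i j).
rewrite mulr_sumr -big_split; apply: eq_bigr => i _.
rewrite mulr_sumr -big_split; apply: eq_bigr => j _.
by rewrite mulrDl mulrA.
Qed.

Definition edge_binomial (i j : nat) : S := Xn i * Yn j - Xn j * Yn i.

Lemma binomial_edge_ideal_gen (i j : nat) : (i < n)%N -> (j < n)%N -> arc i j ->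
  binomial_edge_ideal K star_edges (edge_binomial i j).
Proof.
move=> im jm ij.
exists (fun a b => ((a == i :> nat) && (b == j :> nat))%:R).
rewrite (bigD1 (inord i)) //= [X in _ + X]big1 ?addr0 => [|a ne]; last first.
  apply: big1 => b _; case: (a =P i :> nat) => [ai|]; last by rewrite mul0r.
  by case/eqP: ne; apply: val_inj; rewrite /= inordK.
rewrite (bigD1 (inord j)) /=; last by rewrite /star_edges !inordK // ij.
rewrite [X in _ + X]big1 ?addr0 => [|b /andP [_ ne]]; last first.
  case: (b =P j :> nat) => [bj|]; last by rewrite andbF mul0r.
  by case/eqP: ne; apply: val_inj; rewrite /= inordK.
by rewrite !inordK // !eqxx mul1r.
Qed.

Lemma binomial_edge_idealE p : binomial_edge_ideal K star_edges p <-> star_edges_ideal Xn Yn m k p.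
Proof.
have iS := ideal_star Xn Yn m.
have [B0 Bc] := ideal_binomial_edge_ideal.
have [I0 Ic] : ideal (star_edges_ideal Xn Yn m k) by apply: ideal_add_ideals.
split=> [[c ->]|/(add_idealsP _ _ _ iS) [u [d [[c ->] ->]]]].
  have sum_I (T : finType) (Pr : pred T) (F : T -> S) :
      (forall i, Pr i -> star_edges_ideal Xn Yn m k (F i)) ->
      star_edges_ideal Xn Yn m k (\sum_(i | Pr i) F i).
    move=> h; apply: big_ind => // u v hu hv; rewrite -[u]mul1r; exact: Ic.
  have garc i j : (i < n)%N -> (j < n)%N -> arc i j ->
      star_edges_ideal Xn Yn m k (edge_binomial i j).
    move=> im jm /orP [/andP [/eqP -> /andP [_ le]]|/andP [/andP [l1 l2] /eqP ->]].
      by apply: sub_add_ideals; apply: star_ideal_gen.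
    apply/(add_idealsP _ _ _ iS); have [J00 _] := iS.
    exists 0, (fun a => (a == (i - m.+1)%N)%:R); split=> //.
    have lt : (i - m.+1 < k)%N by lia.
    rewrite add0r (bigD1 (Ordinal lt)) //= eqxx mul1r big1 ?addr0 => [|a ne].
      rewrite /edge_binomial /edge; have -> : (m.+1 + (i - m.+1) = i)%N by lia.
      by have -> : (m.+1 + k + (i - m.+1) = i + k)%N by lia.
    case: eqP => [ai|]; last by rewrite mul0r.
    by case/eqP: ne; apply: val_inj.
  apply: (sum_I) => i _; apply: (sum_I) => j ij.
  rewrite -[_ * _]addr0; apply: (Ic) => //.
  have -> : xvar K i * yvar K j - xvar K j * yvar K i = edge_binomial i j.
    by rewrite /edge_binomial /Xn /Yn !inord_val.
  (* The sum runs over both orientations of an edge, whose binomials differ by a sign. *)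
  case/orP: ij => ij; first exact: garc.
  have -> : edge_binomial i j = -1 * edge_binomial j i + 0.
    by rewrite /edge_binomial addr0 mulN1r opprB.
  by apply: (Ic) => //; apply: garc.
pose B := binomial_edge_ideal K star_edges.
have BD f g : B f -> B g -> B (f + g).
  by move=> hf hg; rewrite -[f]mul1r; apply: Bc.
have BM a f : B f -> B (a * f).
  by move=> hf; rewrite -[_ * _]addr0; apply: Bc.
apply: (BD).
  apply: big_ind => // i _; apply: (BM); case: (posnP i) => [->|i0].
    have -> : star_gen Xn Yn 0 = 0 by rewrite /star_gen subrr.
    exact: (B0).
  apply: binomial_edge_ideal_gen => //; first by have := ltn_ord i; lia.
  by rewrite /arc /= i0 -ltnS ltn_ord.
apply: big_ind => // i _; apply: (BM).
have := ltn_ord i => ik.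
apply: binomial_edge_ideal_gen; [lia | lia |].
by rewrite /arc; apply/orP; right; apply/andP; split; [lia | apply/eqP; lia].
Qed.

End Instance.

(** * The h-polynomial and its degree *)

Section HPolynomial.

Variables (m k : nat).

(** From here on [m] stands for [s - r], so the star has [m.+2] leaves and the exponent [m] needs no
    subtraction. *)
Definition star_h : {poly int} :=
  (1 + 'X) ^+ k * (1 + ('X *+ 2 + 'X^2 *+ m.+1) * (1 - 'X) ^+ m).

Lemma star_K_polynomial :
  (1 - 'X^2) ^+ k * ((1 - 'X) ^+ m.+2 * (\sum_i 'X^(basis_shift (m := m.+2) i)) + (1 - 'X) ^+ 2)
  = star_h * (1 - 'X) ^+ (k + 2).
Proof.
have -> : \sum_i 'X^(basis_shift (m := m.+2) i) = 'X *+ 2 + 'X^2 *+ m.+1 :> {poly int}.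
  rewrite !big_ord_recl /= addrA (eq_bigr (fun=> 'X^2)) => [|i _].
    by rewrite sumr_const card_ord /basis_shift /basis_deg /= expr1 mulr2n ['X^2 *+ m.+1]mulrS.
  by [].
have -> : 1 - 'X^2 = (1 + 'X) * (1 - 'X) :> {poly int} by ring.
rewrite /star_h exprMn !exprD !exprS; ring.
Qed.

Lemma size_1subX : size (1 - 'X : {poly int}) = 2%N.
Proof. by rewrite -opprB size_polyN size_XsubC. Qed.

Lemma size_1subX_exp j : size ((1 - 'X : {poly int}) ^+ j) = j.+1.
Proof.
rewrite polySpred ?expf_neq0 -?size_poly_gt0 ?size_1subX //.
by rewrite size_exp size_1subX mul1n.
Qed.

Lemma size_star_h : size star_h = (k + m.+2).+1.
Proof.
have s1 : size ((1 + 'X : {poly int}) ^+ k) = k.+1.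
  have s0 : size (1 + 'X : {poly int}) = 2%N by rewrite addrC size_XaddC.
  rewrite polySpred ?expf_neq0 -?size_poly_gt0 ?s0 //.
  by rewrite size_exp s0 mul1n.
have c0 : (m.+1%:Z%:P : {poly int}) != 0 by rewrite polyC_eq0.
have s2 : size ('X *+ 2 + 'X^2 *+ m.+1 : {poly int}) = 3%N.
  have e : size ('X^2 *+ m.+1 : {poly int}) = 3%N.
    have -> : 'X^2 *+ m.+1 = m.+1%:Z%:P * 'X^2 :> {poly int}.
      by rewrite mul_polyC -scaler_nat natz.
    by rewrite size_Cmul // size_polyXn.
  rewrite addrC size_polyDl // e -scaler_nat.
  by apply: leq_ltn_trans (size_scale_leq _ _) _; rewrite size_polyX.
have n2 : ('X *+ 2 + 'X^2 *+ m.+1 : {poly int}) != 0 by rewrite -size_poly_gt0 s2.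
have s3 : size (('X *+ 2 + 'X^2 *+ m.+1) * (1 - 'X) ^+ m : {poly int}) = m.+3.
  by rewrite size_mul // -?size_poly_gt0 ?size_1subX_exp // s2.
have s4 : size (1 + ('X *+ 2 + 'X^2 *+ m.+1) * (1 - 'X) ^+ m : {poly int}) = m.+3.
  by rewrite addrC size_polyDl // s3 size_poly1.
by rewrite /star_h size_mul -?size_poly_gt0 ?s1 ?s4 // addSn addnS.
Qed.

(** The index is the length [m.+2 + k] of the resolution plus the regularity [k + 2]; it is the
    degree of the K-polynomial. *)
Lemma star_K_top :
  (star_h * (1 - 'X) ^+ (k + 2))`_(m.+2 + k + (k + 2)) != 0.
Proof.
have sz : size (star_h * (1 - 'X) ^+ (k + 2)) = (m.+2 + k + (k + 2)).+1.
  rewrite size_mul -?size_poly_gt0 ?size_star_h ?size_1subX_exp //.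
  by lia.
rewrite -[X in _`_X]/((m.+2 + k + (k + 2)).+1.-1) -sz -/(lead_coef _).
by rewrite lead_coef_eq0 -size_poly_gt0 sz.
Qed.

End HPolynomial.

(** * Regularity, Hilbert series and dimension of the binomial edge ideal *)

Section Main.

Variables (K : fieldType) (m k : nat).
Local Notation n' := (m.+2 + (k + k))%N.
Local Notation n := n'.+1.
Local Notation S := {mpoly K[n + n]}.
Local Notation e := (@star_edges n' m.+2 k).
Local Notation I := (binomial_edge_ideal K e).
Local Notation g := (star_aug m.+2 (Xn K n') (Yn K n')).
Local Notation b := (@star_shift m.+2).

Lemma vertices : n = (m.+3 + (k + k))%N. Proof. by []. Qed.

Lemma edge_ideal_fres : exists2 P,
  fres (@scaleX K (n + n)) (m.+2 + k) (3 + k) b (fun v => I ((v *m g) 0 0)) P &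
  \sum_i 'X^(b i) - P = star_h m k * (1 - 'X) ^+ (k + 2).
Proof.
have [P fP eP] := star_edges_fres (@mpoly_ev K n') (@mpoly_ev_ext K n')
  (@mpoly_ev_ind K n') (@scaleX_coef K (n + n)) (@scaleX_Xn K n') (@scaleX_Yn K n')
  (mpolyX_neq0 _ _) (isT : (1 < m.+2)%N) vertices.
exists P; last by rewrite -star_K_polynomial -eP.
by apply: fres_eq fP => v; apply: iff_sym; apply: binomial_edge_idealE.
Qed.

Lemma edge_idealD f f' : I f -> I f' -> I (f + f').
Proof. by move=> hf hf'; rewrite -[f]mul1r; apply: (ideal_binomial_edge_ideal K n' m.+2 k).2. Qed.

Lemma edge_ideal_graded f d : I f -> I (scaleX f)`_d.
Proof.
move/(binomial_edge_idealE (erefl n')) => hf; apply/(binomial_edge_idealE (erefl n')).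
exact: (star_edges_graded (@scaleX_Xn K n') (@scaleX_Yn K n') (mpolyX_neq0 _ _) (isT : (1 < m.+2)%N) vertices d hf).
Qed.

Lemma edge_ideal_aug_homog i : homog_entry (@scaleX K (n + n)) (b i) 0 (g i 0).
Proof.
apply: star_aug_homog => j jm.
  by apply: scaleX_Xn; lia.
by apply: scaleX_Yn; lia.
Qed.

Lemma edge_ideal_aug_surj f : exists v : 'rV_(m.+3 + 1), I (f - (v *m g) 0 0).
Proof.
exists (row_mx 0 f%:M); rewrite mul_row_col mul0mx add0r mulmx1 !mxE mulr1n subrr.
exact: (ideal_binomial_edge_ideal K n' m.+2 k).1.
Qed.

Lemma edge_ideal_regularity : is_regularity I (k + 2).
Proof.
have [P fP eP] := edge_ideal_fres.
apply: (regularity_of_fres edge_idealD edge_ideal_aug_homog edge_ideal_aug_surj (l := (m.+2 + k)%N) (P := P)).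
- by have -> : ((k + 2).+1 = 3 + k)%N by lia.
- move=> i; apply: (shift_catP (T := fun x => x <= k + 2)%N) => // l.
  by apply: leq_trans (basis_shift_le l) _; rewrite leq_addl.
- by rewrite eP star_K_top.
Qed.

Definition edge_ideal_dim := (m.+2.*2 + 3 * k)%N.

Lemma edge_ideal_hilbert : exists H : nat -> nat, (forall i, is_hilbert_value I i (H i)) /\
  (forall i, (H i)%:Z = hilbert_coef (binom (n + n)) (star_h m k * (1 - 'X) ^+ (n + n - edge_ideal_dim)) i).
Proof.
have [P fP eP] := edge_ideal_fres.
have /boolp.choice [H hH] : forall i, exists c : nat,
   is_hilbert_value I i c /\ c%:Z = hilbert_coef (binom (n + n)) (\sum_i 'X^(b i) - P) i.
  move=> i; have [c cE hc] := hilbert_of_fres (isT : (0 < n + n)%N)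
    edge_idealD edge_ideal_graded edge_ideal_aug_homog edge_ideal_aug_surj fP i.
  by exists c.
exists H; split=> i; first by case: (hH i).
case: (hH i) => _ ->; rewrite eP.
(* The codimension is 2 for [x_0 = y_0 = 0] and one more for each edge. *)
by have -> : (n + n - edge_ideal_dim = k + 2)%N by rewrite /edge_ideal_dim; lia.
Qed.

Lemma chain_prime_ideal (P : set S) :
  prime_like P /\ ~ P 1 -> is_prime_ideal P.
Proof.
move=> [[P0 Pc Pp] P1]; split.
  split; first exact/mem_set.
    by apply/negP => /set_mem.
  by move=> a u v /set_mem hu /set_mem hv; apply/mem_set; apply: Pc.
by move=> u v /set_mem /Pp [h|h]; apply/orP; [left|right]; apply/mem_set.
Qed.

Lemma prime_ideal_like (P : set S) : is_prime_ideal P -> prime_like P /\ ~ P 1.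
Proof.
move=> [[/set_mem P0 P1 Pc] Pp]; split; last by move=> h; case/negP: P1; apply/mem_set.
split=> // [a u v hu hv|u v h].
  by apply/set_mem; apply: Pc; apply/mem_set.
by have /orP [/set_mem|/set_mem] := Pp _ _ (mem_set h); [left|right].
Qed.

Lemma edge_ideal_krull_dim : is_krull_dim I edge_ideal_dim.
Proof.
have X0 i : (i < n)%N -> Xn K n' i != 0 by move=> _; apply: mpolyX_neq0.
have Y0 i : (i < n)%N -> Yn K n' i != 0 by move=> _; apply: mpolyX_neq0.
split.
  exists (fun t => chain_prime (@mpoly_ev K n') m.+2 k t); split=> t tm.
    split.
      by apply: chain_prime_ideal; apply: prime_chain_prime.
    move=> u /(binomial_edge_idealE (erefl n')) hu; rewrite /= /chain_prime.
    exact: (chain_ideal _ vertices).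
  have [sub [f f1 f0]] := chain_strict (@mpoly_ev K n') (@mpoly_ev_ext K n') X0 Y0 vertices tm.
  by split=> [u|h]; [apply: sub | apply: f0; apply: h].
move=> d P [hP hlt].
have [H [hH HE]] := edge_ideal_hilbert.
have d0 : (0 < edge_ideal_dim)%N by [].
have dN : (edge_ideal_dim <= n + n)%N by rewrite /edge_ideal_dim; lia.
have [C HC] := hilbert_bound d0 dN HE.
apply: (@krull_bound S (@scaleX K (n + n)) (@scaleX1 K _) (@scaleX_coef K _) K
  (@mpolyC (n + n) K) I H edge_idealD _ _ edge_ideal_dim C d P) => //.
- exact: (ideal_binomial_edge_ideal K n' m.+2 k).1.
- move=> i; have [B [_ _ hB]] := hH i; exists B => f /dhomog_hentry /hB [c hc].
  exists c; move: hc; congr I; congr (_ - _).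
  by apply: eq_bigr => j _; rewrite mul_mpolyC.
- by move=> t td; have [/prime_ideal_like] := hP t td.
- move=> t td; have [sub nsub] := hlt t td; split=> //.
  apply: boolp.contrapT => no; apply: nsub => f hf.
  by apply: boolp.contrapT => nf; apply: no; exists f.
- by have [_] := hP 0%N isT; apply.
Qed.

End Main.

Local Close Scope ring_scope.

Theorem theorem0p1 (K : fieldType) (r s : nat) (hr : 2 <= r) (hrs : r <= s) :
  exists (n : nat) (e : rel 'I_n),
  [/\ 0 < n,
      ssrbool.symmetric e,
      irreflexive e,
      is_regularity (binomial_edge_ideal K e) r
    & exists h : {poly int},
        is_h_polynomial (binomial_edge_ideal K e) h /\ size h = s.+1].
Proof.
have [m sE] : exists m, s = m + r by exists (s - r); rewrite subnK.
have [k rE] : exists k, r = k + 2 by exists (r - 2); rewrite subnK.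
exists (m.+2 + (k + k)).+1, (@star_edges (m.+2 + (k + k)) m.+2 k); split=> //.
- by move=> i j; rewrite /star_edges orbC.
- by move=> i; rewrite /star_edges orbb /arc; apply/negP => /orP [/andP [/eqP]|/andP [? /eqP]]; lia.
- by rewrite rE; apply: edge_ideal_regularity.
- exists (star_h m k); split; last by rewrite size_star_h sE rE; congr S; lia.
  have [H [hH HE]] := edge_ideal_hilbert K m k.
  exists (edge_ideal_dim m k), H; split=> //; first exact: edge_ideal_krull_dim.
  by apply: hilbert_h HE; rewrite /edge_ideal_dim; lia.
Qed.
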